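(* Let $\{X(n)\}_{n\ge0}$ be a time-homogeneous real-valued Markov chain, and for each $x$ let $\xi(x)$ be a random variable distributed as the jump of the chain from the state $x$. Assume that $\mathbf E[\xi(x)]=0$ and $\mathbf E[\xi^2(x)]=1$ for all $x$, and that there is a positive random variable $Y$ with finite second moment such that $\mathbf P(|\xi(x)|>y)\le\mathbf P(Y>y)$ for all $x$ and all $y\ge0$. Let $\tau:=\inf\{n\ge1:\ X(n)\le0\}$ and $V(x):=x-\mathbf E_x[X(\tau)]$. Fix any sequence $\delta_n\downarrow0$ and any $x_0>0$. Then: (i) Uniformly in $x\in[x_0,\delta_n\sqrt n]$, $$\mathbf P_x(\tau>n)\sim\sqrt{\frac2\pi}\,\frac{V(x)}{\sqrt n},\quad n\to\infty .$$ (ii) For any $v\ge0$, uniformly in $x\in[x_0,\delta_n\sqrt n]$, $$\mathbf P_x\left(\frac{X(n)}{\sqrt n}>v\ \Big|\ \tau>n\right)\to e^{-v^2/2}\quad\text{as }n\to\infty .$$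
   Context: $\mathbf P_x$ and $\mathbf E_x$ denote probability and expectation for the chain conditioned on $X(0)=x$. The law of $\xi(x)$ is $\mathbf P(\xi(x)\in B)=\mathbf P(X(1)-x\in B\mid X(0)=x)$. Under the stated assumptions $V(x)$ is finite and positive for $x>0$. ''Uniformly'' means that the convergence (of the ratio to $1$ in (i)) is uniform over the indicated $n$-dependent interval of starting points. *)

(* Defs.v *)
From HB Require Import structures.
From mathcomp Require Import all_boot all_order all_algebra.
From mathcomp Require Import all_classical all_reals all_analysis.
Set Implicit Arguments.
Unset Strict Implicit.
Unset Printing Implicit Defensive.
Import Order.TTheory GRing.Theory Num.Theory.
Import numFieldNormedType.Exports.
Local Open Scope classical_set_scope.
Local Open Scope ring_scope.

(** [Pr x] plays the role of P_x: the law of the chain conditioned on X(0) = x,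
    given as a family of probability measures on one sample space.  The Markov
    property says that, under every [Pr x], [K (X n) B] is a version of
    P(X(n+1) \in B | X(0), ..., X(n)), with a kernel [K] that depends neither on
    the time n nor on the starting point x. *)
Definition time_homogeneous_markov_chain (R : realType) (d : measure_display)
    (Omega : measurableType d) (Pr : R -> probability Omega R)
    (X : nat -> {mfun Omega >-> R}) : Prop :=
  (forall x : R, Pr x [set w | X 0%N w = x] = 1%E) /\
  exists K : R.-pker R ~> R,
    forall (x : R) (n : nat) (A : set Omega) (B : set R),
      g_sigma_preimage (fun i : 'I_n.+1 => (X i : Omega -> R)) A ->
      measurable B ->
      Pr x (A `&` X n.+1 @^-1` B) = (\int[Pr x]_(w in A) K (X n w) B)%E.

(** inf {n >= 1 : X(n) <= 0}, with value +oo if there is no such n. *)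
Definition tau (R : realType) (Omega : Type) (X : nat -> Omega -> R)
    (w : Omega) : \bar R :=
  ereal_inf [set n%:R%:E | n in [set n : nat | (1 <= n)%N /\ X n w <= 0]].

(** X(tau), set to 0 on {tau = +oo}.  Where [tau X w = r%:E], the real [r] is a
    natural number, hence equal to its truncation. *)
Definition X_tau (R : realType) (Omega : Type) (X : nat -> Omega -> R)
    (w : Omega) : R :=
  if tau X w is r%:E then X (Num.truncn r) w else 0.

Definition V (R : realType) (d : measure_display) (Omega : measurableType d)
    (Pr : R -> probability Omega R) (X : nat -> Omega -> R) (x : R) : \bar R :=
  (x%:E - 'E_(Pr x)[X_tau X])%E.

Definition cond_prob (R : realType) (d : measure_display)
    (Omega : measurableType d) (P : probability Omega R) (A B : set Omega) : R :=
  fine (P (A `&` B)) / fine (P B).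

(** The domain of uniformity [I n] varies with n, so this is not an instance of
    the topology of uniform convergence on a fixed set. *)
Definition uniform_cvg_in (R : realType) (I : nat -> set R)
    (f : nat -> R -> R) (l : R) : Prop :=
  forall e : R, 0 < e ->
    \forall n \near \oo, forall x : R, I n x -> `|f n x - l| < e.

(** As [a / 0 = 0], this forces [g n x != 0] for n large and x in [I n]. *)
Definition uniform_equiv_in (R : realType) (I : nat -> set R)
    (f g : nat -> R -> R) : Prop :=
  uniform_cvg_in I (fun n x => f n x / g n x) 1.

(* Main.v *)
Require Import Defs.
From HB Require Import structures.
From mathcomp Require Import all_boot all_order all_algebra.
From mathcomp Require Import zify ring lra.
From mathcomp Require Import measurable_realfun.
From mathcomp Require Import all_classical all_reals all_analysis.
Set Implicit Arguments.
Unset Strict Implicit.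
Unset Printing Implicit Defensive.
Import Order.TTheory GRing.Theory Num.Theory.
Import numFieldNormedType.Exports.
Local Open Scope classical_set_scope.
Local Open Scope ring_scope.

(** The proof tests the killed chain against solutions of the heat equation.

    Let [G] be the odd primitive of [exp (- y ^+ 2)].  The function
    [G ((z - v) / sqrt t) + G ((z + v) / sqrt t)] solves u_t = u_zz / 4, is odd in
    [z], and tends as [t] tends to [0] to a multiple of the indicator of [v < z] on
    the half line of positive [z].  Put [z = y / sqrt n] and let [t] decrease by
    [2 / n] at each step.  Jumps are centred with unit variance, and the majorant
    makes their squares uniformly integrable, so by a Lindeberg-type comparison
    ([heat_step]) one step of the chain changes the mean of this function by
    [o(1 / n)] only.  The errors add up to [o(1 / n)] times the sum over [k < n] of
    the survival probabilities P_x(tau > k), which is at most a constant times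
    [V(x) * sqrt n] ([survival_sum]): a concave bounded function of the chain
    decreases at a definite rate while the chain is below [sqrt n].  Hence the total
    error is [o(V(x) / sqrt n)], the order of magnitude of what is to be computed.

    What the comparison compares is, on one side, the mean of the smoothed indicator
    at time [n] on [tau > n], and on the other side the value at the starting point
    minus the values at the crossing points.  Both lie near the boundary, where an
    odd function is almost linear, with the slope of [odd_heat_linear].  The start
    contributes the slope times [x / sqrt n], the crossings contribute the slope
    times the mean of [- X(tau) / sqrt n], and together they give
    [V(x) / sqrt n] times the slope ([smoothed_limit]).  For this to be uniform in
    [x], overshoots after a fixed large number of steps have to be a small part of
    [V(x)], since for them neither the time nor the position is close to the
    initial one.  This is [overshoot_tail], and it rests on a Lyapunov function made
    from the majorant ([lyapunov_function]), whose drift dominates the mean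
    overshoot and which grows slower than any linear function.  The same bound,
    applied from time [0], shows that [V(x)] is finite, and [cvg_V] identifies it
    with the limit of E_x[X(n); tau > n].

    The indicator of [v < z] lies between two smoothed functions with nearby [v],
    up to small errors and except close to the origin, where [small_ball] shows
    that there is little mass.  [limit_beyond] concludes that
    P_x(X(n) > v sqrt n, tau > n) is equivalent to
    [sqrt (2 / pi) * exp (- v ^+ 2 / 2) * V(x) / sqrt n], uniformly in the starting
    point.  The case [v = 0] is the first claim, and the quotient by it is the
    second one.

    The probability space is used only to verify the properties collected in
    [exit_functionals] ([chain_exit_functionals]) and to identify [V(x)]. *)

(** * Integrands and stochastic domination *)

(** The class of integrands on which the chain is tested: a chain with square
    integrable jumps integrates them all. *)
Definition lin_growth (R : realType) (f : R -> R) : Prop :=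
  measurable_fun setT f /\ exists c, forall y, `|f y| <= c * (1 + `|y|).

Definition sq_tail (R : realType) (a u : R) : R := if a < `|u| then u ^+ 2 else 0.

Definition excess (R : realType) (s u : R) : R := Num.max (`|u| - s) 0.

Section lin_growth.
Context {R : realType}.
Implicit Types f g : R -> R.

Lemma measurable_sq_tail (a : R) : measurable_fun setT (sq_tail a).
Proof.
apply: measurable_fun_ifT => //.
by apply: measurable_fun_ltr => //; exact: measurableT_comp.
Qed.

Lemma measurable_excess (s : R) : measurable_fun setT (excess s).
Proof.
apply: measurable_maxr => //; apply: measurable_funB => //.
Qed.

Lemma lin_growth_cst (a : R) : lin_growth (fun=> a).
Proof.
split=> //; exists `|a| => y; rewrite ler_peMr ?normr_ge0//.
by rewrite lerDl normr_ge0.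
Qed.

Lemma lin_growth_id : lin_growth (@id R).
Proof. by split=> //; exists 1 => y; rewrite mul1r lerDr. Qed.

Lemma lin_growth_lin (a b : R) f g : lin_growth f -> lin_growth g ->
  lin_growth (fun y => a * f y + b * g y).
Proof.
move=> [mf [c hc]] [mg [k hk]]; split.
  by apply: measurable_funD; exact: measurable_funM.
exists (`|a| * c + `|b| * k) => y; rewrite (le_trans (ler_normD _ _))// !normrM.
by rewrite mulrDl -!mulrA lerD// ler_wpM2l// normr_ge0.
Qed.

Lemma lin_growth_shift (a : R) f : lin_growth f -> lin_growth (fun u => f (a + u)).
Proof.
move=> [mf [c hc]]; split.
  by apply: (measurableT_comp mf); exact: measurable_funD.
have c0 : 0 <= c.
  by have := hc 0; rewrite normr0 addr0 mulr1; apply: le_trans; exact: normr_ge0.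
exists (c * (1 + `|a|)) => u; rewrite (le_trans (hc _))// -mulrA ler_wpM2l//.
have := ler_normD a u; have := normr_ge0 a; have := normr_ge0 u; nra.
Qed.

End lin_growth.

Section stochastic_domination.
Context {R : realType} d1 (T1 : measurableType d1) (P1 : probability T1 R)
  d2 (T2 : measurableType d2) (P2 : probability T2 R).
Variables (U : T1 -> R) (mU : measurable_fun setT U)
  (Y : T2 -> R) (mY : measurable_fun setT Y).
Hypothesis Y0 : forall w, 0 < Y w.
Hypothesis UY : forall y, 0 <= y ->
  (P1 [set w | (y < `|U w|)%R] <= P2 [set w | (y < Y w)%R])%E.

(** The hypothesis on [phi] says that its superlevel sets in the half line are
    the open half lines that the domination compares; the layer-cake formula
    does the rest. *)
Lemma le_expectation_stochastic (phi : R -> R) :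
  measurable_fun setT phi -> (forall t, 0 <= phi t) ->
  (forall r, 0 <= r -> exists2 c, 0 <= c & forall t, 0 <= t -> (r < phi t) = (c < t)) ->
  (\int[P1]_w (phi `|U w|)%:E <= \int[P2]_w (phi (Y w))%:E)%E.
Proof.
move=> mphi phi0 hphi.
have mphiU : (fun w => phi `|U w|) \in @mfun _ _ T1 R.
  rewrite inE; apply: measurableT_comp => //; exact: measurableT_comp.
have mphiY : (fun w => phi (Y w)) \in @mfun _ _ T2 R.
  by rewrite inE; apply: measurableT_comp.
pose V1 : {RV P1 >-> R} := mfun_Sub mphiU.
pose V2 : {RV P2 >-> R} := mfun_Sub mphiY.
have := @ge0_expectation_ccdf _ _ _ P1 V1 (fun=> phi0 _).
rewrite expectation_def => ->.
have := @ge0_expectation_ccdf _ _ _ P2 V2 (fun=> phi0 _).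
rewrite expectation_def => ->.
apply: ge0_le_integral => //.
- by apply: measurable_funTS; exact: ccdf_measurable.
- by apply: measurable_funTS; exact: ccdf_measurable.
move=> r; rewrite /= in_itv/= andbT => r0.
have [c c0 hc] := hphi r r0.
rewrite /ccdf /distribution /pushforward.
have -> : V1 @^-1` `]r, +oo[ = [set w | c < `|U w|].
  by apply/seteqP; split=> w /=; rewrite in_itv/= andbT hc.
have -> : V2 @^-1` `]r, +oo[ = [set w | c < Y w].
  by apply/seteqP; split=> w /=; rewrite in_itv/= andbT hc// ltW.
exact: UY.
Qed.

Lemma le_expectation_sq_tail (a : R) : 0 <= a ->
  (\int[P1]_w (sq_tail a (U w))%:E <= \int[P2]_w (sq_tail a (Y w))%:E)%E.
Proof.
move=> a0.
have -> : (\int[P1]_w (sq_tail a (U w))%:E = \int[P1]_w (sq_tail a `|U w|)%:E)%E.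
  by apply: eq_integral => w _; rewrite /sq_tail normr_id real_normK ?num_real.
apply: le_expectation_stochastic; first exact: measurable_sq_tail.
  by move=> t; rewrite /sq_tail; case: ifPn => // _; exact: sqr_ge0.
move=> r r0; exists (Num.max a (Num.sqrt r)); first by rewrite le_max a0.
move=> t t0; rewrite /sq_tail ger0_norm// gt_max; have [at_|at_] := ltP a t; rewrite /=.
  by rewrite -[RHS](ltr_pXn2r (_ : 0 < 2)%N) ?nnegrE ?sqrtr_ge0// sqr_sqrtr.
by rewrite ltNge r0.
Qed.

Lemma le_expectation_excess (s : R) : 0 <= s ->
  (\int[P1]_w (excess s (U w))%:E <= \int[P2]_w (excess s (Y w))%:E)%E.
Proof.
move=> s0.
have -> : (\int[P1]_w (excess s (U w))%:E = \int[P1]_w (excess s `|U w|)%:E)%E.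
  by apply: eq_integral => w _; rewrite /excess normr_id.
apply: le_expectation_stochastic; first exact: measurable_excess.
  by move=> t; rewrite /excess le_max lexx orbT.
move=> r r0; exists (r + s); first by rewrite addr_ge0.
move=> t t0; rewrite /excess ger0_norm// lt_max ltrBrDr.
by rewrite [r < 0]ltNge r0 orbF.
Qed.

End stochastic_domination.

Section square_integrable.
Context {R : realType} d (T : measurableType d) (P : probability T R).
Variables (U : T -> R) (mU : measurable_fun setT U).
Hypothesis U2 : (\int[P]_w (U w ^+ 2)%:E < +oo)%E.

(** Every measurable function of at most quadratic growth of a square
    integrable variable is integrable. *)
Lemma integrable_quadratic (phi : R -> R) (c : R) : measurable_fun setT phi ->
  (forall u, `|phi u| <= c * (1 + u ^+ 2)) ->
  P.-integrable setT (fun w => (phi (U w))%:E).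
Proof.
move=> mphi hphi.
have i2 : P.-integrable setT (fun w => (1 + U w ^+ 2)%:E).
  have -> : (fun w => (1 + U w ^+ 2)%:E) =
      (EFin \o cst (1 : R)) \+ (fun w => (U w ^+ 2)%:E) :> (T -> \bar R).
    by apply/funext => w /=; rewrite EFinD.
  apply: integrableD => //; first exact: finite_measure_integrable_cst.
  apply/integrableP; split.
    by apply/measurable_EFinP; exact: measurable_funX.
  apply: le_lt_trans U2; apply: ge0_le_integral => //.
  - by apply: measurableT_comp => //; apply/measurable_EFinP; exact: measurable_funX.
  - by apply/measurable_EFinP; exact: measurable_funX.
  - by move=> w _; rewrite abse_EFin lee_fin ger0_norm// sqr_ge0.
have ic := integrableZl measurableT c i2.
apply: le_integrable ic => //.
  by apply/measurable_EFinP; exact: measurableT_comp.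
move=> w _; rewrite -EFinM !abse_EFin lee_fin (le_trans (hphi _))//.
exact: ler_norm.
Qed.

Lemma integrable_sq_tail (a : R) : P.-integrable setT (fun w => (sq_tail a (U w))%:E).
Proof.
apply: (@integrable_quadratic _ 1); first exact: measurable_sq_tail.
move=> u; rewrite mul1r /sq_tail; case: ifPn => _.
  by rewrite ger0_norm ?sqr_ge0// lerDr.
by rewrite normr0 addr_ge0// sqr_ge0.
Qed.

Lemma integrable_excess (s : R) : 0 <= s ->
  P.-integrable setT (fun w => (excess s (U w))%:E).
Proof.
move=> s0; apply: (@integrable_quadratic _ 1); first exact: measurable_excess.
move=> u; rewrite mul1r /excess ger0_norm ?le_max ?lexx ?orbT// ge_max.
rewrite addr_ge0 ?sqr_ge0// andbT -[u ^+ 2]real_normK ?num_real//.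
by have := normr_ge0 u; have := sqr_ge0 (`|u| - 1); nra.
Qed.

Lemma integrable_lin_growth (f : R -> R) (y : R) : lin_growth f ->
  P.-integrable setT (fun w => (f (y + U w))%:E).
Proof.
move=> /(lin_growth_shift y)[mf [c hc]].
have c0 : 0 <= c.
  by have := le_trans (normr_ge0 _) (hc 0); rewrite normr0 [1 + 0]addr0 mulr1.
apply: (@integrable_quadratic (fun u => f (y + u)) (c * 2)) => // u.
rewrite (le_trans (hc u))// -mulrA ler_wpM2l//.
rewrite -[u ^+ 2]real_normK ?num_real//; have := sqr_ge0 (`|u| - 1).
by have := sqr_ge0 (`|u|); nra.
Qed.

Lemma integrable_id_quadratic : P.-integrable setT (fun w => (U w)%:E).
Proof.
have := @integrable_lin_growth id 0 (@lin_growth_id R).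
by under eq_fun do rewrite add0r.
Qed.

Lemma integrable_sqr : P.-integrable setT (fun w => (U w ^+ 2)%:E).
Proof.
apply: (@integrable_quadratic (fun u => u ^+ 2) 1) => //.
by move=> u; rewrite ger0_norm ?sqr_ge0// mul1r lerDr.
Qed.

Lemma Rintegral_quadratic_le (phi : R -> R) (a b q k A l s : R) :
  P.-integrable setT (fun w => (phi (U w))%:E) -> 0 <= s ->
  (forall u, phi u <= a + b * u + q * u ^+ 2 + k * sq_tail A u + l * excess s u) ->
  \int[P]_w phi (U w) <= a + b * \int[P]_w U w + q * \int[P]_w (U w ^+ 2)
     + k * \int[P]_w sq_tail A (U w) + l * \int[P]_w excess s (U w).
Proof.
move=> iphi s0 hphi.
have ic : P.-integrable setT (EFin \o (fun=> a)).
  exact: finite_measure_integrable_cst.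
have Zl (c : R) (g : T -> R) : P.-integrable setT (EFin \o g) ->
    P.-integrable setT (EFin \o (fun w => c * g w)).
  by move=> /(integrableZl measurableT c).
have D (g h : T -> R) : P.-integrable setT (EFin \o g) ->
    P.-integrable setT (EFin \o h) ->
    P.-integrable setT (EFin \o (fun w => g w + h w)).
  by move=> ig ih; have := integrableD measurableT ig ih.
have i1 := Zl b _ integrable_id_quadratic.
have i2 := Zl q _ integrable_sqr.
have i3 := Zl k _ (integrable_sq_tail A).
have i4 := Zl l _ (integrable_excess s0).
have e1 := RintegralZl b measurableT integrable_id_quadratic.
have e2 := RintegralZl q measurableT integrable_sqr.
have e3 := RintegralZl k measurableT (integrable_sq_tail A).
have e4 := RintegralZl l measurableT (integrable_excess s0).
rewrite -e1 -e2 -e3 -e4.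
have <- : \int[P]_w a = a.
  rewrite Rintegral_cst// [X in fine X](_ : _ = 1%E) ?mulr1//.
  exact: probability_setT.
rewrite -!RintegralD//; try by do ![exact: D|apply: (D)].
by apply: le_Rintegral => //; do ![exact: D|apply: (D)].
Qed.

End square_integrable.

(** * The Markov chain up to the exit time *)

Section disintegration.
Context d (T : measurableType d) (R : realType) (mu : {measure set T -> \bar R}).
Variables (D : set T) (mD : measurable D) (Y Z : T -> R).
Hypotheses (mY : measurable_fun setT Y) (mZ : measurable_fun setT Z).
Variable K : R.-pker R ~> R.
Hypothesis YZ : forall B, measurable B ->
  mu (D `&` Z @^-1` B) = (\int[mu]_(w in D) K (Y w) B)%E.

Import HBNNSimple.

Let mK B : measurable B -> measurable_fun D ((fun w => K (Y w) B) : T -> \bar R).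
Proof.
move=> mB; apply: measurable_funTS.
apply: (measurableT_comp (f := fun y => K y B : \bar R)) => //.
exact: measurable_kernel.
Qed.

Let disintegration_nnsfun (f : {nnsfun R >-> R}) :
  (\int[mu]_(w in D) (f (Z w))%:E = \int[mu]_(w in D) \int[K (Y w)]_z (f z)%:E)%E.
Proof.
have mf r : measurable (f @^-1` [set r]) by exact: measurable_sfunP.
transitivity (\sum_(r \in range f) (r%:E * mu (D `&` Z @^-1` (f @^-1` [set r]))))%E.
  under eq_integral do rewrite fimfunE -fsumEFin//.
  rewrite ge0_integral_fsum//; last 2 first.
    - move=> r; apply/measurable_EFinP; apply: measurable_funTS.
      apply: measurable_funM => //.
      by apply: measurableT_comp => //; exact: measurable_indic.
    - by move=> r w _; rewrite EFinM nnfun_muleindic_ge0.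
  apply: eq_fsbigr => r _.
  transitivity (\int[mu]_(w in D) (r%:E * (\1_(Z @^-1` (f @^-1` [set r])) w)%:E))%E.
    by apply: eq_integral => w _; rewrite EFinM.
  rewrite (integralZl_indic _ (fun r => Z @^-1` (f @^-1` [set r])))//; last 2 first.
    + by move=> r0; rewrite preimage_nnfun0// preimage_set0.
    + by rewrite -[X in measurable X]setTI; exact: mZ.
  rewrite integral_indic//; first by rewrite setIC.
  by rewrite -[X in measurable X]setTI; exact: mZ.
under [in RHS]eq_integral.
  move=> y _.
  under eq_integral.
    by move=> z _; rewrite fimfunE -fsumEFin//; over.
  rewrite /= ge0_integral_fsum//; last 2 first.
    - by move=> r; exact/measurable_EFinP/measurableT_comp.
    - by move=> r z _; rewrite EFinM nnfun_muleindic_ge0.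
  under eq_fsbigr.
    move=> r _.
    rewrite (integralZl_indic _ (fun r => f @^-1` [set r]))//; last first.
      by move=> r0; rewrite preimage_nnfun0.
    rewrite integral_indic// setIT.
    over.
  over.
rewrite /= ge0_integral_fsum//; last 2 first.
  - by move=> r; apply: measurable_funeM; exact: mK.
  - move=> n y _.
    have := mulemu_ge0 (fun n => f @^-1` [set n]).
    by apply; exact: preimage_nnfun0.
apply: eq_fsbigr => r _.
have [r0|r0] := leP 0%R r.
  by rewrite YZ// ge0_integralZl//; exact: mK.
rewrite preimage_nnfun0// preimage_set0 setI0 measure0 mule0.
by rewrite integral0_eq// => w _; rewrite measure0 mule0.
Qed.

(** The disintegration of the pair law is given on measurable rectangles; the
    usual approximation by simple functions extends it to integrands. *)
Lemma integral_disintegration (f : R -> \bar R) :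
    (forall z, 0 <= f z)%E -> measurable_fun setT f ->
  (\int[mu]_(w in D) f (Z w) = \int[mu]_(w in D) \int[K (Y w)]_z f z)%E.
Proof.
move=> f0 mf; pose f_ := nnsfun_approx measurableT mf.
have mfn n : measurable_fun setT (EFin \o f_ n) by exact/measurable_EFinP.
have nd w a b : (a <= b)%N -> (f_ a w <= f_ b w)%R.
  by move=> ab; exact/lefP/nd_nnsfun_approx.
have mKf n : measurable_fun D ((fun w => \int[K (Y w)]_z (f_ n z)%:E)%E : T -> \bar R).
  apply: measurable_funTS.
  apply: (measurableT_comp (f := fun y => (\int[K y]_z (f_ n z)%:E)%E : \bar R)) => //.
  apply: measurable_fun_integral_kernel => //.
  - by move=> U mU; exact: measurable_kernel.
  - by move=> z; rewrite lee_fin.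
  - exact: mfn.
transitivity (\int[mu]_(w in D) lim ((f_ n (Z w))%:E @[n --> \oo]))%E.
  apply/eq_integral => w _; apply/esym/cvg_lim => //=; exact: cvg_nnsfun_approx.
have mfZ n : measurable_fun D (fun w => (f_ n (Z w))%:E).
  by apply: measurable_funTS; exact: (measurableT_comp (mfn n)).
rewrite monotone_convergence//; last 2 first.
  by move=> n z _; rewrite lee_fin.
  by move=> z _ a b ab; rewrite lee_fin nd.
transitivity (lim ((\int[mu]_(w in D) \int[K (Y w)]_z (f_ n z)%:E) @[n --> \oo]))%E.
  by congr (lim _); congr (_ @ \oo); apply/funext => n; exact: disintegration_nnsfun.
rewrite -monotone_convergence//; last 2 first.
  - by move=> n y _; apply: integral_ge0 => // z _; rewrite lee_fin.
  - move=> y _ a b ab; apply: ge0_le_integral => //.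
    + by move=> z _; rewrite lee_fin.
    + exact: mfn.
    + exact: mfn.
    + by move=> z _; rewrite lee_fin nd.
apply: eq_integral => y _; rewrite -monotone_convergence//; last 2 first.
  - by move=> n z _; rewrite lee_fin.
  - by move=> z _ a b ab; rewrite lee_fin nd.
by apply: eq_integral => z _; apply/cvg_lim => //; exact: cvg_nnsfun_approx.
Qed.

End disintegration.

Section killed_chain.
Context (R : realType) (d : measure_display) (Omega : measurableType d)
  (Pr : R -> probability Omega R) (X : nat -> {mfun Omega >-> R}).

(** The event [tau > n], written so that it visibly depends on the steps up to
    [n] only. *)
Definition alive (n : nat) : set Omega :=
  [set w | forall k, (1 <= k <= n)%N -> 0 < X k w].

Let nonpos (n k : nat) : set Omega :=
  if (1 <= k <= n)%N then X k @^-1` `]-oo, 0] else set0.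

Lemma aliveE n : alive n = ~` \bigcup_k nonpos n k.
Proof.
apply/seteqP; split=> w /=.
  move=> h [k _]; rewrite /nonpos; case: ifPn => // kn /=.
  by rewrite in_itv/= leNgt h.
move=> h k kn; rewrite ltNge; apply/negP => Xk; apply: h; exists k => //.
by rewrite /nonpos kn /= in_itv.
Qed.

Lemma alive0 : alive 0 = setT.
Proof. by apply/seteqP; split=> w //= _ [|k]. Qed.

Lemma aliveS n : alive n.+1 = alive n `&` [set w | 0 < X n.+1 w].
Proof.
apply/seteqP; split=> w /=.
  move=> h; split=> [k /andP[k1 kn]|]; apply: h; last by rewrite leqnn.
  by rewrite k1 leqW.
move=> [h hn] k /andP[k1]; rewrite leq_eqVlt => /predU1P[->//|kn].
by apply: h; rewrite k1.
Qed.

Lemma measurable_nonpos_event k : measurable [set w | X k w <= 0].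
Proof.
have -> : [set w | X k w <= 0] = X k @^-1` `]-oo, 0].
  by apply/seteqP; split=> w /=; rewrite in_itv.
by rewrite -[_ @^-1` _]setTI; exact: measurable_funP.
Qed.

Lemma measurable_alive n : measurable (alive n).
Proof.
elim: n => [|n ih]; first by rewrite alive0.
rewrite aliveS; apply: measurableI => //.
have -> : [set w | 0 < X n.+1 w] = ~` [set w | X n.+1 w <= 0].
  by apply/seteqP; split=> w /= => [h|/negP]; rewrite ?leNgt ?negbK// h.
by apply: measurableC; exact: measurable_nonpos_event.
Qed.

Lemma alive_adapted n : g_sigma_preimage (fun i : 'I_n.+1 => (X i : Omega -> R)) (alive n).
Proof.
rewrite aliveE -setTD; apply: sigma_algebraCD; apply: sigma_algebra_bigcup => k.
rewrite /nonpos; case: ifPn => [/andP[k1 kn]|_]; last exact: sigma_algebra0.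
apply: sub_sigma_algebra; have kn' : (k < n.+1)%N by [].
rewrite (bigD1 (Ordinal kn'))//=; left.
by exists `]-oo, 0]%classic => //=; rewrite setTI.
Qed.

Lemma gt_tau (n : nat) : [set w | (n%:R%:E < tau X w)%E] = alive n.
Proof.
apply/seteqP; split=> w /=.
  move=> h k /andP[k1 kn]; rewrite ltNge; apply/negP => Xk.
  have : (tau X w <= k%:R%:E)%E by apply: ereal_inf_lbound => /=; exists k.
  move=> /(lt_le_trans h); rewrite lte_fin ltr_nat.
  by rewrite ltnNge kn.
move=> h; apply: (@lt_le_trans _ _ (n.+1%:R%:E)%E); first by rewrite lte_fin ltr_nat.
apply: le_ereal_inf_tmp => _ [k [k1 Xk] <-]; rewrite lee_fin ler_nat ltnNge.
by apply/negP => kn; move: Xk; rewrite leNgt h ?k1.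
Qed.

Lemma tau_eq (n : nat) w : alive n w -> X n.+1 w <= 0 -> tau X w = n.+1%:R%:E.
Proof.
move=> h Xn; apply/eqP; rewrite eq_le; apply/andP; split.
  by apply: ereal_inf_lbound; exists n.+1.
apply: le_ereal_inf_tmp => _ [k [k1 Xk] <-]; rewrite lee_fin ler_nat ltnNge.
by apply/negP => kn; move: Xk; rewrite leNgt h ?k1.
Qed.

(** The event [tau = n + 1]. *)
Definition crossing (n : nat) : set Omega := alive n `&` [set w | X n.+1 w <= 0].

Lemma measurable_crossing n : measurable (crossing n).
Proof. by apply: measurableI; [exact: measurable_alive|exact: measurable_nonpos_event]. Qed.

Lemma crossing_tau n w : crossing n w -> X_tau X w = X n.+1 w.
Proof. by move=> [h Xn]; rewrite /X_tau (tau_eq h Xn) natrK. Qed.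

Lemma X_tau_notin w : (forall n, ~ crossing n w) -> X_tau X w = 0.
Proof.
move=> h; have a n : alive n w.
  elim: n => [|n ih]; first by rewrite alive0.
  rewrite aliveS; split=> //=; rewrite ltNge; apply/negP => Xn.
  exact: (h n).
rewrite /X_tau; suff -> : tau X w = +oo%E by [].
rewrite /tau [X in ereal_inf X](_ : _ = set0) ?ereal_inf0//.
apply/seteqP; split=> // y [k [k1 Xk] _]; move: Xk.
by rewrite leNgt (a k)// k1 leqnn.
Qed.

Lemma trivIset_crossing : trivIset setT crossing.
Proof.
apply/trivIsetP => i j _ _ ij; apply/seteqP; split=> // w [[ai Xi] [aj Xj]] /=.
wlog lij : i j ij ai Xi aj Xj / (i < j)%N.
  move=> H; move: (ij); rewrite neq_ltn => /orP[l|l]; first exact: (H i j).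
  by apply: (H j i) => //; rewrite eq_sym.
by move: Xi; rewrite /= leNgt aj.
Qed.

Definition alive_mean (x : R) (n : nat) (f : R -> R) : R :=
  \int[Pr x]_(w in alive n) f (X n w).

Definition cross_mean (x : R) (n : nat) (f : R -> R) : R :=
  \int[Pr x]_(w in crossing n) f (X n.+1 w).

End killed_chain.

(** What the rest of the argument uses about the chain started from [x]: [e n f]
    and [c n f] stand for E_x[f(X(n)); tau > n] and E_x[f(X(tau)); tau = n + 1].
    No probability space occurs in it, so that the limit theorem becomes real
    analysis of two sequences of positive functionals.  The last field is the Markov
    property at time [n], specialized to functions whose increments are dominated
    by a combination of functions of the jump with controlled expectation: [u],
    [u ^+ 2], the tail [sq_tail A] of the second moment, bounded by [tY A], and
    [excess s], bounded by [xY s]. *)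
Record exit_functionals (R : realType) (tY xY : R -> R) (x : R)
    (e c : nat -> (R -> R) -> R) : Prop := ExitFunctionals {
  alive_init : forall f, lin_growth f -> e 0%N f = f x ;
  alive_lin : forall n a b f g, lin_growth f -> lin_growth g ->
    e n (fun y => a * f y + b * g y) = a * e n f + b * e n g ;
  alive_le : forall n f g, lin_growth f -> lin_growth g ->
    (forall y, 0 < y -> f y <= g y) -> e n f <= e n g ;
  cross_lin : forall n a b f g, lin_growth f -> lin_growth g ->
    c n (fun y => a * f y + b * g y) = a * c n f + b * c n g ;
  cross_le : forall n f g, lin_growth f -> lin_growth g ->
    (forall y, y <= 0 -> f y <= g y) -> c n f <= c n g ;
  alive_step : forall n f g, lin_growth f -> lin_growth g ->
    (forall y, 0 < y -> exists a b q k A l s,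
      [/\ 0 <= k /\ 0 <= A, 0 <= l /\ 0 <= s,
       forall u, f (y + u) <= a + b * u + q * u ^+ 2 + k * sq_tail A u + l * excess s u
       & a + q + k * tY A + l * xY s <= g y]) ->
    e n.+1 f + c n f <= e n g }.

Section functionals_of_chain.
Context (R : realType)
  (d : measure_display) (Omega : measurableType d)
  (Pr : R -> probability Omega R) (X : nat -> {mfun Omega >-> R})
  (hX0 : forall x : R, Pr x [set w | X 0%N w = x] = 1%E)
  (K : R.-pker R ~> R)
  (hXK : forall (x : R) (n : nat) (A : set Omega) (B : set R),
      g_sigma_preimage (fun i : 'I_n.+1 => (X i : Omega -> R)) A ->
      measurable B ->
      Pr x (A `&` X n.+1 @^-1` B) = (\int[Pr x]_(w in A) K (X n w) B)%E)
  (d1 : R -> measure_display) (Omega1 : forall x : R, measurableType (d1 x))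
  (P1 : forall x : R, probability (Omega1 x) R)
  (xi : forall x : R, {RV (P1 x) >-> R})
  (hxi : forall (x : R) (B : set R), measurable B ->
     P1 x [set w | B (xi x w)] = Pr x [set w | B (X 1%N w - x)])
  (hxi1 : forall x : R, ('E_(P1 x)[xi x] = 0)%E)
  (hxi2 : forall x : R, ('E_(P1 x)[(fun w => (xi x w ^+ 2)%R)] = 1)%E)
  (d2 : measure_display) (Omega2 : measurableType d2)
  (P2 : probability Omega2 R) (Y : {RV P2 >-> R})
  (hY0 : forall w : Omega2, 0 < Y w)
  (hY2 : ('E_P2[(fun w => (Y w ^+ 2)%R)] < +oo)%E)
  (hY : forall x y : R, 0 <= y ->
     (P1 x [set w | (y < `|xi x w|)%R] <= P2 [set w | (y < Y w)%R])%E).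

Lemma integral_initial x (f : R -> \bar R) : measurable_fun setT f ->
  (\int[Pr x]_w f (X 0%N w) = f x)%E.
Proof.
move=> mf; rewrite (@ae_eq_integral _ _ _ _ _ (fun=> f x))//.
- by rewrite integral_cst// [X in (_ * X)%E](_ : _ = 1%E) ?mule1//; exact: probability_setT.
- by apply: measurableT_comp.
have mX0 : measurable [set w | X 0%N w = x].
  have -> : [set w | X 0%N w = x] = X 0%N @^-1` [set x] by [].
  by rewrite -[_ @^-1` _]setTI; exact: measurable_funP.
exists (~` [set w | X 0%N w = x]); split; first exact: measurableC.
  apply: etrans (probability_setC (Pr x) mX0) _.
  by rewrite [X in (1 - X)%E](_ : _ = 1%E) ?subee.
by move=> w /= h Xw; apply: h => _; rewrite Xw.
Qed.

(** The kernel of the Markov property and the law of the jump agree, by the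
    Markov property at time [0] for the chain started from [y]. *)
Lemma kernelE y (B : set R) : measurable B ->
  K y B = P1 y [set w | B (y + xi y w)].
Proof.
move=> mB.
have mB' : measurable [set z | B (y + z)].
  have -> : [set z | B (y + z)] = (fun z => y + z) @^-1` B by [].
  by rewrite -[_ @^-1` _]setTI; apply: measurable_funD.
rewrite -[RHS]/(P1 y [set w | [set z | B (y + z)] (xi y w)]) (hxi y mB').
have -> : [set w | [set z | B (y + z)] (X 1%N w - y)] = setT `&` X 1%N @^-1` B.
  by rewrite setTI; apply/seteqP; split=> w /=; rewrite addrC subrK.
rewrite hXK//.
  by rewrite (@integral_initial y (fun z => K z B))//; exact: measurable_kernel.
by rewrite -setC0 -setTD; apply: sigma_algebraCD; exact: sigma_algebra0.
Qed.

Lemma integral_kernel y (f : R -> \bar R) : (forall z, 0 <= f z)%E ->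
  measurable_fun setT f ->
  (\int[K y]_z f z = \int[P1 y]_w f (y + xi y w)%R)%E.
Proof.
move=> f0 mf.
have mphi : (fun w => y + xi y w) \in @mfun _ _ (Omega1 y) R.
  by rewrite inE; apply: measurable_funD.
pose phi : {RV (P1 y) >-> R} := mfun_Sub mphi.
rewrite -(ge0_integral_distribution phi mf f0).
by apply: eq_measure_integral => A mA _; exact: kernelE.
Qed.

Let sq_fin y : (\int[P1 y]_w (xi y w ^+ 2)%:E < +oo)%E.
Proof. by have := hxi2 y; rewrite unlock => ->; rewrite ltry. Qed.

Let sqY_fin : (\int[P2]_w (Y w ^+ 2)%:E < +oo)%E.
Proof. by have := hY2; rewrite unlock. Qed.

Definition step_mean (f : R -> R) (y : R) : R := \int[P1 y]_w f (y + xi y w).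

Definition tail_majorant (a : R) : R := \int[P2]_w sq_tail a (Y w).
Definition excess_majorant (s : R) : R := \int[P2]_w excess s (Y w).

(** The jumps enter only through their first two moments and through the two
    quantities that the majorant dominates. *)
Lemma step_mean_le (f : R -> R) y a b q k A l s : lin_growth f ->
  0 <= k -> 0 <= A -> 0 <= l -> 0 <= s ->
  (forall u, f (y + u) <= a + b * u + q * u ^+ 2 + k * sq_tail A u + l * excess s u) ->
  step_mean f y <= a + q + k * tail_majorant A + l * excess_majorant s.
Proof.
move=> lf k0 A0 l0 s0 hf.
have mxi : measurable_fun setT (xi y) by exact: measurable_funP.
have mY : measurable_fun setT Y by exact: measurable_funP.
have h := @Rintegral_quadratic_le R _ _ (P1 y) _ mxi (sq_fin y) (fun u => f (y + u))
  a b q k A l s (integrable_lin_growth mxi (sq_fin y) y lf) s0 hf.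
apply: (le_trans h).
have -> : \int[P1 y]_w xi y w = 0.
  by rewrite /Rintegral; have := hxi1 y; rewrite unlock => ->.
have -> : \int[P1 y]_w (xi y w ^+ 2) = 1.
  by rewrite /Rintegral; have := hxi2 y; rewrite unlock => ->.
rewrite mulr0 addr0 mulr1 !lerD// ler_wpM2l//.
  apply: fine_le.
  - exact: integrable_fin_num (integrable_sq_tail _ (sq_fin y) A).
  - exact: integrable_fin_num (integrable_sq_tail _ sqY_fin A).
  - exact: le_expectation_sq_tail (hY y) _ A0.
apply: fine_le.
- exact: integrable_fin_num (integrable_excess _ (sq_fin y) s0).
- exact: integrable_fin_num (integrable_excess _ sqY_fin s0).
- exact: le_expectation_excess (hY y) _ s0.
Qed.

Lemma markov_ge0 x n (A : set Omega) (f : R -> R) : measurable A ->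
  g_sigma_preimage (fun i : 'I_n.+1 => (X i : Omega -> R)) A ->
  lin_growth f -> (forall y, 0 <= f y) ->
  (\int[Pr x]_(w in A) (f (X n.+1 w))%:E = \int[Pr x]_(w in A) (step_mean f (X n w))%:E)%E.
Proof.
move=> mA sA lf f0.
have mf : measurable_fun setT (EFin \o f) by apply/measurable_EFinP; case: lf.
have := @integral_disintegration _ _ _ (Pr x) A mA (X n) (X n.+1)
  (measurable_funP (X n)) (measurable_funP (X n.+1)) K
  (fun B mB => hXK x sA mB) (EFin \o f) _ mf.
rewrite /= => -> //.
apply: eq_integral => w _; rewrite integral_kernel//= /step_mean /Rintegral fineK//.
exact: integrable_fin_num (integrable_lin_growth _ (sq_fin _) _ lf).
Qed.

Lemma measurable_step_mean f : lin_growth f -> (forall y, 0 <= f y) ->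
  measurable_fun setT (step_mean f).
Proof.
move=> lf f0; have mf : measurable_fun setT (EFin \o f) by apply/measurable_EFinP; case: lf.
apply/measurable_EFinP.
have -> : EFin \o step_mean f = (fun y => \int[K y]_z (f z)%:E)%E.
  apply/funext => y /=; rewrite integral_kernel//= /step_mean /Rintegral fineK//.
  exact: integrable_fin_num (integrable_lin_growth _ (sq_fin _) _ lf).
apply: measurable_fun_integral_kernel => //.
by move=> U mU; exact: measurable_kernel.
Qed.

Lemma lin_growth_step_mean f : lin_growth f -> (forall y, 0 <= f y) ->
  lin_growth (step_mean f).
Proof.
move=> lf f0; split; first exact: measurable_step_mean.
have [_ [c hc]] := lf.
have c0 : 0 <= c.
  by have := le_trans (normr_ge0 _) (hc 0); rewrite normr0 [1 + 0]addr0 mulr1.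
exists (2 * c) => y; rewrite ger0_norm; last by apply: Rintegral_ge0.
have := @step_mean_le f y (c * (3 / 2 + `|y|)) 0 (c / 2) 0 0 0 0 lf
  (lexx _) (lexx _) (lexx _) (lexx _).
rewrite !mul0r !addr0 => /(_ _)/le_trans; apply; last first.
  by have := normr_ge0 y; nra.
move=> u; rewrite !mul0r !addr0; apply: (le_trans (ler_norm _)).
apply: (le_trans (hc _)).
have -> : c * (3 / 2 + `|y|) + c / 2 * u ^+ 2 = c * (3 / 2 + `|y| + 1 / 2 * u ^+ 2).
  by field.
rewrite ler_wpM2l//; have := ler_normD y u; have := sqr_ge0 (`|u| - 1).
by rewrite -[u ^+ 2]real_normK ?num_real//; nra.
Qed.

Lemma integrable_chain x n : (Pr x).-integrable setT (EFin \o X n).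
Proof.
have mX k : measurable_fun setT (EFin \o X k) by apply/measurable_EFinP.
have lgn : lin_growth (fun y : R => `|y|).
  by split=> //; exists 1 => y; rewrite normr_id mul1r lerDr.
elim: n => [|n ih]; apply/integrableP; split=> //.
  have -> : (\int[Pr x]_w `|(EFin \o X 0%N) w| = \int[Pr x]_w `|X 0%N w|%:E)%E by [].
  rewrite (@integral_initial x (fun y => `|y|%:E))%E ?ltry//.
  by apply/measurable_EFinP.
have -> : (\int[Pr x]_w `|(EFin \o X n.+1) w| = \int[Pr x]_w `|X n.+1 w|%:E)%E by [].
rewrite (@markov_ge0 x n setT (fun y : R => `|y|))//; last first.
  by rewrite -setC0 -setTD; apply: sigma_algebraCD; exact: sigma_algebra0.
have lgs := lin_growth_step_mean lgn (fun y => normr_ge0 y).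
have i : (Pr x).-integrable setT (fun w => (step_mean (fun y : R => `|y|) (X n w))%:E).
  case: lgs => ms [c hc].
  have ic : (Pr x).-integrable setT (fun w => c%:E * (EFin \o cst 1%R \+ (fun w => `|X n w|%:E)) w)%E.
    apply: integrableZl => //; apply: integrableD => //.
      exact: finite_measure_integrable_cst.
    exact: integrable_norm ih.
  apply: le_integrable ic => //.
    by apply/measurable_EFinP; exact: measurableT_comp.
  move=> w _ /=; rewrite lee_fin (le_trans (hc _))//.
  exact: ler_norm.
have := integrable_lty measurableT i.
by [].
Qed.

Lemma integrable_chain_lin_growth x n (D : set Omega) f : measurable D ->
  lin_growth f -> (Pr x).-integrable D (fun w => (f (X n w))%:E).
Proof.
move=> mD [mf [c hc]]; apply: (@integrableS _ _ _ _ setT) => //.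
have ic : (Pr x).-integrable setT (fun w => c%:E * (EFin \o cst 1%R \+ (fun w => `|X n w|%:E)) w)%E.
  apply: integrableZl => //; apply: integrableD => //.
    exact: finite_measure_integrable_cst.
  exact: integrable_norm (integrable_chain x n).
apply: le_integrable ic => //.
  by apply/measurable_EFinP; exact: measurableT_comp.
move=> w _ /=; rewrite lee_fin (le_trans (hc _))//.
exact: ler_norm.
Qed.

Lemma alive_mean_init x f : lin_growth f -> alive_mean Pr X x 0 f = f x.
Proof.
move=> [mf _]; rewrite /alive_mean alive0 /Rintegral.
rewrite (@integral_initial x (fun y => (f y)%:E))//.
exact/measurable_EFinP.
Qed.

Lemma alive_mean_le x n f g : 0 < x -> lin_growth f -> lin_growth g ->
  (forall y, 0 < y -> f y <= g y) ->
  alive_mean Pr X x n f <= alive_mean Pr X x n g.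
Proof.
move=> x0 lf lg fg; case: n => [|n]; first by rewrite !alive_mean_init// fg.
apply: le_Rintegral; first exact: measurable_alive.
- exact: integrable_chain_lin_growth (measurable_alive X _) lf.
- exact: integrable_chain_lin_growth (measurable_alive X _) lg.
by move=> w hw; apply: fg; apply: hw; rewrite leqnn.
Qed.

Lemma mean_step_mean x n f : lin_growth f -> (forall y, 0 <= f y) ->
  \int[Pr x]_(w in alive X n) f (X n.+1 w) = alive_mean Pr X x n (step_mean f).
Proof.
move=> lf f0; rewrite /alive_mean /Rintegral markov_ge0//.
- exact: measurable_alive.
- exact: alive_adapted.
Qed.

Lemma alive_cross_split x n f : lin_growth f ->
  \int[Pr x]_(w in alive X n) f (X n.+1 w) =
  alive_mean Pr X x n.+1 f + cross_mean Pr X x n f.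
Proof.
move=> lf; have e : alive X n = alive X n.+1 `|` crossing X n.
  rewrite aliveS /crossing -setIUr [X in _ `&` X](_ : _ = setT) ?setIT//.
  by apply/seteqP; split=> // w _ /=; case: (ltP 0 (X n.+1 w)); [left|right].
rewrite {1}e Rintegral_setU//.
- exact: measurable_alive.
- exact: measurable_crossing.
- by apply: integrable_chain_lin_growth => //; rewrite -e; exact: measurable_alive.
apply/disj_setPS => w [/= ha [_ /=]]; rewrite leNgt => /negP; apply.
by apply: ha; rewrite leqnn.
Qed.

(** The disintegration formula holds for nonnegative integrands; a multiple of
    [1 + |y|] is added to make [f] nonnegative and is subtracted at the end. *)
Lemma chain_step x n f g : 0 < x -> lin_growth f -> lin_growth g ->
  (forall y, 0 < y -> step_mean f y <= g y) ->
  alive_mean Pr X x n.+1 f + cross_mean Pr X x n f <= alive_mean Pr X x n g.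
Proof.
move=> x0 lf lg fg; rewrite -alive_cross_split//.
have mA := measurable_alive X n.
have [_ [c hc]] := lf.
have c0 : 0 <= c.
  by have := le_trans (normr_ge0 _) (hc 0); rewrite normr0 [1 + 0]addr0 mulr1.
pose psi (y : R) : R := c * 1 + c * `|y|.
have lgn : lin_growth (fun y : R => `|y|).
  by split=> //; exists 1 => y; rewrite normr_id mul1r lerDr.
have lpsi : lin_growth psi := lin_growth_lin c c (lin_growth_cst 1) lgn.
have psi0 y : 0 <= psi y by rewrite /psi addr_ge0// mulr_ge0.
have lfp : lin_growth (fun y => 1 * f y + 1 * psi y) := lin_growth_lin 1 1 lf lpsi.
have fp0 y : 0 <= 1 * f y + 1 * psi y.
  rewrite !mul1r -lerBlDr sub0r /psi -mulrDr.
  by apply: le_trans (_ : - `|f y| <= _); [rewrite lerN2|rewrite lerNl -normrN ler_norm].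
have := mean_step_mean x n lfp fp0.
have i1 := integrable_chain_lin_growth x n.+1 mA lf.
have i2 := integrable_chain_lin_growth x n.+1 mA lpsi.
have -> : \int[Pr x]_(w in alive X n) (1 * f (X n.+1 w) + 1 * psi (X n.+1 w)) =
    \int[Pr x]_(w in alive X n) f (X n.+1 w) +
    \int[Pr x]_(w in alive X n) psi (X n.+1 w).
  by rewrite -RintegralD//; apply: eq_Rintegral => w _; rewrite !mul1r.
have lsp := lin_growth_step_mean lpsi psi0.
rewrite (mean_step_mean x n lpsi psi0) => e.
have : alive_mean Pr X x n (step_mean (fun y => 1 * f y + 1 * psi y)) <=
    alive_mean Pr X x n (fun y => 1 * g y + 1 * step_mean psi y).
  apply: alive_mean_le => //; first exact: lin_growth_step_mean.
    exact: lin_growth_lin.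
  move=> y y0; rewrite !mul1r /step_mean.
  have mxi : measurable_fun setT (xi y) by exact: measurable_funP.
  have j1 := integrable_lin_growth mxi (sq_fin y) y lf.
  have j2 := integrable_lin_growth mxi (sq_fin y) y lpsi.
  have -> : \int[P1 y]_w (1 * f (y + xi y w) + 1 * psi (y + xi y w)) =
      step_mean f y + step_mean psi y.
    by rewrite /step_mean -RintegralD//; apply: eq_Rintegral => w _; rewrite !mul1r.
  by rewrite lerD2r fg.
rewrite -e.
have -> : alive_mean Pr X x n (fun y => 1 * g y + 1 * step_mean psi y) =
    alive_mean Pr X x n g + alive_mean Pr X x n (step_mean psi).
  rewrite /alive_mean -RintegralD//.
  - by apply: eq_Rintegral => w _; rewrite !mul1r.
  - exact: integrable_chain_lin_growth.
  - exact: integrable_chain_lin_growth.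
by rewrite lerD2r.
Qed.

Lemma chain_exit_functionals x : 0 < x ->
  exit_functionals tail_majorant excess_majorant x
    (alive_mean Pr X x) (cross_mean Pr X x).
Proof.
have lin (D : set Omega) n a b f g : measurable D -> lin_growth f -> lin_growth g ->
    \int[Pr x]_(w in D) (a * f (X n w) + b * g (X n w)) =
    a * \int[Pr x]_(w in D) f (X n w) + b * \int[Pr x]_(w in D) g (X n w).
  move=> mD lf lg.
  have i1 := integrable_chain_lin_growth x n mD lf.
  have i2 := integrable_chain_lin_growth x n mD lg.
  rewrite -!RintegralZl// -RintegralD//.
  - by have := integrableZl mD a i1.
  - by have := integrableZl mD b i2.
move=> x0; split.
- exact: alive_mean_init.
- by move=> n a b f g lf lg; apply: lin => //; exact: measurable_alive.
- by move=> n f g; exact: alive_mean_le.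
- by move=> n a b f g lf lg; apply: lin => //; exact: measurable_crossing.
- move=> n f g lf lg fg; have mC := measurable_crossing X n.
  apply: le_Rintegral => //.
  + exact: integrable_chain_lin_growth.
  + exact: integrable_chain_lin_growth.
  + by move=> w [_ /= h]; exact: fg.
- move=> n f g lf lg h; apply: chain_step => // y y0.
  have [a [b [q [k [A [l [s [[k0 A0] [l0 s0] hu hg]]]]]]]] := h y y0.
  exact: le_trans (step_mean_le lf k0 A0 l0 s0 hu) hg.
Qed.

End functionals_of_chain.

Section expectation_at_exit.
Context (R : realType) (d : measure_display) (Omega : measurableType d)
  (Pr : R -> probability Omega R) (X : nat -> {mfun Omega >-> R}).

(** [X_tau] vanishes where the chain never leaves the half line, so its mean is
    the sum over the possible exit times, whether or not [tau] is finite. *)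
Lemma cvg_V x (M : R) :
  (forall n, (Pr x).-integrable (crossing X n) (EFin \o X n.+1)) ->
  (forall n, \sum_(0 <= k < n) cross_mean Pr X x k (fun y => - y) <= M) ->
  x + \sum_(0 <= k < n) cross_mean Pr X x k (fun y => - y) @[n --> \oo] -->
    fine (V Pr X x).
Proof.
move=> iX hM.
have c0 k : 0 <= cross_mean Pr X x k (fun y => - y).
  by apply: Rintegral_ge0 => w [_ /=]; rewrite oppr_ge0.
pose u n := \sum_(0 <= k < n) cross_mean Pr X x k (fun y => - y).
have [l ul] : exists l : R, u n @[n --> \oo] --> l.
  have /cvg_ex[l] : cvgn u; last by exists l.
  apply: nondecreasing_is_cvgn; last by exists M => _ [n _ <-]; exact: hM.
  apply/nondecreasing_seqP => n.
  by rewrite /u big_nat_recr//= lerDl.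
have FX w : 0 <= - X_tau X w.
  have [[n hn]|h] := pselect (exists n, crossing X n w).
    by rewrite (crossing_tau hn); case: hn => _ /=; rewrite oppr_ge0.
  by rewrite X_tau_notin ?oppr0// => n hn; apply: h; exists n.
have E : (\int[Pr x]_w (- X_tau X w)%:E = l%:E)%E.
  transitivity (\int[Pr x]_(w in \bigcup_n crossing X n) (- X_tau X w)%:E)%E.
    rewrite [RHS]integral_mkcond; apply: eq_integral => w _.
    rewrite patchE; case: ifPn => // /negP; rewrite inE => h.
    by rewrite X_tau_notin ?oppr0// => n hn; apply: h; exists n.
  rewrite ge0_integral_bigcup//; last 4 first.
  - exact: measurable_crossing.
  - apply/measurable_fun_bigcup; first exact: measurable_crossing.
    move=> n; apply: (eq_measurable_fun (fun w => (- X n.+1 w)%:E)).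
      by move=> w; rewrite inE => /crossing_tau ->.
    by apply/measurable_EFinP; apply: measurable_funTS; exact: measurableT_comp.
  - by move=> w _; rewrite lee_fin.
  - exact: trivIset_crossing.
  transitivity (\sum_(i <oo) (cross_mean Pr X x i (fun y => - y))%:E)%E.
    apply: eq_eseriesr => n _.
    have -> : (\int[Pr x]_(w in crossing X n) (- X_tau X w)%:E =
        \int[Pr x]_(w in crossing X n) (- X n.+1 w)%:E)%E.
      by apply: eq_integral => w; rewrite inE => /crossing_tau ->.
    rewrite /cross_mean /Rintegral fineK//; apply: integrable_fin_num.
      exact: measurable_crossing.
    have := integrableN (iX n).
    by [].
  apply/cvg_lim => //.
  rewrite (_ : (fun n => _) = (EFin \o u)); last first.
    by apply/funext => n /=; rewrite sumEFin.
  by apply: cvg_EFin; [exact: nearW|].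
have -> : V Pr X x = (x + l)%:E.
  rewrite /V unlock.
  have -> : (\int[Pr x]_w (X_tau X w)%:E = - l%:E)%E.
    rewrite -E -integral_ge0N//; last by move=> w _; rewrite lee_fin.
    by apply: eq_integral => w _; rewrite EFinN oppeK.
  by rewrite -EFinN -EFinD opprK.
by apply: cvgD => //; exact: cvg_cst.
Qed.

End expectation_at_exit.

(** * The Gaussian primitive and the heat equation *)

Section gauss_primitive.
Context {R : realType}.
Implicit Types y r h : R.
Local Notation mu := (@lebesgue_measure R).

Let gauss_integrable (D : set R) : measurable D -> mu.-integrable D (EFin \o @gauss_fun R).
Proof.
by move=> mD; apply: (@integrableS _ _ _ _ setT) => //; exact: integrableT_gauss.
Qed.

(** The odd primitive of [exp(-y^2)]: up to a factor, the error function. *)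
Definition gauss_prim y : R :=
  \int[mu]_(t in `]-oo, y]) gauss_fun t - \int[mu]_(t in `]-oo, 0%R]) gauss_fun t.

Lemma is_derive_gauss_prim y : is_derive y 1 gauss_prim (gauss_fun y).
Proof.
have [] := @continuous_FTC1 R (@gauss_fun R) -oo%O y (y + 1) _ _ _ _.
- by rewrite ltrDl.
- by apply: gauss_integrable; exact: measurable_itv.
- by rewrite ltNyr.
- exact: continuous_gauss_fun.
move=> dF F'; have hF := DeriveDef dF (esym (derive1E _ _)).
rewrite F' in hF.
have -> : gauss_prim = (fun x => \int[mu]_(t in [set` Interval -oo%O (BRight x)]) gauss_fun t)
   + cst (- \int[mu]_(t in `]-oo, 0%R]) gauss_fun t) by apply/funext.
by rewrite -[gauss_fun y]addr0; apply: is_deriveD.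
Qed.

Lemma gauss_prim0 : gauss_prim 0 = 0.
Proof. by rewrite /gauss_prim subrr. Qed.

(** A mean value formula that does not order the end points. *)
Lemma mean_value (f df : R -> R) (a h : R) : (forall x : R, is_derive x 1 f (df x)) ->
  exists2 t, 0 <= t <= 1 & f (a + h) - f a = df (a + t * h) * h.
Proof.
move=> d.
have cf : continuous f.
  by move=> x; apply: differentiable_continuous; apply/derivable1_diffP; case: (d x).
have [h0|h0|->] := ltgtP h 0; last first.
- by exists 0; rewrite ?lexx ?ler01// mulr0 addr0 subrr.
- have := @MVT _ f df a (a + h).
  rewrite ltrDl => /(_ h0 (fun x _ => d x) (continuous_subspaceT cf)) [c].
  rewrite in_itv/= => /andP[c1 c2] e; exists ((c - a) / h).
    have hc : 0 <= c - a by rewrite subr_ge0 ltW.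
    by rewrite divr_ge0 ?(ltW h0)//= ler_pdivrMr// mul1r lerBlDl ltW.
  by rewrite divfK ?gt_eqF// [X in df X]addrC subrK e [a + h - a]addrAC subrr add0r.
- have := @MVT _ f df (a + h) a.
  rewrite gtrDl => /(_ h0 (fun x _ => d x) (continuous_subspaceT cf)) [c].
  rewrite in_itv/= => /andP[c1 c2] e; exists ((c - a) / h).
    have hc : c - a <= 0 by rewrite subr_le0 ltW.
    have hV : h^-1 <= 0 by rewrite invr_le0 ltW.
    by rewrite mulr_le0//= ler_ndivrMr// mul1r lerBrDl ltW.
  rewrite divfK ?lt_eqF// [X in df X]addrC subrK -[LHS]opprB e opprD addrA subrr.
  by rewrite add0r mulrN opprK.
Qed.

Lemma is_derive_gauss_fun y : is_derive y 1 (@gauss_fun R) (- 2 * y * gauss_fun y).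
Proof.
rewrite /gauss_fun; apply: trigger_derive.
rewrite /= !(expr1, scaler1) /GRing.scale /=; ring.
Qed.

Lemma is_derive_gauss_fun1 y :
  is_derive y 1 (fun y => - 2 * y * gauss_fun y) ((4 * y ^+ 2 - 2) * gauss_fun y).
Proof.
have d := is_derive_gauss_fun.
apply: trigger_derive.
rewrite /= /GRing.scale /=; ring.
Qed.

End gauss_primitive.

Section gauss_bounds.
Context {R : realType}.
Implicit Types y r h : R.

Lemma gauss_poly_le y : (1 + y ^+ 2 + (y ^+ 2) ^+ 2 / 4) * gauss_fun y <= 1.
Proof.
rewrite /gauss_fun expRN ler_pdivrMr ?expR_gt0// mul1r.
have -> : expR (y ^+ 2) = expR (y ^+ 2 / 2) ^+ 2.
  by rewrite [RHS]expr2 -expRD; congr expR; field.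
have : (1 + y ^+ 2 / 2) ^+ 2 <= expR (y ^+ 2 / 2) ^+ 2.
  rewrite ler_pXn2r ?nnegrE ?expR_ge0 ?expR_ge1Dx//.
  by rewrite addr_ge0// divr_ge0// sqr_ge0.
by apply: le_trans; rewrite le_eqVlt; apply/orP; left; apply/eqP; field.
Qed.

Lemma norm_gauss1_le1 y : `|- 2 * y * gauss_fun y| <= 1.
Proof.
have := gauss_poly_le y; have g0 := gauss_fun_ge0 y.
have s4 : 0 <= (y ^+ 2) ^+ 2 by rewrite sqr_ge0.
have h1 := sqr_ge0 (y - 1); have h2 := sqr_ge0 (y + 1).
move: (gauss_fun y) g0 => g g0 hg; rewrite ler_norml; apply/andP; split; nra.
Qed.

Lemma norm_gauss2_le4 y : `|(4 * y ^+ 2 - 2) * gauss_fun y| <= 4.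
Proof.
have := gauss_poly_le y; have g0 := gauss_fun_ge0 y.
have s2 : 0 <= y ^+ 2 by rewrite sqr_ge0.
have s4 : 0 <= (y ^+ 2) ^+ 2 by rewrite sqr_ge0.
move: (gauss_fun y) (y ^+ 2) g0 s2 s4 => g a g0 s2 s4 hg.
by rewrite ler_norml; apply/andP; split; nra.
Qed.

Lemma norm_sqr_gauss1_le5 y : `|y ^+ 2 * (- 2 * y * gauss_fun y)| <= 5.
Proof.
have := gauss_poly_le y; have g0 := gauss_fun_ge0 y.
have s2 : 0 <= y ^+ 2 by rewrite sqr_ge0.
have h1 := sqr_ge0 (y - 1); have h2 := sqr_ge0 (y + 1).
move: (gauss_fun y) g0 => g g0 hg.
have a1 : 2 * y <= 1 + y ^+ 2 by nra.
have a2 : - (2 * y) <= 1 + y ^+ 2 by nra.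
have ag : 0 <= y ^+ 2 * g by rewrite mulr_ge0.
have k : y ^+ 2 * g * (1 + y ^+ 2) <= 5.
  have e1 : y ^+ 2 * g <= 1.
    by have : 0 <= (y ^+ 2) ^+ 2 * g; [rewrite mulr_ge0// sqr_ge0|lra].
  have : 0 <= y ^+ 2 * g by [].
  by lra.
rewrite (_ : y ^+ 2 * (- 2 * y * g) = - (y ^+ 2 * g * (2 * y))); last by ring.
rewrite normrN ler_norml; apply/andP; split.
  have := ler_wpM2l ag a2; lra.
have := ler_wpM2l ag a1; lra.
Qed.

Lemma gauss_prim_taylor1 r h :
  `|gauss_prim (r + h) - gauss_prim r - gauss_fun r * h| <= h ^+ 2.
Proof.
have [t t01 ->] := @mean_value R _ _ r h is_derive_gauss_prim.
have [s s01 e] := @mean_value R _ _ r (t * h) is_derive_gauss_fun.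
rewrite -mulrBl e -[X in `|X|]mulrA normrM.
apply: (le_trans (_ : _ <= 1 * `|h ^+ 2|)); last by rewrite mul1r ger0_norm ?sqr_ge0.
apply: ler_pM => //; first exact: norm_gauss1_le1.
rewrite -mulrA -expr2 normrM ler_piMl//.
by move: t01 => /andP[t0 t1]; rewrite ger0_norm.
Qed.

(** Second order Taylor formula; the factor [minr 1 `|h|] turns the remainder
    into a truncated second moment when [h] is a small multiple of a jump. *)
Lemma gauss_prim_taylor2 r h :
  `|gauss_prim (r + h) - gauss_prim r - gauss_fun r * h
    - (- 2 * r * gauss_fun r) / 2 * h ^+ 2| <= 4 * h ^+ 2 * Num.min 1 `|h|.
Proof.
pose phi k := gauss_prim (r + k) - gauss_fun r * k - (- 2 * r * gauss_fun r) / 2 * k ^+ 2.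
pose dphi k := gauss_fun (r + k) - gauss_fun r - (- 2 * r * gauss_fun r) * k.
have dp (k : R) : is_derive k 1 phi (dphi k).
  have := @is_derive_gauss_prim R => d.
  rewrite /phi; apply: trigger_derive.
  by rewrite /dphi /= /GRing.scale /=; field.
have [t /andP[t0 t1]] := @mean_value R _ _ 0 h dp.
rewrite !add0r {1 2}/phi !addr0 !(mulr0, expr0n)/= !subr0 => e.
rewrite (_ : _ - _ = dphi (t * h) * h); last by rewrite -e; ring.
have [s /andP[s0 s1] e2] := @mean_value R _ _ r (t * h) is_derive_gauss_fun.
have n1 : `|dphi (t * h)| <= 2 * `|h|.
  rewrite /dphi e2 -mulrBl normrM.
  apply: ler_pM => //; last by rewrite normrM ler_piMl// ger0_norm.
  rewrite (le_trans (ler_normB _ _))//.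
  have := norm_gauss1_le1 (r + s * (t * h)); have := norm_gauss1_le1 r; lra.
have n2 : `|dphi (t * h)| <= 4 * `|h| * `|h|.
  rewrite /dphi e2 -mulrBl normrM.
  apply: ler_pM => //; last by rewrite normrM ler_piMl// ger0_norm.
  have [q /andP[q0 q1] e3] := @mean_value R _ _ r (s * (t * h)) is_derive_gauss_fun1.
  rewrite e3 normrM; apply: ler_pM => //; first exact: norm_gauss2_le4.
  rewrite mulrA normrM ler_piMl// ger0_norm ?mulr_ge0//.
  by rewrite mulr_ile1.
rewrite normrM -[h ^+ 2]real_normK ?num_real//.
have a0 := normr_ge0 h.
have k1 := ler_wpM2r a0 n1; have k2 := ler_wpM2r a0 n2.
move: (`|h|) a0 k1 k2 => a a0 k1 k2.
by have [_|_] := leP 1 a; nra.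
Qed.

Lemma gauss_primN y : gauss_prim (- y) = - gauss_prim y.
Proof.
have d (x : R) : is_derive x 1 (fun y => gauss_prim y + gauss_prim (- y)) 0.
  have := @is_derive_gauss_prim R => d.
  apply: trigger_derive.
  by rewrite /= /GRing.scale /= /gauss_fun sqrrN; ring.
have [t _] := @mean_value R _ (cst 0) 0 y d.
rewrite add0r oppr0 gauss_prim0 addr0 subr0 /cst mul0r => /eqP.
by rewrite addrC addr_eq0 => /eqP.
Qed.

Lemma gauss_prim_nd : {homo @gauss_prim R : x y / x <= y}.
Proof.
move=> x y xy; have [t _] := @mean_value R _ _ x (y - x) is_derive_gauss_prim.
rewrite [x + _]addrC subrK => e; rewrite -subr_ge0 e mulr_ge0 ?gauss_fun_ge0//.
by rewrite subr_ge0.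
Qed.

Lemma gauss_prim_lipschitz x y : `|gauss_prim x - gauss_prim y| <= `|x - y|.
Proof.
have [t _] := @mean_value R _ _ y (x - y) is_derive_gauss_prim.
rewrite [y + _]addrC subrK => ->; rewrite normrM ler_piMl//.
by rewrite ger0_norm ?gauss_fun_ge0// gauss_fun_le1.
Qed.

Lemma continuous_gauss_prim : continuous (@gauss_prim R).
Proof.
move=> x; apply: differentiable_continuous; apply/derivable1_diffP.
by case: (@is_derive_gauss_prim R x).
Qed.

End gauss_bounds.

Section gauss_heat.
Context {R : realType}.
Local Notation mu := (@lebesgue_measure R).

Lemma sup_gauss_prim :
  has_ubound (range (@gauss_prim R)) /\ sup (range (@gauss_prim R)) = Num.sqrt pi / 2.
Proof.
have nd : nondecreasing_fun (@gauss_prim R) by move=> x y; exact: gauss_prim_nd.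
have ub : has_ubound (range (@gauss_prim R)).
  exists (Num.sqrt pi - \int[mu]_(t in `]-oo, 0%R]) gauss_fun t) => _ [y _ <-].
  rewrite /gauss_prim lerD2r -lee_fin /Rintegral.
  have i (D : set R) : measurable D -> mu.-integrable D (EFin \o @gauss_fun R).
    by move=> mD; apply: (@integrableS _ _ _ _ setT) => //; exact: integrableT_gauss.
  have iy := i _ (measurable_itv `]-oo, y]); rewrite fineK; last exact: integrable_fin_num iy.
  rewrite -integralT_gauss; apply: ge0_subset_integral => //.
  - by apply/measurable_EFinP; exact: measurable_gauss_fun.
  - by move=> x _; rewrite lee_fin gauss_fun_ge0.
have cv := nondecreasing_cvgr nd ub.
have := @ge0_continuous_FTC2y R (@gauss_fun R) (@gauss_prim R) 0 _
  (fun x _ => gauss_fun_ge0 x) (continuous_subspaceT (@continuous_gauss_fun R)) cv.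
rewrite gauss_prim0 sube0 integral0y_gauss => h.
split=> //; apply/esym/EFin_inj; apply: h.
- by move=> x _; case: (is_derive_gauss_prim x).
- by apply: cvg_at_right_filter; rewrite -[X in _ --> X]gauss_prim0; exact: continuous_gauss_prim.
- by move=> x _; rewrite derive1E; case: (is_derive_gauss_prim x).
Qed.

Lemma cvg_gauss_prim : gauss_prim y @[y --> +oo] --> (Num.sqrt pi / 2 : R).
Proof.
have [ub <-] := sup_gauss_prim; apply: nondecreasing_cvgr => // x y.
exact: gauss_prim_nd.
Qed.

Lemma gauss_prim_le y : gauss_prim y <= Num.sqrt pi / 2 :> R.
Proof.
have [ub <-] := sup_gauss_prim; apply: ub_le_sup => //; by exists y.
Qed.

(** [gauss_prim (z / sqrt t)] solves the heat equation u_t = u_zz / 4; this is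
    the first order Taylor formula in [t] with the time derivative written as a
    space derivative. *)
Lemma gauss_prim_heat (z t t' : R) : 0 < t' -> t' <= t ->
  `|gauss_prim (z / Num.sqrt t) - gauss_prim (z / Num.sqrt t')
    - (t - t') / (4 * t') * (- 2 * (z / Num.sqrt t') * gauss_fun (z / Num.sqrt t'))|
  <= 7 * ((t - t') / t') ^+ 2.
Proof.
move=> t'0 tt'; have t0 : 0 < t by exact: lt_le_trans tt'.
have s0 : 0 < Num.sqrt t by rewrite sqrtr_gt0.
have s'0 : 0 < Num.sqrt t' by rewrite sqrtr_gt0.
have st : Num.sqrt t ^+ 2 = t by rewrite sqr_sqrtr ?ltW.
have st' : Num.sqrt t' ^+ 2 = t' by rewrite sqr_sqrtr ?ltW.
have ss : Num.sqrt t' <= Num.sqrt t by rewrite ler_wsqrtr.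
set r := z / Num.sqrt t'.
pose q := Num.sqrt t' / Num.sqrt t.
have q0 : 0 < q by rewrite divr_gt0.
have q1 : q <= 1 by rewrite ler_pdivrMr// mul1r.
have -> : z / Num.sqrt t = r * (1 + (q - 1)).
  by rewrite addrC subrK /r /q mulrA divfK// gt_eqF.
have tq : (t - t') / t' = (1 - q ^+ 2) / q ^+ 2.
  rewrite /q expr_div_n st st'; field.
  by rewrite !gt_eqF.
have d1 (s : R) : is_derive s 1 (fun s => gauss_prim (r * s)) (r * gauss_fun (r * s)).
  have := @is_derive_gauss_prim R => d; apply: trigger_derive.
  by rewrite /= /GRing.scale /=; ring.
have d2 (s : R) : is_derive s 1 (fun s => r * gauss_fun (r * s))
    (r ^+ 2 * (- 2 * (r * s) * gauss_fun (r * s))).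
  have := @is_derive_gauss_fun R => d; apply: trigger_derive.
  by rewrite /= /GRing.scale /=; ring.
have [a /andP[a0 a1]] := @mean_value R _ _ 1 (q - 1) d1.
rewrite mulr1 => ->.
have [b /andP[b0 b1]] := @mean_value R _ _ 1 (a * (q - 1)) d2.
rewrite mulr1; set rho := 1 + b * (a * (q - 1)) => e.
have rho_q : q <= rho.
  have : a * b <= 1 by rewrite mulr_ile1.
  have : 0 <= a * b by rewrite mulr_ge0.
  by rewrite /rho mulrA [b * a]mulrC; move: (a * b) => ab; nra.
have rho0 : 0 < rho by exact: lt_le_trans rho_q.
rewrite tq [X in _ - X](_ : _ = - ((1 - q ^+ 2) / (2 * q ^+ 2)) * (r * gauss_fun r)); last first.
  have -> : (t - t') / (4 * t') = (t - t') / t' / 4 by field; rewrite gt_eqF.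
  by rewrite tq; field; rewrite gt_eqF.
have -> : r * gauss_fun (r * (1 + a * (q - 1))) * (q - 1) -
    - ((1 - q ^+ 2) / (2 * q ^+ 2)) * (r * gauss_fun r) =
    ((r * rho) ^+ 2 * (- 2 * (r * rho) * gauss_fun (r * rho))) * a * ((q - 1) / rho) ^+ 2
    + (- 2 * r * gauss_fun r) * ((1 - q) / q) ^+ 2 * (- ((1 + 2 * q) / 4)).
  have -> : r * gauss_fun (r * (1 + a * (q - 1))) =
     r * gauss_fun r + r ^+ 2 * (- 2 * (r * rho) * gauss_fun (r * rho)) * (a * (q - 1)).
    by rewrite -e; ring.
  by field; rewrite !gt_eqF.
have Q0 : 0 <= (1 - q) / q by rewrite divr_ge0 ?subr_ge0 ?(ltW q0) ?(ltW rho0).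
have Qle : ((1 - q) / q) ^+ 2 <= ((1 - q ^+ 2) / q ^+ 2) ^+ 2.
  rewrite ler_pXn2r ?nnegrE//; last first.
    by rewrite divr_ge0 ?sqr_ge0// subr_ge0 expr_le1// (ltW q0).
  have -> : (1 - q ^+ 2) / q ^+ 2 = (1 - q) / q * ((1 + q) / q) by field; rewrite gt_eqF.
  by rewrite ler_peMr// ler_pdivlMr// mul1r lerDr.
have Rle : ((q - 1) / rho) ^+ 2 <= ((1 - q) / q) ^+ 2.
  rewrite -[leLHS]sqrrN -mulNr opprB ler_pXn2r ?nnegrE//.
    by rewrite ler_wpM2l ?subr_ge0// lef_pV2 ?posrE.
  by rewrite divr_ge0 ?subr_ge0 ?(ltW q0) ?(ltW rho0).
apply: (le_trans (_ : _ <= 7 * ((1 - q) / q) ^+ 2)); last by rewrite ler_wpM2l.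
have n5 := norm_sqr_gauss1_le5 (r * rho).
have n1 := norm_gauss1_le1 r.
rewrite (le_trans (ler_normD _ _))//.
have -> : 7 * ((1 - q) / q) ^+ 2 = 5 * 1 * ((1 - q) / q) ^+ 2 + 1 * ((1 - q) / q) ^+ 2 * 2.
  by ring.
rewrite lerD// 2!normrM.
  rewrite ler_pM ?mulr_ge0//; last by rewrite ger0_norm ?sqr_ge0.
  by rewrite ler_pM// ger0_norm.
rewrite ler_pM ?mulr_ge0//.
  by rewrite ler_pM// ger0_norm ?sqr_ge0.
by rewrite normrN ger0_norm; nra.
Qed.

End gauss_heat.

(** In [z = y / sqrt n] and [t], a solution of the heat equation u_t = u_zz / 4.
    Here [y] is a position of the chain and [n] a number of steps: a jump has
    variance [1 / n] in [z], which the time step [2 / n] matches. *)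
Definition heat (R : realType) (n a t y : R) : R :=
  gauss_prim ((y / Num.sqrt n - a) / Num.sqrt t).

Definition heat2 (R : realType) (n p a q b t y : R) : R :=
  p * heat n a t y + q * heat n b t y.

Section heat_step.
Context {R : realType}.
Implicit Types (n a t y u eps kap : R).

Lemma norm_gauss_prim_le y : `|gauss_prim y| <= Num.sqrt pi / 2 :> R.
Proof.
by rewrite ler_norml gauss_prim_le andbT lerNl -gauss_primN gauss_prim_le.
Qed.

Lemma lin_growth_heat n a t : lin_growth (heat n a t).
Proof.
split.
  apply: (measurableT_comp (f := @gauss_prim R)).
    exact: continuous_measurable_fun continuous_gauss_prim.
  by apply: measurable_funM => //; apply: measurable_funB => //; exact: measurable_funM.
exists (Num.sqrt pi / 2) => y; apply: (le_trans (norm_gauss_prim_le _)).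
by rewrite ler_peMr ?lerDl// divr_ge0// sqrtr_ge0.
Qed.

(** One step of length [u] against one time step [2 / n]: since the jump is
    centred with unit variance, the terms [b * u] and [q * (u ^+ 2 - 1)] have
    mean zero, and what is left is small compared with [1 / n] in mean. *)
Lemma heat_step n eps kap t a y : 0 < n -> 0 < eps -> 0 <= kap -> 2 * eps <= t ->
  exists b q, forall u,
  `|heat n a t (y + u) - heat n a (t + 2 / n) y - b * u - q * (u ^+ 2 - 1)| <=
    2 / (eps * n) * (kap * u ^+ 2 + sq_tail (kap * Num.sqrt (2 * eps * n)) u)
    + 7 / (eps * n) ^+ 2.
Proof.
move=> n0 e0 k0 et; have t0 : 0 < t by apply: lt_le_trans et; rewrite mulr_gt0.
have sn0 : 0 < Num.sqrt n by rewrite sqrtr_gt0.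
have st0 : 0 < Num.sqrt t by rewrite sqrtr_gt0.
have sn2 : Num.sqrt n ^+ 2 = n by rewrite sqr_sqrtr ?ltW.
have st2 : Num.sqrt t ^+ 2 = t by rewrite sqr_sqrtr ?ltW.
pose r := (y / Num.sqrt n - a) / Num.sqrt t.
exists (gauss_fun r / (Num.sqrt n * Num.sqrt t)),
  ((- 2 * r * gauss_fun r) / (2 * n * t)) => u.
pose h := u / (Num.sqrt n * Num.sqrt t).
have h2 : h ^+ 2 = u ^+ 2 / (n * t) by rewrite /h expr_div_n exprMn sn2 st2.
have -> : heat n a t (y + u) = gauss_prim (r + h).
  congr gauss_prim; rewrite /r /h; field.
  by rewrite !gt_eqF.
have T2 := gauss_prim_taylor2 r h.
have n2 : 0 <= 2 / n by rewrite divr_ge0// ltW.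
have := @gauss_prim_heat R (y / Num.sqrt n - a) (t + 2 / n) t t0.
rewrite lerDl => /(_ n2); rewrite -/r -/(heat n a (t + 2 / n) y).
have -> : t + 2 / n - t = 2 / n by ring.
move=> Th.
set A := heat n a (t + 2 / n) y in Th *.
have -> : gauss_prim (r + h) - A - gauss_fun r / (Num.sqrt n * Num.sqrt t) * u -
     (- 2 * r * gauss_fun r) / (2 * n * t) * (u ^+ 2 - 1) =
   (gauss_prim (r + h) - gauss_prim r - gauss_fun r * h
     - (- 2 * r * gauss_fun r) / 2 * h ^+ 2)
   - (A - gauss_prim r - 2 / n / (4 * t) * (- 2 * r * gauss_fun r)).
  rewrite h2 /h; field.
  by rewrite !gt_eqF.
apply: (le_trans (ler_normB _ _)); apply: lerD.
  apply: (le_trans T2).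
  have hle : h ^+ 2 <= u ^+ 2 / (2 * eps * n).
    rewrite h2 ler_wpM2l ?sqr_ge0// lef_pV2 ?posrE ?mulr_gt0//.
    by rewrite [n * t]mulrC ler_wpM2r// ltW.
  have -> : 2 / (eps * n) * (kap * u ^+ 2 + sq_tail (kap * Num.sqrt (2 * eps * n)) u) =
     4 * (u ^+ 2 / (2 * eps * n)) * kap + 4 * (sq_tail (kap * Num.sqrt (2 * eps * n)) u / (2 * eps * n)).
    by field; rewrite !gt_eqF.
  have U0 : 0 <= u ^+ 2 / (2 * eps * n) by rewrite divr_ge0 ?sqr_ge0// !mulr_ge0// ?(ltW e0) ?(ltW n0).
  rewrite /sq_tail; case: ifPn => hu.
    apply: (le_trans (_ : _ <= 4 * h ^+ 2 * 1)).
      by rewrite ler_wpM2l ?ge_min ?lexx// mulr_ge0 ?sqr_ge0.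
    move: hle U0; move: (u ^+ 2 / (2 * eps * n)) => U hle U0.
    by have := mulr_ge0 U0 k0; lra.
  rewrite mul0r mulr0 addr0 -[leLHS]mulrA -[leRHS]mulrA ler_wpM2l// ler_pM ?sqr_ge0 ?le_min ?normr_ge0 ?ler01//.
  rewrite ge_min; apply/orP; right.
  rewrite /h normrM normfV [`|_ * _|]gtr0_norm ?mulr_gt0// ler_pdivrMr ?mulr_gt0//.
  rewrite -leNgt in hu; apply: (le_trans hu); rewrite ler_wpM2l//.
  by rewrite -sqrtrM ?(ltW n0)// ler_wsqrtr// [n * t]mulrC ler_wpM2r// (ltW n0).
apply: (le_trans Th).
have -> : 7 / (eps * n) ^+ 2 = 7 * (1 / (eps * n)) ^+ 2 by field; rewrite !gt_eqF.
have n'0 := ltW n0; have t'0 := ltW t0; have e'0 := ltW e0.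
rewrite ler_wpM2l// ler_pXn2r ?nnegrE ?divr_ge0 ?mulr_ge0//.
have -> : 2 / n / t = 1 / (t / 2 * n) by field; rewrite !gt_eqF.
rewrite ler_wpM2l// lef_pV2 ?posrE ?mulr_gt0 ?divr_gt0// ler_wpM2r//.
by rewrite ler_pdivlMr// mulrC.
Qed.

Variables (tY xY : R -> R) (x : R) (e c : nat -> (R -> R) -> R).
Hypothesis H : exit_functionals tY xY x e c.

(** Along the killed chain a combination of two heat solutions loses, at each
    step, no more than the remainder of [heat_step]; the term in [c k] accounts for
    the mass that crosses at this step. *)
Lemma heat_mean_step k n eps kap t (p q a b : R) :
  0 < n -> 0 < eps -> 0 <= kap -> 2 * eps <= t -> `|p| <= 1 -> `|q| <= 1 ->
  e k.+1 (heat2 n p a q b t) + c k (heat2 n p a q b t) <=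
    e k (heat2 n p a q b (t + 2 / n)) +
    (4 / (eps * n) * (kap + tY (kap * Num.sqrt (2 * eps * n))) + 14 / (eps * n) ^+ 2)
    * e k (fun=> 1).
Proof.
move=> n0 e0 k0 et p1 q1; pose F := heat2 n p a q b; rewrite -/F.
set w := (X in X * e k _).
have lF s : lin_growth (F s) by apply: lin_growth_lin; exact: lin_growth_heat.
have <- : e k (fun y => 1 * F (t + 2 / n) y + w * 1) = e k (F (t + 2 / n)) + w * e k (fun=> 1).
  by rewrite (alive_lin H)//; [rewrite mul1r|exact: lin_growth_cst].
apply: (alive_step H) => //.
  by apply: lin_growth_lin => //; exact: lin_growth_cst.
move=> y y0.
have [b1 [q1' h1]] := heat_step a y n0 e0 k0 et.
have [b2 [q2' h2]] := heat_step b y n0 e0 k0 et.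
set D := 2 / (eps * n) in h1 h2.
set E := 7 / (eps * n) ^+ 2 in h1 h2.
set A := kap * _ in h1 h2.
have D0 : 0 <= D by rewrite divr_ge0// mulr_ge0// ltW.
have A0 : 0 <= A by rewrite mulr_ge0// sqrtr_ge0.
exists (F (t + 2 / n) y + 2 * E - p * q1' - q * q2'), (p * b1 + q * b2),
  (p * q1' + q * q2' + 2 * D * kap), (2 * D), A, 0, 0.
split=> //; first by split=> //; rewrite mulr_ge0.
  move=> u; have := h1 u; have := h2 u; rewrite mul0r addr0.
  set B := D * _ + E => H2 H1.
  have B0 : 0 <= B by exact: le_trans H1.
  have bnd (r z : R) : `|r| <= 1 -> `|z| <= B -> r * z <= B.
    move=> r1 zB; apply: (le_trans (ler_norm _)); rewrite normrM.
    by rewrite -[leRHS]mul1r ler_pM.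
  have := bnd _ _ p1 H1; have := bnd _ _ q1 H2.
  rewrite /F /heat2 /B; move: (heat n a t _) (heat n b t _) (heat n a (_ + _) y) (heat n b (_ + _) y).
  by clear => *; lra.
rewrite mul0r addr0 mulr1 /w mul1r /D /E.
have -> : 4 / (eps * n) = 2 * (2 / (eps * n)) by field; rewrite !gt_eqF.
have -> : 14 / (eps * n) ^+ 2 = 2 * (7 / (eps * n) ^+ 2) by field; rewrite !gt_eqF.
by rewrite -/A; lra.
Qed.

End heat_step.

(** * A Lyapunov function built from the majorant *)

Section concave_profile.
Context {R : realType}.
Implicit Types b y u : R.

(** The concave function with second derivative [- (b - y)^+] on [y > 0] that is
    linear on [y <= 0] and vanishes at [- h]. *)
Definition profile h b y : R :=
  if y <= 0 then b ^+ 2 * (y + h) / 2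
  else b ^+ 2 * h / 2 + (b ^+ 3 - (Num.max (b - y) 0) ^+ 3) / 6.

Lemma profile_nd h b : 0 <= b -> {homo profile h b : y z / y <= z}.
Proof.
move=> b0 y z yz; rewrite /profile.
have s2 := sqr_ge0 b.
have [y0|y0] := leP y 0; have [z0|z0] := leP z 0.
- by move: (b ^+ 2) s2 => s s2; nra.
- have := mulr_ge0 s2 b0; rewrite -exprSr => b3.
  have : (Num.max (b - z) 0) ^+ 3 <= b ^+ 3.
    rewrite ler_pXn2r ?nnegrE// ?le_max ?lexx ?orbT// ge_max b0 andbT.
    by lra.
  by move: (b ^+ 2) (b ^+ 3) ((Num.max (b - z) 0) ^+ 3) s2 b3 => s t m s2 b3 hm; nra.
- by have := lt_le_trans y0 yz; rewrite ltNge z0.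
- rewrite lerD2l ler_pM2r ?invr_gt0// lerD2l lerN2.
  have m0 (a : R) : 0 <= Num.max a 0 by rewrite le_max lexx orbT.
  by rewrite ler_pXn2r ?nnegrE// ge_max le_max lerD2l lerN2 yz /= m0.
Qed.

Lemma profile_ge0 h b y : 0 <= h -> 0 <= b -> 0 < y -> 0 <= profile h b y.
Proof.
move=> h0 b0 y0; apply: (@le_trans _ _ (profile h b 0)).
  by rewrite /profile lexx add0r divr_ge0// mulr_ge0// sqr_ge0.
by apply: profile_nd => //; exact: ltW.
Qed.

Lemma profile_ge h b y : 0 <= h -> 0 <= b ->
  - (b ^+ 2 / 2) * Num.max (- (y + h)) 0 <= profile h b y.
Proof.
move=> h0 b0; have s2 := sqr_ge0 b.
have [y0|y0] := ltP 0 y.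
  apply: le_trans (profile_ge0 h0 b0 y0).
  rewrite mulNr oppr_le0 mulr_ge0 ?divr_ge0//.
  by rewrite le_max lexx orbT.
rewrite /profile y0; have [hy|_] := leP (- (y + h)) 0; last by lra.
by rewrite mulr0 divr_ge0// mulr_ge0//; lra.
Qed.

Lemma profile_le h b y m : 0 <= h -> 0 <= b -> 0 < y -> 0 <= m ->
  profile h b y <= b ^+ 2 * h / 2 + m * b ^+ 2 / 6 + y / 2 * sq_tail m b.
Proof.
move=> h0 b0 y0 m0; rewrite /profile [y <= 0]leNgt y0 /= -addrA lerD2l.
rewrite /sq_tail ger0_norm//; have s2 := sqr_ge0 b.
have c : forall a : R, 0 <= a -> 0 <= a ^+ 3 by move=> a a0; exact: exprn_ge0.
have [bm|bm] := ltP m b; last first.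
  rewrite mulr0 addr0 ler_pM2r ?invr_gt0//.
  have : 0 <= Num.max (b - y) 0 ^+ 3 by apply: c; rewrite le_max lexx orbT.
  have : b ^+ 3 <= m * b ^+ 2 by rewrite exprS ler_wpM2r.
  by lra.
have mb : 0 <= m * b ^+ 2 / 6 by rewrite divr_ge0 ?mulr_ge0.
rewrite -[leLHS]add0r lerD//.
rewrite -subr_ge0; have [by0|by0] := leP (b - y) 0.
  rewrite expr0n/= subr0.
  rewrite (_ : _ - _ = b ^+ 2 * (3 * y - b) / 6); last by field.
  by rewrite divr_ge0// mulr_ge0//; lra.
rewrite (_ : _ - _ = y ^+ 2 * (3 * b - y) / 6); last by field.
by rewrite divr_ge0// mulr_ge0 ?sqr_ge0//; lra.
Qed.

(** Concavity, with the gain in the second order term that jumps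
    [0 < u <= a] produce. *)
Lemma profile_step h b y u a : 0 <= b -> 0 < y -> 0 <= a ->
  profile h b (y + u) <= profile h b y + (Num.max (b - y) 0) ^+ 2 / 2 * u
    - Num.max (b - y - a) 0 / 2 * (if 0 < u <= a then u ^+ 2 else 0).
Proof.
move=> b0 y0 a0; rewrite /profile [y <= 0]leNgt y0 /=.
have [yu|yu] := leP (y + u) 0.
  have u0 : u < 0 by lra.
  rewrite [0 < u]ltNge (ltW u0)/= mulr0 subr0.
  have [p0|p0] := leP (b - y) 0.
    rewrite !expr0n/= mul0r mul0r subr0 addr0.
    have b3 := exprn_ge0 3 b0; have s2 := sqr_ge0 b.
    have := mulr_ge0_le0 s2 yu; lra.
  have z0 : 0 <= - (y + u) by lra.
  rewrite -subr_ge0 [X in 0 <= X](_ : _ = (3 * (b - y) * y ^+ 2 + y ^+ 2 * y) / 6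
    + (- (y + u)) * (2 * (b - y) * y + y ^+ 2) / 2); last by field.
  have s2 := sqr_ge0 y; have y'0 := ltW y0; have p'0 := ltW p0.
  by rewrite addr_ge0// divr_ge0// ?addr_ge0 ?mulr_ge0// addr_ge0// !mulr_ge0.
have -> : b - (y + u) = b - y - u by lra.
move: (b - y) => p.
case: ifPn => [/andP[u0 ua]|hu].
  have [q0|q0] := leP (p - u) 0; have [r0|r0] := leP (p - a) 0.
  - have [p0|p0] := leP p 0.
      by rewrite !expr0n/= !mul0r; lra.
    have h1 : 0 <= p ^+ 2 by rewrite sqr_ge0.
    by rewrite expr0n/= mul0r subr0 mul0r subr0; nra.
  - by exfalso; lra.
  - have p0 : 0 < p by lra.
    have := sqr_ge0 u; have := ltW u0; rewrite mul0r mul0r subr0.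
    have -> : Num.max p 0 = p by apply/max_idPl; exact: ltW.
    move=> h1 h2; rewrite -subr_ge0 [X in 0 <= X](_ : _ = u ^+ 2 * (3 * p - u) / 6); last by field.
    by rewrite divr_ge0// mulr_ge0//; lra.
  - have p0 : 0 < p by lra.
    have := sqr_ge0 u; have := ltW u0.
    have -> : Num.max p 0 = p by apply/max_idPl; exact: ltW.
    move=> h1 h2; rewrite -subr_ge0 [X in 0 <= X](_ : _ = u ^+ 2 * (3 * a - u) / 6); last by field.
    by rewrite divr_ge0// mulr_ge0//; lra.
rewrite mulr0 subr0.
have [q0|q0] := leP (p - u) 0; have [p0|p0] := leP p 0.
- by rewrite !expr0n/= !mul0r; lra.
- rewrite -subr_ge0 expr0n/= [X in 0 <= X](_ : _ = p ^+ 2 * (3 * u - p) / 6); last by field.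
  by rewrite divr_ge0// mulr_ge0 ?sqr_ge0//; lra.
- have := exprn_ge0 3 (ltW q0); rewrite !expr0n/= !mul0r; lra.
rewrite -subr_ge0 [X in 0 <= X](_ : _ = u ^+ 2 * (3 * p - u) / 6); last by field.
by rewrite divr_ge0// mulr_ge0 ?sqr_ge0//; lra.
Qed.

End concave_profile.

Section majorant.
Context {R : realType} d2 (T2 : measurableType d2) (P2 : probability T2 R)
  (Y : {RV P2 >-> R}).
Hypothesis Y0 : forall w, 0 < Y w.
Hypothesis Y2 : (\int[P2]_w (Y w ^+ 2)%:E < +oo)%E.

Let mY : measurable_fun setT Y. Proof. exact: measurable_funP. Qed.
Let tY := tail_majorant Y.
Let xY := excess_majorant Y.

Lemma tail_majorant_ge0 a : 0 <= tY a.
Proof.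
apply: Rintegral_ge0 => w _; rewrite /sq_tail; case: ifPn => // _; exact: sqr_ge0.
Qed.

Lemma tail_majorant_ni a b : a <= b -> tY b <= tY a.
Proof.
move=> ab; apply: le_Rintegral => //; [exact: integrable_sq_tail|exact: integrable_sq_tail|].
move=> w _; rewrite /sq_tail; case: ifPn => [bY|_].
  by rewrite (le_lt_trans ab bY).
by case: ifPn => // _; exact: sqr_ge0.
Qed.

(** This is where the finite second moment of the majorant is used. *)
Lemma tail_majorant_small e : 0 < e -> exists2 a, 0 <= a & forall b, a <= b -> tY b <= e.
Proof.
move=> e0; have iY := integrable_sqr mY Y2.
have pw w : setT w -> (sq_tail n%:R (Y w))%:E @[n --> \oo] --> (0%:E : \bar R).
  move=> _; apply: cvg_EFin; first exact: nearW.
  apply: cvg_near_cst; near=> n; rewrite /sq_tail /= ltNge.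
  suff -> : `|Y w| <= n%:R by [].
  by near: n; exact: nbhs_infty_ger.
have dom n w : setT w -> (`|(sq_tail n%:R (Y w))%:E| <= (Y w ^+ 2)%:E)%E.
  move=> _; rewrite abse_EFin lee_fin /sq_tail; case: ifPn => _.
    by rewrite ger0_norm ?sqr_ge0.
  by rewrite normr0 sqr_ge0.
have mf n : measurable_fun setT (fun w => (sq_tail n%:R (Y w))%:E).
  by apply/measurable_EFinP; apply: measurableT_comp => //; exact: measurable_sq_tail.
have h := @dominated_cvg _ T2 R P2 setT measurableT
  (fun n w => (sq_tail n%:R (Y w))%:E) (cst 0%E) (fun w => (Y w ^+ 2)%:E) mf pw
  (fun w _ => isT) iY dom.
have {}h : tY n%:R @[n --> \oo] --> (0 : R).
  by apply: fine_cvg; move: h; rewrite integral0.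
have /cvgrPdist_le/(_ e e0)[N _ hN] := h.
exists N%:R => // b Nb; apply: (le_trans (tail_majorant_ni Nb)).
have := hN N (leqnn N); rewrite /= sub0r normrN ger0_norm//.
exact: tail_majorant_ge0.
Unshelve. all: by end_near. Qed.


Lemma excess_majorant_ni a b : 0 <= a -> a <= b -> xY b <= xY a.
Proof.
move=> a0 ab; apply: le_Rintegral => //.
- exact: integrable_excess mY Y2 _ (le_trans a0 ab).
- exact: integrable_excess mY Y2 _ a0.
- by move=> w _; rewrite /excess ge_max !le_max lerD2l lerN2 ab lexx orbT.
Qed.

(** A Lyapunov function for the killed chain: its mean decreases at a rate of
    order [xY (y + B)], which dominates the mean overshoot below [- B], and its slope
    below [0] is as small as wished when [B] is large.  It is the average of the
    profiles above, with [b] the part of the majorant beyond a high level: the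
    slope [b ^+ 2 / 2] averages to a small tail of the second moment, and the
    second derivative [- (b - y)^+] averages to a mean excess of the majorant. *)
Lemma lyapunov_function A kap : 0 <= A -> 0 < kap ->
  exists (B : R) (W D : R -> R), [/\ 0 <= B, lin_growth W,
    (forall y, 0 < y -> 0 <= W y) /\ (forall y, - kap * Num.max (- (y + B)) 0 <= W y),
    forall y u, 0 < y -> W (y + u) <= W y + D y * u
       - xY (y + B) / 2 * (if 0 < u <= A then u ^+ 2 else 0)
    & forall eps, 0 < eps -> exists C, forall y, 0 < y -> W y <= eps * y + C].
Proof.
move=> A0 k0.
have [B0 B00 hB0] := tail_majorant_small k0.
(* [Z] has second moment at most [kap]; the shift by [A] in [B] below absorbs
   the loss of [A] in the second order term of [profile_step] *)
pose Z w := Num.max (Y w - B0) 0.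
have Z0 w : 0 <= Z w by rewrite /Z le_max lexx orbT.
have mZ : measurable_fun setT Z.
  by apply: measurable_maxr => //; exact: measurable_funB.
have ZY w : Z w ^+ 2 <= sq_tail B0 (Y w).
  rewrite /Z /sq_tail gtr0_norm//; have [h|h] := ltP B0 (Y w).
    have -> : Num.max (Y w - B0) 0 = Y w - B0 by apply/max_idPl; rewrite subr_ge0 ltW.
    by rewrite ler_pXn2r ?nnegrE ?subr_ge0 ?(ltW h) ?(ltW (Y0 w))// gerDl oppr_le0.
  have -> : Num.max (Y w - B0) 0 = 0 by apply/max_idPr; rewrite subr_le0.
  by rewrite expr0n.
have ZleY w : Z w <= Y w by rewrite /Z ge_max (ltW (Y0 w)) andbT gerDl oppr_le0.
have itail := integrable_sq_tail mY Y2.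
have Z2 : (\int[P2]_w (Z w ^+ 2)%:E < +oo)%E.
  apply: le_lt_trans Y2; apply: ge0_le_integral => //.
  - by move=> w _; rewrite lee_fin sqr_ge0.
  - by apply/measurable_EFinP; exact: measurable_funX.
  - by apply/measurable_EFinP; exact: measurable_funX.
  - by move=> w _; rewrite lee_fin ler_pXn2r ?nnegrE ?ZleY ?(ltW (Y0 w)).
pose B := B0 + A.
have B1 : 0 <= B by rewrite addr_ge0.
have sZ : \int[P2]_w (Z w ^+ 2) <= kap.
  apply: le_trans (hB0 B0 (lexx _)); apply: le_Rintegral => //.
  exact: integrable_sqr mZ Z2.
  exact: itail.
pose W y := \int[P2]_w profile B (Z w) y.
pose D y := \int[P2]_w (Num.max (Z w - y) 0 ^+ 2 / 2).
(* [Z] is nonnegative, and the truncation makes the bounds hold for all [b] *)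
pose q y (b : R) := profile B (Num.max b 0) y.
have mq y : measurable_fun setT (q y).
  rewrite /q /profile; have [y0|y0] := leP y 0.
    apply: measurable_funM => //; apply: measurable_funM => //; apply: measurable_funX.
    exact: measurable_maxr.
  apply: measurable_funD.
    apply: measurable_funM => //; apply: measurable_funM => //; apply: measurable_funX.
    exact: measurable_maxr.
  apply: measurable_funM => //; apply: measurable_funB; apply: measurable_funX.
    exact: measurable_maxr.
  apply: measurable_maxr => //; apply: measurable_funB => //.
  exact: measurable_maxr.
have q_le y b : `|q y b| <= (B + `|y|) / 2 * (1 + b ^+ 2).
  pose c := Num.max b 0; have c0 : 0 <= c by rewrite /c le_max lexx orbT.
  have cb : c ^+ 2 <= 1 + b ^+ 2.
    rewrite /c; have [_|_] := leP b 0; last by rewrite lerDr.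
    by rewrite expr0n/= addr_ge0 ?sqr_ge0.
  have By : 0 <= (B + `|y|) / 2 by rewrite divr_ge0// addr_ge0.
  apply: (@le_trans _ _ ((B + `|y|) / 2 * c ^+ 2)); last by rewrite ler_wpM2l.
  rewrite /q -/c; have s2 := sqr_ge0 c; have [y0|y0] := leP y 0.
    rewrite /profile y0 normrM normrM [`|2^-1|]ger0_norm ?invr_ge0//.
    rewrite [`|c ^+ 2|]ger0_norm//; have := ler_normD y B.
    by rewrite [`|B|]ger0_norm//; nra.
  rewrite ger0_norm; last exact: profile_ge0.
  have := profile_le B1 c0 y0 (lexx 0).
  rewrite mul0r mul0r addr0 => /le_trans; apply.
  have : sq_tail 0 c <= c ^+ 2 by rewrite /sq_tail; case: ifPn.
  by rewrite [`|y|]gtr0_norm//; nra.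
have ip y : P2.-integrable setT (fun w => (profile B (Z w) y)%:E).
  have := integrable_quadratic mZ Z2 (mq y) (q_le y).
  by congr (_ .-integrable _ _); apply/funext => w; rewrite /q; congr (profile _ _ _)%:E; apply/max_idPl.
have iZ2 := integrable_sqr mZ Z2.
have EZ (k : R) : \int[P2]_w (k * Z w ^+ 2) = k * \int[P2]_w (Z w ^+ 2).
  by rewrite RintegralZl.
have iZk (k : R) : P2.-integrable setT (EFin \o (fun w => k * Z w ^+ 2)).
  by have := integrableZl measurableT k iZ2.
have EZ0 : 0 <= \int[P2]_w (Z w ^+ 2) by apply: Rintegral_ge0 => w _; exact: sqr_ge0.
have nd : {homo W : x y / x <= y}.
  move=> x y xy; apply: le_Rintegral => //; [exact: ip|exact: ip|].
  by move=> w _; exact: profile_nd.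
have xYE y : 0 < y -> \int[P2]_w (Num.max (Z w - y - A) 0) = xY (y + B).
  move=> y0; apply: eq_Rintegral => w _; rewrite /excess gtr0_norm//.
  rewrite /Z /B; have [h|h] := leP (Y w - B0) 0.
    have -> : Num.max (0 - y - A) 0 = 0 by apply/max_idPr; lra.
    by apply/esym/max_idPr; lra.
  by congr (Num.max _ _); lra.
exists B; exists W; exists D; split=> //.
- split; first by apply: nondecreasing_measurable => // x y; exact: nd.
  exists ((B + 1) / 2 * (1 + kap)) => y.
  have By0 : 0 <= (B + `|y|) / 2 by rewrite divr_ge0// addr_ge0.
  have ic : P2.-integrable setT (EFin \o (fun=> (B + `|y|) / 2)).
    exact: finite_measure_integrable_cst.
  have h1 : `|W y| <= \int[P2]_w ((B + `|y|) / 2 + (B + `|y|) / 2 * Z w ^+ 2).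
    apply: (le_trans (le_normr_Rintegral measurableT (ip y))).
    apply: le_Rintegral => //.
    + exact: integrable_norm (ip y).
    + by have := integrableD measurableT ic (iZk ((B + `|y|) / 2)).
    + move=> w _; have := q_le y (Z w); rewrite /q.
      have -> : Num.max (Z w) 0 = Z w by apply/max_idPl.
      by rewrite mulrDr mulr1.
  apply: (le_trans h1); rewrite (RintegralD measurableT ic (iZk _)).
  rewrite EZ Rintegral_cst// [X in fine X](_ : _ = 1%E) /= ?mulr1; last exact: probability_setT.
  apply: (@le_trans _ _ ((B + `|y|) / 2 * (1 + kap))).
    by rewrite mulrDr mulr1 lerD2l ler_wpM2l.
  rewrite [leRHS]mulrAC ler_wpM2r//; first by rewrite addr_ge0// ltW.
  by have := mulr_ge0 B1 (normr_ge0 y); have := normr_ge0 y; lra.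
- split; first by move=> y y0; apply: Rintegral_ge0 => w _; exact: profile_ge0.
  move=> y; set M := Num.max _ 0; have M0 : 0 <= M by rewrite /M le_max lexx orbT.
  apply: (@le_trans _ _ (\int[P2]_w (- (M / 2) * Z w ^+ 2))).
    by rewrite EZ; nra.
  apply: le_Rintegral => //; first exact: ip.
  move=> w _; have := profile_ge y B1 (Z0 w); rewrite -/M; apply: le_trans.
  by rewrite le_eqVlt; apply/orP; left; apply/eqP; field.
- move=> y u y0; set I := (if _ then _ else _).
  have iD : P2.-integrable setT (EFin \o (fun w => Num.max (Z w - y) 0 ^+ 2 / 2)).
    apply: (integrable_quadratic (phi := fun b => Num.max (b - y) 0 ^+ 2 / 2) mZ Z2 (c := 1 + y ^+ 2)).
      apply: measurable_funM => //; apply: measurable_funX; apply: measurable_maxr => //.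
      exact: measurable_funB.
    move=> b; rewrite ger0_norm ?divr_ge0 ?sqr_ge0//.
    have s1 := sqr_ge0 (b + y); have s2 := sqr_ge0 b; have s3 := sqr_ge0 y.
    by have [_|_] := leP (b - y) 0; nra.
  have iX : P2.-integrable setT (EFin \o (fun w => Num.max (Z w - y - A) 0)).
    apply: (integrable_quadratic (phi := fun b => Num.max (b - y - A) 0) mZ Z2 (c := 1)).
      apply: measurable_maxr => //; apply: measurable_funB => //.
      exact: measurable_funB.
    move=> b; rewrite ger0_norm ?le_max ?lexx ?orbT//.
    by have s1 := sqr_ge0 (b - 1); have [_|_] := leP (b - y - A) 0; nra.
  have iDu := integrableZl measurableT u iD.
  have iXI := integrableZl measurableT (- (I / 2)) iX.
  have -> : W y + D y * u - xY (y + B) / 2 * I =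
      \int[P2]_w (profile B (Z w) y + u * (Num.max (Z w - y) 0 ^+ 2 / 2)
         + - (I / 2) * Num.max (Z w - y - A) 0).
    rewrite (RintegralD measurableT (integrableD measurableT (ip y) iDu) iXI).
    rewrite (RintegralD measurableT (ip y) iDu).
    rewrite RintegralZl// RintegralZl// xYE// /W /D; ring.
  apply: le_Rintegral => //; first exact: ip.
    have := integrableD measurableT (integrableD measurableT (ip y) iDu) iXI.
    by [].
  move=> w _; have := profile_step B u (Z0 w) y0 A0; rewrite -/I.
  by move/le_trans; apply; lra.
- move=> eps e0; have [m m0 hm] := tail_majorant_small e0.
  exists (kap * B / 2 + m * kap / 6) => y y0.
  have iS := integrableZl measurableT (y / 2) (itail m).
  apply: (@le_trans _ _ (\int[P2]_w ((B / 2 + m / 6) * Z w ^+ 2 + y / 2 * sq_tail m (Y w)))).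
    apply: le_Rintegral => //; first exact: ip.
      by have := integrableD measurableT (iZk (B / 2 + m / 6)) iS.
    move=> w _; have := profile_le B1 (Z0 w) y0 m0.
    have : sq_tail m (Z w) <= sq_tail m (Y w).
      rewrite /sq_tail !ger0_norm// ?(ltW (Y0 w))//; case: ltP => h.
        by rewrite (lt_le_trans h (ZleY w)) ler_pXn2r ?nnegrE ?(ltW (Y0 w)).
      by case: ifPn => // _; exact: sqr_ge0.
    by nra.
  rewrite (RintegralD measurableT (iZk _) iS) EZ RintegralZl//; last exact: itail.
  have := hm m (lexx m); rewrite /tY /tail_majorant => hm'.
  move: (\int[P2]_x sq_tail m (Y x)) hm' => t ht.
  have h1 : (B / 2 + m / 6) * \int[P2]_w (Z w ^+ 2) <= (B / 2 + m / 6) * kap.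
    by rewrite ler_wpM2l// addr_ge0// divr_ge0.
  have h2 : y / 2 * t <= y / 2 * eps by rewrite ler_wpM2l// divr_ge0// ltW.
  have := mulr_gt0 e0 y0; lra.
Qed.

End majorant.

(** * Estimates on overshoots and survival *)

(** What is used of the majorant of the jumps; see [tail_majorant_small] and
    [lyapunov_function]. *)
Record majorant_estimates (R : realType) (tY xY : R -> R) : Prop := MajorantEstimates {
  tail_small : forall e, 0 < e -> exists2 a, 0 <= a & forall b, a <= b -> tY b <= e ;
  excess_ge0 : forall s, 0 <= xY s ;
  excess_ni : forall a b, 0 <= a -> a <= b -> xY b <= xY a ;
  lyapunov : forall A kap, 0 <= A -> 0 < kap ->
    exists (B : R) (W D : R -> R), [/\ 0 <= B, lin_growth W,
    (forall y, 0 < y -> 0 <= W y) /\ (forall y, - kap * Num.max (- (y + B)) 0 <= W y),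
    forall y u, 0 < y -> W (y + u) <= W y + D y * u
       - xY (y + B) / 2 * (if 0 < u <= A then u ^+ 2 else 0)
    & forall eps, 0 < eps -> exists C, forall y, 0 < y -> W y <= eps * y + C] }.

Section exit_functional_theory.
Context {R : realType} (tY xY : R -> R) (x : R) (e c : nat -> (R -> R) -> R).
Hypothesis H : exit_functionals tY xY x e c.

Lemma alive_comb n a b f g h : lin_growth f -> lin_growth g ->
  (forall y, h y = a * f y + b * g y) -> e n h = a * e n f + b * e n g.
Proof.
by move=> lf lg hE; rewrite -(alive_lin H)//; congr (e n _); apply/funext.
Qed.

Lemma cross_comb n a b f g h : lin_growth f -> lin_growth g ->
  (forall y, h y = a * f y + b * g y) -> c n h = a * c n f + b * c n g.
Proof.
by move=> lf lg hE; rewrite -(cross_lin H)//; congr (c n _); apply/funext.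
Qed.

Lemma alive_ge0 n f : lin_growth f -> (forall y, 0 < y -> 0 <= f y) -> 0 <= e n f.
Proof.
move=> lf f0.
have <- : e n (fun=> 0) = 0.
  rewrite (@alive_comb n 0 0 f f (fun=> 0))// ?mul0r ?addr0// => y.
  by rewrite !mul0r addr0.
by apply: (alive_le H) => //; exact: lin_growth_cst.
Qed.

Lemma cross_ge0 n f : lin_growth f -> (forall y, y <= 0 -> 0 <= f y) -> 0 <= c n f.
Proof.
move=> lf f0.
have <- : c n (fun=> 0) = 0.
  rewrite (@cross_comb n 0 0 f f (fun=> 0))// ?mul0r ?addr0// => y.
  by rewrite !mul0r addr0.
by apply: (cross_le H) => //; exact: lin_growth_cst.
Qed.

Lemma lin_growthN (f : R -> R) : lin_growth f -> lin_growth (fun y => - f y).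
Proof.
move=> lf; have := lin_growth_lin (-1) 0 lf lf.
by congr lin_growth; apply/funext => y; rewrite mul0r addr0 mulN1r.
Qed.

Lemma lin_growth_opp : lin_growth (fun y : R => - y).
Proof. exact: lin_growthN (lin_growth_id (R := R)). Qed.

Lemma aliveN n f : lin_growth f -> e n (fun y => - f y) = - e n f.
Proof.
move=> lf; rewrite (@alive_comb n (-1) 0 f f)// => [|y]; first by rewrite mul0r addr0 mulN1r.
by rewrite mul0r addr0 mulN1r.
Qed.

Lemma crossN n f : lin_growth f -> c n (fun y => - f y) = - c n f.
Proof.
move=> lf; rewrite (@cross_comb n (-1) 0 f f)// => [|y]; first by rewrite mul0r addr0 mulN1r.
by rewrite mul0r addr0 mulN1r.
Qed.

Lemma survival0 : e 0%N (fun=> 1) = 1.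
Proof. by rewrite (alive_init H)//; exact: lin_growth_cst. Qed.

Lemma survival_step n : e n.+1 (fun=> 1) + c n (fun=> 1) <= e n (fun=> 1).
Proof.
have l1 := @lin_growth_cst R 1.
apply: (alive_step H) => // y y0; exists 1, 0, 0, 0, 0, 0, 0.
by split=> //; [move=> u|]; rewrite !mul0r !addr0.
Qed.

Lemma survival_ge0 n : 0 <= e n (fun=> 1).
Proof. by apply: alive_ge0 => //; exact: lin_growth_cst. Qed.

Lemma cross1_ge0 n : 0 <= c n (fun=> 1).
Proof. by apply: cross_ge0 => //; exact: lin_growth_cst. Qed.

Lemma survival_ni m n : (m <= n)%N -> e n (fun=> 1) <= e m (fun=> 1).
Proof.
elim: n => [|n ih]; first by rewrite leqn0 => /eqP ->.
rewrite leq_eqVlt => /predU1P[->//|mn]; apply: le_trans (ih mn).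
by have := survival_step n; have := cross1_ge0 n; lra.
Qed.

Lemma survival_le1 n : e n (fun=> 1) <= 1.
Proof. by have := survival_ni (leq0n n); rewrite survival0. Qed.

Definition overshoot n := c n (fun y => - y).

Lemma overshoot_ge0 n : 0 <= overshoot n.
Proof.
by apply: cross_ge0 => [|y]; [exact: lin_growth_opp|rewrite oppr_ge0].
Qed.

(** Optional stopping: the jumps are centred, so the mean of the stopped chain is
    constant, and the surviving part gains what the crossings carry below [0]. *)
Lemma alive_id n : e n id = x + \sum_(0 <= k < n) overshoot k.
Proof.
have li := @lin_growth_id R; have lo := lin_growth_opp.
elim: n => [|n ih]; first by rewrite big_nil addr0 (alive_init H).
rewrite big_nat_recr//= addrA -ih; apply/eqP; rewrite eq_le; apply/andP; split.
  have : e n.+1 id + c n id <= e n id.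
    apply: (alive_step H) => // y y0; exists y, 1, 0, 0, 0, 0, 0.
    by split=> //; [move=> u|]; rewrite !mul0r ?mul1r !addr0.
  by rewrite /overshoot crossN//; lra.
have : e n.+1 (fun y => - y) + c n (fun y => - y) <= e n (fun y => - y).
  apply: (alive_step H) => // y y0; exists (- y), (-1), 0, 0, 0, 0, 0.
  by split=> //; [move=> u|]; rewrite !mul0r !addr0//; lra.
by rewrite /overshoot !aliveN//; lra.
Qed.

Lemma sum_cross1 m n : (m <= n)%N ->
  \sum_(m <= k < n) c k (fun=> 1) <= e m (fun=> 1).
Proof.
move=> mn; suff : \sum_(m <= k < n) c k (fun=> 1) <= e m (fun=> 1) - e n (fun=> 1).
  by have := survival_ge0 n; lra.
elim: n mn => [|n ih]; first by rewrite leqn0 => /eqP ->; rewrite big_nil subrr.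
rewrite leq_eqVlt => /predU1P[->|mn]; first by rewrite big_geq// subrr.
by rewrite big_nat_recr//=; have := ih mn; have := survival_step n; lra.
Qed.

End exit_functional_theory.

Section overshoot_bound.
Context {R : realType} (tY xY : R -> R).
Hypothesis M : majorant_estimates tY xY.

(** Since the jumps are centred with unit variance and uniformly integrable
    square, upward jumps of moderate size carry a fixed part of the variance.
    The left-hand side is a combination of functions of controlled mean.  It comes
    from [u ^+ 2 >= 2 * k * u - k ^+ 2] for [0 < u], where the half sum of [u] and
    of a lower bound of [|u|] replaces the positive part of [u]. *)
Lemma upward_jump (a u k : R) : 0 < a -> k = 1 / (8 * a) ->
  2 * k * ((u + (u ^+ 2 - sq_tail a u) / a) / 2 - u ^+ 2 / (8 * a)) - k ^+ 2
    <= (if 0 < u <= 8 * a then u ^+ 2 else 0).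
Proof.
move=> a0 kE.
have k0 : 0 < k by rewrite kE divr_gt0// mulr_gt0.
have h1 : (u ^+ 2 - sq_tail a u) / a <= `|u|.
  rewrite ler_pdivrMr// /sq_tail; case: ltP => h; first by rewrite subrr mulr_ge0// ltW.
  by rewrite subr0 -[u ^+ 2]real_normK ?num_real// expr2 ler_wpM2l.
have s2 := sqr_ge0 u.
have h2 : 0 <= u ^+ 2 / (8 * a) by rewrite divr_ge0 ?sqr_ge0// mulr_ge0 ?ltW.
have s3 := sqr_ge0 (u - k).
move: (sq_tail a u) h1 => t h1.
case: ifPn => [/andP[u0 ua]|].
  rewrite gtr0_norm// in h1.
  have : (u + (u ^+ 2 - t) / a) / 2 - u ^+ 2 / (8 * a) <= u by lra.
  by move=> /(ler_wpM2l (ltW k0)); nra.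
rewrite negb_and -leNgt -ltNge => /orP[u0|ua].
  rewrite ler0_norm// in h1.
  have : (u + (u ^+ 2 - t) / a) / 2 - u ^+ 2 / (8 * a) <= 0 by lra.
  by move=> /(ler_wpM2l (ltW k0)); nra.
have u0 : 0 < u by apply: lt_trans ua; rewrite mulr_gt0.
rewrite gtr0_norm// in h1.
have : u <= u ^+ 2 / (8 * a).
  by rewrite ler_pdivlMr ?mulr_gt0// expr2 ler_wpM2l// (ltW u0, ltW ua).
move=> h3; have : (u + (u ^+ 2 - t) / a) / 2 - u ^+ 2 / (8 * a) <= 0 by lra.
by move=> /(ler_wpM2l (ltW k0)); nra.
Qed.

(** The total overshoot after time [m] is small compared with the mean of the
    chain at time [m], up to a multiple of the survival probability.  The Lyapunov
    function [W] decreases in mean at the rate [k ^+ 2 / 2 * g], and [g] bounds the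
    mean overshoot below [- B]; so the sum of these overshoots is at most the mean
    of [W] at time [m], and [W] grows slower than any linear function.  The
    remaining overshoots cost at most [B] times the probability of crossing. *)
Lemma overshoot_tail (eps : R) : 0 < eps -> exists2 C, 0 <= C &
  forall x e c, exit_functionals tY xY x e c -> forall m n, (m <= n)%N ->
  \sum_(m <= k < n) overshoot c k <= eps * e m id + C * e m (fun=> 1).
Proof.
move=> eps0.
have [a0 a00 ha0] := tail_small M (divr_gt0 ltr01 (ltr0n R 2)).
pose a := a0 + 1; have a1 : 0 < a by rewrite ltr_pwDr.
have ha : tY a <= 1 / 2 by apply: ha0; rewrite lerDl.
(* this value of [k] leaves a drift of at least [k ^+ 2 / 2], because the mean of
   [sq_tail a] is at most half of the variance *)
pose k := 1 / (8 * a); have k0 : 0 < k by rewrite divr_gt0// mulr_gt0.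
have ka : k * a = 1 / 8 by rewrite /k; field; rewrite gt_eqF.
have A0 : 0 <= 8 * a by rewrite mulr_ge0// ltW.
(* the negative part of [W] at the crossing costs half of the drift *)
have kap0 : 0 < k ^+ 2 / 4 by rewrite divr_gt0// exprn_gt0.
have [B [W [D [B0 lW [W0 Wlow] Wstep Wlin]]]] := lyapunov M A0 kap0.
pose eps' := eps * (k ^+ 2 / 4).
have eps'0 : 0 < eps' by rewrite mulr_gt0.
have [C0 hC0] := Wlin _ eps'0.
pose C1 := Num.max C0 0.
have C10 : 0 <= C1 by rewrite /C1 le_max lexx orbT.
have hC1 y : 0 < y -> W y <= eps' * y + C1.
  by move=> y0; apply: (le_trans (hC0 y y0)); rewrite lerD2l /C1 le_max lexx.
exists (B + C1 / (k ^+ 2 / 4)); first by rewrite addr_ge0// divr_ge0// ltW.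
move=> x e c H.
have l1 := @lin_growth_cst R 1; have li := @lin_growth_id R; have lo := @lin_growth_opp R.
pose g y := xY (Num.max y 0 + B).
have mx (y : R) : 0 <= Num.max y 0 by rewrite le_max lexx orbT.
have gE y : 0 < y -> g y = xY (y + B).
  by move=> y0; rewrite /g; congr (xY (_ + _)); apply/max_idPl; exact: ltW.
have lg : lin_growth g.
  split.
    apply: nonincreasing_measurable => // y z yz; apply: (excess_ni M).
      by rewrite addr_ge0.
    by rewrite lerD2r ge_max !le_max yz lexx orbT.
  exists (xY B) => y; rewrite ger0_norm ?(excess_ge0 M)//.
  apply: (@le_trans _ _ (xY B)); last by rewrite ler_peMr ?(excess_ge0 M)// lerDl.
  by apply: (excess_ni M) => //; rewrite lerDr.
pose f y := Num.max (- (y + B)) 0.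
have lf : lin_growth f.
  split.
    apply: measurable_maxr => //; apply: measurableT_comp => //.
    exact: measurable_funD.
  exists (1 + B) => y; rewrite /f.
  have h1 := normr_ge0 y; have h2 := mulr_ge0 B0 h1.
  have h3 : - y <= `|y| by rewrite -normrN ler_norm.
  rewrite ger0_norm ?le_max ?lexx ?orbT// ge_max.
  by apply/andP; split; lra.
have f0 y : 0 <= f y by rewrite /f le_max lexx orbT.
have cf n : c n f <= e n g.
  have := alive_step H n lf lg; suff h : 0 <= e n.+1 f.
    move=> /(_ _)/le_trans => hh; apply: le_trans (hh _ _ (lexx _)); first by rewrite lerDr.
    move=> y y0; exists 0, 0, 0, 0, 0, 1, (y + B).
    have yB : 0 <= y + B by rewrite addr_ge0// ltW.
    split=> //; last by rewrite gE// !mul0r mul1r !add0r.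
    move=> u; rewrite !mul0r mul1r !add0r /f /excess.
    rewrite ge_max !le_max lexx orbT andbT; apply/orP; left.
    by have := ler_norm (- u); rewrite normrN; lra.
  by apply: (alive_ge0 H) => // y _.
have step n : e n.+1 W + c n W <= e n W - k ^+ 2 / 2 * e n g.
  have -> : e n W - k ^+ 2 / 2 * e n g = e n (fun y => 1 * W y + (- (k ^+ 2 / 2)) * g y).
    by rewrite (alive_lin H)// mul1r mulNr.
  apply: (alive_step H) => //; first exact: lin_growth_lin.
  move=> y y0; have G0 : 0 <= xY (y + B) by exact: (excess_ge0 M).
  rewrite gE//.
  set G := xY (y + B) in G0 *.
  exists (W y + G * k ^+ 2 / 2), (D y - G * k / 2), (- 3 * G * k ^+ 2), (4 * G * k ^+ 2), a, 0, 0.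
  split=> //.
  - by split; rewrite ?(ltW a1)// mulr_ge0 ?sqr_ge0// mulr_ge0.
  - move=> u; rewrite mul0r addr0; apply: (le_trans (Wstep y u y0)); rewrite -/G.
    have hj := upward_jump u a1 (erefl k).
    have := ler_wpM2l (divr_ge0 G0 (ler0n R 2)) hj.
    have -> : 2 * k * ((u + (u ^+ 2 - sq_tail a u) / a) / 2 - u ^+ 2 / (8 * a)) - k ^+ 2 =
      k * u + 6 * k ^+ 2 * u ^+ 2 - 8 * k ^+ 2 * sq_tail a u - k ^+ 2.
      by rewrite /k; field; rewrite gt_eqF.
    move: (if _ then _ else _) (sq_tail a u) (W y) (D y) => I t w z hI.
    by lra.
  rewrite mul0r addr0.
  have : G * k ^+ 2 * tY a <= G * k ^+ 2 * (1 / 2).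
    by rewrite ler_wpM2l// mulr_ge0// sqr_ge0.
  by nra.
have cW n : - (k ^+ 2 / 4) * c n f <= c n W.
  have <- : c n (fun y => - (k ^+ 2 / 4) * f y + 0 * f y) = - (k ^+ 2 / 4) * c n f.
    by rewrite (cross_lin H)// mul0r addr0.
  apply: (cross_le H) => //; first exact: lin_growth_lin.
  by move=> y _; rewrite mul0r addr0; exact: Wlow.
have eW n : 0 <= e n W by apply: (alive_ge0 H).
have decr n : k ^+ 2 / 4 * e n g <= e n W - e n.+1 W.
  have := ler_wpM2l (ltW kap0) (cf n); have := cW n; have := step n; lra.
move=> m n mn.
have sumg : k ^+ 2 / 4 * \sum_(m <= j < n) e j g <= e m W.
  suff : k ^+ 2 / 4 * \sum_(m <= j < n) e j g <= e m W - e n W by have := eW n; lra.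
  elim: n mn => [|n ih]; first by rewrite leqn0 => /eqP ->; rewrite big_nil mulr0 subrr.
  rewrite leq_eqVlt => /predU1P[->|mn]; first by rewrite big_geq// mulr0 subrr.
  by rewrite big_nat_recr//= mulrDr; have := ih mn; have := decr n; lra.
have ov j : overshoot c j <= B * c j (fun=> 1) + e j g.
  apply: (@le_trans _ _ (B * c j (fun=> 1) + 1 * c j f)); last by rewrite mul1r lerD2l.
  rewrite -(cross_lin H)//; apply: (cross_le H) => //; first exact: lin_growth_lin.
  by move=> y _; rewrite /f mulr1 mul1r; have [|] := leP (- (y + B)) 0; lra.
apply: (@le_trans _ _ (\sum_(m <= j < n) (B * c j (fun=> 1) + e j g))).
  by apply: ler_sum => j _; exact: ov.
rewrite big_split/= -mulr_sumr.
have s1 := ler_wpM2l B0 (sum_cross1 H mn).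
have eWm : e m W <= eps' * e m id + C1 * e m (fun=> 1).
  rewrite -(alive_lin H)//; apply: (alive_le H) => //; first exact: lin_growth_lin.
  by move=> y y0; rewrite mulr1; exact: hC1.
have : \sum_(m <= j < n) e j g <= eps * e m id + C1 / (k ^+ 2 / 4) * e m (fun=> 1).
  rewrite -(ler_pM2l kap0); apply: (le_trans sumg); apply: (le_trans eWm).
  rewrite /eps' le_eqVlt; apply/orP; left; apply/eqP; field.
  by rewrite gt_eqF// /k.
by rewrite mulrDl; lra.
Qed.

End overshoot_bound.

Section survival_bound.
Context {R : realType} (tY xY : R -> R).
Hypothesis M : majorant_estimates tY xY.

(** The Taylor remainder splits into small jumps, where the factor [kap] is
    gained, and large ones, left to the tail of the second moment. *)
Lemma truncated_square (L kap u : R) : 0 < L -> 0 <= kap ->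
  (u / L) ^+ 2 * Num.min 1 `|u / L| <= (kap * u ^+ 2 + sq_tail (kap * L) u) / L ^+ 2.
Proof.
move=> L0 k0; have L2 : 0 < L ^+ 2 by rewrite exprn_gt0.
rewrite expr_div_n mulrAC ler_pM2r ?invr_gt0// /sq_tail; case: ifPn => h.
  apply: (@le_trans _ _ (u ^+ 2 * 1)); first by rewrite ler_wpM2l ?sqr_ge0// ge_min lexx.
  by rewrite mulr1 lerDr mulr_ge0 ?sqr_ge0.
rewrite addr0 mulrC ler_wpM2r ?sqr_ge0// ge_min; apply/orP; right.
by rewrite normrM normfV (gtr0_norm L0) ler_pdivrMr// leNgt.
Qed.

(** Occupation times: the concave bounded function [f] below, on the scale [L],
    loses at least [1 / L] in mean at each step made from [y < L] (up to a
    constant), while the martingale property bounds the time spent above [L]. *)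
Lemma survival_sum (x0 : R) : 0 < x0 -> exists2 C, 0 < C &
  forall x e c, exit_functionals tY xY x e c -> x0 <= x ->
  forall V, (forall n, e n id <= V) -> forall n : nat,
  \sum_(0 <= k < n) e k (fun=> 1) <= C * Num.sqrt n%:R * V.
Proof.
move=> x00; pose d := gauss_fun (2 : R).
have d0 : 0 < d by exact: expR_gt0.
(* [1 + y / L] is at most [2] for [y <= L], so [d] bounds the density from below
   there; [kap] keeps the Taylor remainder below half of the drift *)
pose kap := d / 16; have kap0 : 0 < kap by rewrite divr_gt0.
have [a a0 ha] := tail_small M kap0.
pose L0 := a / kap.
have L00 : 0 <= L0 by rewrite divr_ge0// ltW.
pose C := Num.max (4 / d) (Num.max L0 1 / x0).
have mL0 : 0 < Num.max L0 1 by rewrite lt_max ltr01 orbT.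
have C0 : 0 < C by rewrite /C lt_max divr_gt0.
exists C => // x e c H xx V hV n.
have l1 := @lin_growth_cst R 1; have li := @lin_growth_id R.
have xV : x <= V by have := hV 0%N; rewrite (alive_init H).
have V0 : 0 < V by apply: lt_le_trans xV; exact: lt_le_trans xx.
case: n => [|n]; first by rewrite big_nil !mulr_ge0 ?sqrtr_ge0 ?(ltW C0) ?(ltW V0).
set N := n.+1; pose L : R := Num.sqrt N%:R.
have L_gt0 : 0 < L by rewrite sqrtr_gt0 ltr0n.
have L2 : L ^+ 2 = N%:R by rewrite sqr_sqrtr// ler0n.
have [LL|LL] := ltP L (Num.max L0 1).
  apply: (@le_trans _ _ (\sum_(0 <= k < N) 1)).
    by apply: ler_sum => k _; exact: survival_le1 H k.
  have -> : \sum_(0 <= k < N) 1 = L * L by rewrite sumr_const_nat subn0 -expr2 L2.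
  rewrite -/L [leRHS]mulrAC ler_wpM2r ?(ltW L_gt0)//.
  apply: (le_trans (ltW LL)).
  apply: (@le_trans _ _ (Num.max L0 1 / x0 * V)).
    by rewrite mulrAC ler_pdivlMr// ler_wpM2l ?(ltW mL0)// (le_trans xx xV).
  by rewrite ler_wpM2r ?(ltW V0)// /C le_max lexx orbT.
have Lkap : a <= kap * L.
  have : L0 <= L by apply: le_trans LL; rewrite le_max lexx.
  by rewrite /L0 ler_pdivrMr// mulrC.
have htY := ha _ Lkap.
pose f y := L * (gauss_prim (1 + y / L) - gauss_prim 1).
have fle y : `|f y| <= `|y|.
  rewrite /f normrM (gtr0_norm L_gt0) mulrC -ler_pdivlMr//.
  apply: (le_trans (gauss_prim_lipschitz _ _)).
  by rewrite addrAC subrr add0r normrM normfV (gtr0_norm L_gt0).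
have lf : lin_growth f.
  split; last by exists 1 => y; rewrite mul1r (le_trans (fle y))// lerDr.
  apply: measurable_funM => //; apply: measurable_funB => //.
  apply: (measurableT_comp (f := @gauss_prim R)).
    exact: continuous_measurable_fun continuous_gauss_prim.
  by apply: measurable_funD => //; exact: measurable_funM.
have f0 y : 0 < y -> 0 <= f y.
  move=> y0; rewrite mulr_ge0 ?(ltW L_gt0)// subr_ge0 gauss_prim_nd// lerDl.
  by rewrite divr_ge0 ?(ltW y0) ?(ltW L_gt0).
pose w := 4 * (kap + tY (kap * L)).
have wd : w <= d / 2 by rewrite /w /kap in htY *; lra.
have step k : e k.+1 f + c k f <= e k f + (w / L - d / L) * e k (fun=> 1) + d / L ^+ 2 * e k id.
  pose g y := (w / L - d / L) * 1 + d / L ^+ 2 * y.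
  have lg : lin_growth g := lin_growth_lin _ _ l1 li.
  have -> : e k f + (w / L - d / L) * e k (fun=> 1) + d / L ^+ 2 * e k id =
      e k (fun y => 1 * f y + 1 * g y).
    by rewrite (alive_lin H)// !mul1r /g (alive_lin H)// addrA.
  apply: (alive_step H) => //; first exact: lin_growth_lin.
  move=> y y0; pose r := 1 + y / L.
  exists (f y), (gauss_fun r), ((- 2 * r * gauss_fun r) / (2 * L) + 4 * kap / L),
    (4 / L), (kap * L), 0, 0.
  split=> //.
  - by split; [exact: divr_ge0 (ltW L_gt0)|exact: mulr_ge0 (ltW kap0) (ltW L_gt0)].
  - move=> u; rewrite mul0r addr0.
    have := gauss_prim_taylor2 r (u / L).
    rewrite -[X in _ <= X]mulrA => hT; have ht := truncated_square u L_gt0 (ltW kap0).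
    have {hT}hT := le_trans (ler_norm _) (le_trans hT (ler_wpM2l (ler0n R 4) ht)).
    have -> : f (y + u) = L * (gauss_prim (r + u / L) - gauss_prim 1).
      by rewrite /f /r; congr (_ * (gauss_prim _ - _)); rewrite mulrDl addrA.
    rewrite /f -/r.
    have := ler_wpM2l (ltW L_gt0) hT.
    have -> : L * (gauss_prim (r + u / L) - gauss_prim r - gauss_fun r * (u / L) -
       -2 * r * gauss_fun r / 2 * (u / L) ^+ 2) =
       L * gauss_prim (r + u / L) - L * gauss_prim r - gauss_fun r * u
        - -2 * r * gauss_fun r / (2 * L) * u ^+ 2 by field; rewrite gt_eqF.
    have -> : L * (4 * ((kap * u ^+ 2 + sq_tail (kap * L) u) / L ^+ 2)) =
      4 * kap / L * u ^+ 2 + 4 / L * sq_tail (kap * L) u by field; rewrite gt_eqF.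
    by move: (_ / (2 * L)) (4 * kap / L) (4 / L) => q1 q2 q3; lra.
  rewrite mul0r addr0 /g mulr1 !mul1r -addrA -addrA lerD2l.
  rewrite -(ler_pM2r L_gt0).
  have -> : (- 2 * r * gauss_fun r / (2 * L) + (4 * kap / L + 4 / L * tY (kap * L))) * L =
     w - r * gauss_fun r by rewrite /w; field; rewrite gt_eqF.
  have -> : (w / L - d / L + d / L ^+ 2 * y) * L = w - d * (1 - y / L) by field; rewrite gt_eqF.
  rewrite lerD2l lerN2 /r.
  have rho0 : 0 < y / L by rewrite divr_gt0.
  move: (y / L) rho0 => rho rho0.
  have g0 : 0 <= gauss_fun (1 + rho) by exact: gauss_fun_ge0.
  have [r1|r1] := leP rho 1; last by nra.
  have : d <= gauss_fun (1 + rho).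
    rewrite /d /gauss_fun ler_expR lerN2 ler_pXn2r ?nnegrE//; lra.
  by nra.
have cf k : - overshoot c k <= c k f.
  rewrite /overshoot -(crossN H); last exact: lin_growth_opp.
  apply: (cross_le H) => //; first by apply: lin_growthN; exact: lin_growth_opp.
  move=> y y0; rewrite opprK; have := fle y; rewrite ler_norml => /andP[+ _].
  by rewrite ler0_norm// opprK.
have tele m : e m f - f x - \sum_(0 <= k < m) overshoot c k <=
    (w / L - d / L) * \sum_(0 <= k < m) e k (fun=> 1) + d / L ^+ 2 * (m%:R * V).
  elim: m => [|m ih].
    by rewrite !big_nil (alive_init H)// mul0r !mulr0; lra.
  rewrite !big_nat_recr//= -natr1.
  have h1 := step m; have h2 := cf m.
  have h3 : d / L ^+ 2 * e m id <= d / L ^+ 2 * V.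
    by rewrite ler_wpM2l// divr_ge0 ?sqr_ge0// ltW.
  move: (w / L - d / L) (d / L ^+ 2) h1 h3 ih => q1 q2 h1 h3 ih; lra.
have := tele N.
have e0 : 0 <= e N f by apply: (alive_ge0 H).
have fx : f x <= x.
  have x_gt0 : 0 < x by exact: lt_le_trans xx.
  by apply: (le_trans (ler_norm _)); rewrite (le_trans (fle x))// gtr0_norm.
have mN : x + \sum_(0 <= k < N) overshoot c k <= V by rewrite -(alive_id H).
have -> : d / L ^+ 2 * (N%:R * V) = d * V by rewrite -L2; field; rewrite gt_eqF.
have d1 : d <= 1 by exact: gauss_fun_le1.
have dV : d * V <= V by rewrite ler_piMl// ltW.
have S0 : 0 <= \sum_(0 <= k < N) e k (fun=> 1).
  by apply: sumr_ge0 => k _; exact: survival_ge0 H k.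
move: (\sum_(0 <= k < N) e k (fun=> 1)) S0 => S S0 hS.
have : (d / (2 * L)) * S <= 2 * V.
  have : d / (2 * L) * S <= - ((w / L - d / L) * S).
    rewrite -mulNr ler_wpM2r// -(ler_pM2r L_gt0).
    have -> : d / (2 * L) * L = d / 2 by field; rewrite gt_eqF.
    have -> : - (w / L - d / L) * L = d - w by field; rewrite gt_eqF.
    by lra.
  by lra.
rewrite -[leLHS]mulrC -ler_pdivlMr; last by rewrite divr_gt0// mulr_gt0.
move=> h; apply: (le_trans h).
have -> : 2 * V / (d / (2 * L)) = 4 / d * L * V by field; rewrite !gt_eqF.
rewrite ler_wpM2r ?(ltW V0)// ler_wpM2r ?(ltW L_gt0)//.
by rewrite /C le_max lexx.
Qed.

(** The survival probabilities decrease, so the last term of the sum is at most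
    the average. *)
Lemma survival_le (x0 : R) : 0 < x0 -> exists2 C, 0 < C &
  forall x e c, exit_functionals tY xY x e c -> x0 <= x ->
  forall V, (forall n, e n id <= V) -> forall n : nat, (0 < n)%N ->
  \sum_(0 <= k < n) e k (fun=> 1) <= C * Num.sqrt n%:R * V /\
  e n (fun=> 1) <= C * V / Num.sqrt n%:R.
Proof.
move=> /survival_sum[C C0 hC]; exists C => // x e c H xx V hV n n0.
have h := hC x e c H xx V hV n; split=> //.
have s0 : 0 < Num.sqrt n%:R :> R by rewrite sqrtr_gt0 ltr0n.
rewrite ler_pdivlMr// -(ler_pM2r s0) -mulrA -expr2 sqr_sqrtr ?ler0n//.
have -> : C * V * Num.sqrt n%:R = C * Num.sqrt n%:R * V by rewrite mulrAC.
apply: le_trans h; rewrite mulr_natr.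
have -> : e n (fun=> 1) *+ n = \sum_(0 <= k < n) e n (fun=> 1).
  by rewrite sumr_const_nat subn0.
rewrite big_nat [leRHS]big_nat; apply: ler_sum => k /andP[_ kn].
by apply: (survival_ni H); exact: ltnW.
Qed.

End survival_bound.

(** * Heat functions along the killed chain *)

Section heat_telescope.
Context {R : realType} (tY xY : R -> R).
Hypothesis M : majorant_estimates tY xY.

(** The time grid of the heat kernel when [j] steps of the chain are left; the
    last step stops at time [2 * eps], where the kernel is still smooth. *)
Definition grid (eps : R) (n j : nat) : R := 2 * eps + j%:R * (2 / n%:R).

Lemma grid_ge eps n j : 2 * eps <= grid eps n j.
Proof. by rewrite lerDl mulr_ge0// divr_ge0. Qed.

(** The error of one step against one time step is [o(1 / n)], uniformly as long
    as the kernel has width at least [sqrt eps]. *)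
Lemma heat_rate (eps eta : R) : 0 < eps -> 0 < eta ->
  exists kap, 0 <= kap /\ exists n0 : nat, forall n : nat, (n0 <= n)%N -> (0 < n)%N /\
  4 / (eps * n%:R) * (kap + tY (kap * Num.sqrt (2 * eps * n%:R))) + 14 / (eps * n%:R) ^+ 2
    <= eta / n%:R.
Proof.
move=> e0 h0; pose kap := eps * eta / 16.
have k0 : 0 < kap by rewrite divr_gt0// mulr_gt0.
have [a a0 ha] := tail_small M k0.
exists kap; split; first exact: ltW.
(* the first term brings the truncation level above [a], the second one takes
   care of the error in time *)
pose b := (a / kap) ^+ 2 / (2 * eps) + 28 / (eps ^+ 2 * eta) + 1.
have e2 : 0 < eps ^+ 2 * eta by rewrite mulr_gt0// exprn_gt0.
have b1 : 0 <= (a / kap) ^+ 2 / (2 * eps) by rewrite divr_ge0 ?sqr_ge0// mulr_ge0// ltW.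
have b2 : 0 <= 28 / (eps ^+ 2 * eta) by rewrite divr_ge0// ltW.
exists (Num.truncn b).+1 => n hn.
have nb : b <= n%:R.
  apply: (le_trans (ltW (truncnS_gt b))); by rewrite ler_nat.
have n0 : 0 < n%:R :> R by apply: lt_le_trans nb; rewrite /b; lra.
split; first by rewrite -(ltr0n R).
have h1 : tY (kap * Num.sqrt (2 * eps * n%:R)) <= kap.
  apply: ha; rewrite mulrC -ler_pdivrMr//.
  rewrite -(ger0_norm (divr_ge0 a0 (ltW k0))) -sqrtr_sqr ler_wsqrtr//.
  by rewrite [leRHS]mulrC -ler_pdivrMr ?mulr_gt0//; apply: le_trans nb; rewrite /b; lra.
have h2 : 14 / (eps * n%:R) ^+ 2 <= eta / 2 / n%:R.
  have -> : 14 / (eps * n%:R) ^+ 2 = 14 / (eps ^+ 2 * n%:R) / n%:R by field; rewrite !gt_eqF.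
  rewrite ler_pM2r ?invr_gt0// ler_pdivrMr ?mulr_gt0 ?exprn_gt0//.
  have -> : eta / 2 * (eps ^+ 2 * n%:R) = n%:R * (eps ^+ 2 * eta) / 2 by ring.
  have : 28 <= n%:R * (eps ^+ 2 * eta).
    by rewrite -ler_pdivrMr//; apply: le_trans nb; rewrite /b; lra.
  by lra.
have h3 : 4 / (eps * n%:R) * (kap + tY (kap * Num.sqrt (2 * eps * n%:R))) <= eta / 2 / n%:R.
  apply: (@le_trans _ _ (4 / (eps * n%:R) * (kap + kap))).
    by rewrite ler_wpM2l ?lerD2l// divr_ge0// mulr_ge0// ltW.
  by rewrite le_eqVlt; apply/orP; left; apply/eqP; rewrite /kap; field; rewrite !gt_eqF.
have -> : eta / n%:R = eta / 2 / n%:R + eta / 2 / n%:R by field; rewrite gt_eqF.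
exact: lerD.
Qed.

(** The one-step comparisons are added up along the time grid.  The bound is one
    sided, and the signs of [p] and [q] give the other side. *)
Lemma heat_telescope (eps eta : R) : 0 < eps -> 0 < eta ->
  exists n0 : nat, forall n : nat, (n0 <= n)%N -> (0 < n)%N /\
  forall x e c, exit_functionals tY xY x e c ->
  forall p a q b, `|p| <= 1 -> `|q| <= 1 -> forall i m, (i <= m <= n)%N ->
  e m (heat2 n%:R p a q b (grid eps n (n - m))) +
    \sum_(i <= k < m) c k (heat2 n%:R p a q b (grid eps n (n - k.+1))) <=
  e i (heat2 n%:R p a q b (grid eps n (n - i))) +
    eta / n%:R * \sum_(i <= k < m) e k (fun=> 1).
Proof.
move=> e0 h0; have [kap [k0 [n0 hn0]]] := heat_rate e0 h0.
exists n0 => n hn; have [npos rate] := hn0 n hn; split=> //.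
move=> x e c H p a q b p1 q1 i; elim=> [|m ih] /andP[im mn].
  by move: im; rewrite leqn0 => /eqP ->; rewrite !big_nil mulr0.
move: im; rewrite leq_eqVlt => /predU1P[->|im].
  by rewrite !big_geq// mulr0.
have := ih; rewrite -ltnS im ltnW// => /(_ isT) {}ih.
rewrite !big_nat_recr//=.
have nR : 0 < n%:R :> R by rewrite ltr0n.
have := heat_mean_step H m a b nR e0 k0 (grid_ge eps n (n - m.+1)) p1 q1.
have -> : grid eps n (n - m.+1) + 2 / n%:R = grid eps n (n - m).
  by rewrite /grid -[(n - m)%N](subnSK mn) -natr1; ring.
move=> step; have {}step := le_trans step (lerD (lexx _) (ler_wpM2r (survival_ge0 H m) rate)).
move: step ih; rewrite mulrDr.
move: (e m.+1 _) (c m _) (_ * e m _) (e m _) (\sum_(_ <= _ < _) c _ _) (e i _) (_ * \sum_(_ <= _ < _) _).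
by clear => *; lra.
Qed.

(** From time [n / 2] to time [n], a bump of width [eta] at the origin spreads
    into a function bounded by a multiple of [eta]; the survival probability up
    to time [n / 2] supplies the factor [V / sqrt n]. *)
Lemma small_ball (x0 : R) : 0 < x0 -> exists2 C, 0 < C &
  forall eta : R, 0 < eta -> exists n0 : nat, forall n : nat, (n0 <= n)%N ->
  forall x e c, exit_functionals tY xY x e c -> x0 <= x ->
  forall V, (forall n, e n id <= V) ->
  e n (fun y => if y <= eta * Num.sqrt n%:R then 1 else 0) <= C * eta * V / Num.sqrt n%:R.
Proof.
move=> x00; have [C C0 hC] := survival_le M x00.
pose d : R := expR (- 2); have d0 : 0 < d by exact: expR_gt0.
exists (6 * C / d); first by rewrite divr_gt0// mulr_gt0.
move=> eta h0; have e0 : 0 < eta ^+ 2 by rewrite exprn_gt0.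
have [n0 hn0] := heat_telescope e0 h0.
exists (n0 + 2)%N => n hn.
have [npos tele] := hn0 n (leq_trans (leq_addr _ _) hn).
move=> x e c H xx V hV.
have n2 : (2 <= n)%N by apply: leq_trans hn; rewrite leq_addl.
have nR : 0 < n%:R :> R by rewrite ltr0n.
have sn0 : 0 < Num.sqrt n%:R :> R by rewrite sqrtr_gt0.
pose m := n./2.
have m0 : (0 < m)%N by rewrite /m half_gt0.
have mn : (m <= n)%N by have := odd_double_half n; rewrite -/m -mul2n; clear; lia.
have m4 : (n <= 4 * m)%N.
  by have := odd_double_half n; rewrite -/m -mul2n; case: (odd n); move: m0; clear => /=; lia.
have n2m : (2 * m <= n)%N by have := odd_double_half n; rewrite -/m -mul2n; clear; lia.
have := tele x e c H 1 (- eta) (- 1) eta; rewrite normrN normr1 => /(_ (lexx _) (lexx _) m n).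
rewrite mn leqnn => /(_ isT).
set F := heat2 n%:R 1 (- eta) (- 1) eta.
have FE t y : F t y = gauss_prim ((y / Num.sqrt n%:R + eta) / Num.sqrt t) -
    gauss_prim ((y / Num.sqrt n%:R - eta) / Num.sqrt t).
  by rewrite /F /heat2 /heat mul1r mulN1r opprK.
have lF t : lin_growth (F t) by apply: lin_growth_lin; exact: lin_growth_heat.
have F0 t y : 0 <= F t y.
  rewrite FE subr_ge0 gauss_prim_nd// ler_wpM2r ?invr_ge0 ?sqrtr_ge0//.
  by rewrite lerD2l; lra.
have cF : 0 <= \sum_(m <= k < n) c k (F (grid (eta ^+ 2) n (n - k.+1))).
  by apply: sumr_ge0 => k _; apply: (cross_ge0 H).
have S1 : \sum_(m <= k < n) e k (fun=> 1) <= n%:R * e m (fun=> 1).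
  apply: (@le_trans _ _ (\sum_(m <= k < n) e m (fun=> 1))).
    rewrite big_nat [leRHS]big_nat; apply: ler_sum => k /andP[mk _].
    exact: (survival_ni H).
  rewrite sumr_const_nat -[leLHS]mulr_natl ler_wpM2r ?(survival_ge0 H)//.
  by rewrite ler_nat leq_subr.
have Fm : e m (F (grid (eta ^+ 2) n (n - m))) <= 2 * eta * e m (fun=> 1).
  have -> : 2 * eta * e m (fun=> 1) = e m (fun=> 2 * eta).
    have l1 := @lin_growth_cst R 1.
    have h2 (y : R) : 2 * eta = 2 * eta * 1 + 0 * 1 by rewrite mul0r addr0 mulr1.
    by rewrite (alive_comb H m l1 l1 h2) mul0r addr0.
  apply: (alive_le H) => //; first exact: lin_growth_cst.
  move=> y _; rewrite FE; apply: (le_trans (ler_norm _)).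
  apply: (le_trans (gauss_prim_lipschitz _ _)).
  rewrite -mulrBl (_ : _ - _ = 2 * eta); last by ring.
  rewrite normrM ger0_norm ?mulr_ge0 ?(ltW h0)//.
  have t1 : 1 <= grid (eta ^+ 2) n (n - m).
    have g1 : 1 <= (n - m)%:R * (2 / n%:R) :> R.
      by rewrite mulrA ler_pdivlMr// mul1r -natrM ler_nat; clear -n2m; lia.
    by rewrite /grid; lra.
  have s1 : 1 <= Num.sqrt (grid (eta ^+ 2) n (n - m)) by rewrite -sqrtr1 ler_wsqrtr.
  rewrite ler_piMr ?mulr_ge0 ?(ltW h0)// normfV invf_le1.
    by rewrite ger0_norm ?sqrtr_ge0.
  by rewrite normr_gt0 gt_eqF// (lt_le_trans ltr01).
have lI : lin_growth (fun y : R => if y <= eta * Num.sqrt n%:R then 1 else 0 : R).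
  split.
    by apply: measurable_fun_ifT => //; apply: measurable_fun_ler.
  exists 1 => y; rewrite mul1r; case: ifP => _; rewrite ?normr1 ?normr0.
    by rewrite lerDl.
  by rewrite addr_ge0.
have Fn : d * e n (fun y => if y <= eta * Num.sqrt n%:R then 1 else 0) <=
    e n (F (grid (eta ^+ 2) n (n - n))).
  rewrite -[leLHS]addr0 -[X in _ + X](mul0r (e n (F 1))) -(alive_lin H)//.
  apply: (alive_le H) => //; first exact: lin_growth_lin.
  move=> y y0; rewrite mul0r addr0 subnn /grid mul0r addr0.
  case: ifPn => [hy|_]; last by rewrite mulr0.
  rewrite mulr1 FE.
  have z0 : 0 < y / Num.sqrt n%:R by rewrite divr_gt0.
  have z1 : y / Num.sqrt n%:R <= eta by rewrite ler_pdivrMr.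
  move: (y / Num.sqrt n%:R) z0 z1 => z z0 z1.
  pose s : R := Num.sqrt 2.
  have s0 : 0 < s by rewrite sqrtr_gt0.
  have s2 : s ^+ 2 = 2 by rewrite sqr_sqrtr.
  have -> : Num.sqrt (2 * eta ^+ 2) = s * eta by rewrite sqrtrM// sqrtr_sqr gtr0_norm.
  have [t /andP[t0 t1]] := @mean_value R _ _ ((z - eta) / (s * eta)) s is_derive_gauss_prim.
  have -> : (z - eta) / (s * eta) + s = (z + eta) / (s * eta).
    transitivity ((z - eta + s ^+ 2 * eta) / (s * eta)); last by rewrite s2; congr (_ / _); ring.
    by field; rewrite !gt_eqF.
  move=> ->.
  set r := _ + t * s.
  have r2 : r ^+ 2 <= 2.
    have rs : r = (z - eta) / (s * eta) + t * s by [].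
    have h1 : - s <= (z - eta) / (s * eta).
      rewrite ler_pdivlMr ?mulr_gt0// mulNr mulrA -expr2 s2; lra.
    have h2 : (z - eta) / (s * eta) <= 0.
      by rewrite ler_pdivrMr ?mulr_gt0// mul0r; lra.
    rewrite -s2 -[r ^+ 2]real_normK ?num_real// ler_pXn2r ?nnegrE ?(ltW s0)//.
    have ts0 := mulr_ge0 t0 (ltW s0).
    have ts1 : t * s <= s by rewrite ler_piMl// ltW.
    rewrite ler_norml rs; move: (_ / _) (t * s) h1 h2 ts0 ts1; clear => *.
    by apply/andP; split; lra.
  have : d <= gauss_fun r by rewrite /d /gauss_fun ler_expR lerN2.
  have : 1 <= s by rewrite -[leLHS]sqrtr1 ler_wsqrtr// ler1n.
  by move=> h1 h2; rewrite -[leLHS]mulr1 ler_pM// ltW.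
move=> tl.
have pm := (hC x e c H xx V hV m m0).2.
have V0 : 0 < V.
  have := hV 0%N; rewrite (alive_init H); last exact: lin_growth_id.
  by apply: lt_le_trans; exact: lt_le_trans xx.
have sm : Num.sqrt n%:R <= 2 * Num.sqrt m%:R :> R.
  have -> : 2 = Num.sqrt (2 ^+ 2) :> R by rewrite sqrtr_sqr ger0_norm.
  by rewrite -sqrtrM ?sqr_ge0// ler_wsqrtr// -natrX -natrM ler_nat.
have sm0 : 0 < Num.sqrt m%:R :> R by rewrite sqrtr_gt0 ltr0n.
have pm' : e m (fun=> 1) <= 2 * C * V / Num.sqrt n%:R.
  apply: (le_trans pm).
  have -> : 2 * C * V / Num.sqrt n%:R = C * V * (2 / Num.sqrt n%:R) by ring.
  rewrite ler_wpM2l ?mulr_ge0 ?(ltW C0) ?(ltW V0)//.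
  by rewrite ler_pdivlMr// mulrC ler_pdivrMr.
have : d * e n (fun y => if y <= eta * Num.sqrt n%:R then 1 else 0) <=
    3 * eta * (2 * C * V / Num.sqrt n%:R).
  have h1 : eta / n%:R * \sum_(m <= k < n) e k (fun=> 1) <= eta * e m (fun=> 1).
    apply: (@le_trans _ _ (eta / n%:R * (n%:R * e m (fun=> 1)))).
      by rewrite ler_wpM2l ?divr_ge0 ?(ltW h0) ?(ltW nR).
    by rewrite mulrA divfK// gt_eqF.
  have h2 := ler_wpM2l (ltW h0) pm'.
  apply: (le_trans Fn); apply: le_trans (le_trans (lerD Fm h1) _).
    by apply: le_trans tl; rewrite lerDl.
  have -> : 2 * eta * e m (fun=> 1) + eta * e m (fun=> 1) = 3 * (eta * e m (fun=> 1)).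
    by ring.
  by rewrite -[leRHS]mulrA ler_wpM2l.
rewrite -ler_pdivlMl// => /le_trans; apply.
by rewrite le_eqVlt; apply/orP; left; apply/eqP; field; rewrite !gt_eqF.
Qed.

End heat_telescope.

Section slope.
Context {R : realType}.

(** Half the slope at [z = 0] of [G (s * (z - v)) + G (s * (z + v))], with [G]
    the Gaussian primitive. *)
Definition slope (s v : R) : R := s * gauss_fun (s * v).

Lemma slope_lipschitz (s s' v : R) : `|slope s v - slope s' v| <= 3 * `|s - s'|.
Proof.
have d (r : R) : is_derive r 1 (slope ^~ v)
    ((1 - 2 * (r * v) ^+ 2) * gauss_fun (r * v)).
  have := @is_derive_gauss_fun R => d; rewrite /slope; apply: trigger_derive.
  by rewrite /= /GRing.scale /=; ring.
have [t _] := @mean_value R _ _ s' (s - s') d.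
rewrite [s' + _]addrC subrK => ->; rewrite normrM ler_wpM2r//.
move: ((s' + t * (s - s')) * v) => r.
have h1 := gauss_poly_le r; have g0 := gauss_fun_ge0 r.
move: (gauss_fun r) h1 g0 => g h1 g0.
have s2 := sqr_ge0 r; have h2 := mulr_ge0 (sqr_ge0 (r ^+ 2)) g0.
have h3 := mulr_ge0 s2 g0.
by rewrite ler_norml; apply/andP; split; lra.
Qed.

Lemma slope_continuous_shift (s v v' : R) : 0 <= s ->
  `|slope s v - slope s v'| <= s ^+ 2 * `|v - v'|.
Proof.
move=> s0; rewrite /slope -mulrBr normrM ger0_norm// expr2 -mulrA ler_wpM2l//.
have [t _] := @mean_value R _ _ (s * v') (s * v - s * v') (@is_derive_gauss_fun R).
rewrite [s * v' + _]addrC subrK => ->; rewrite -mulrBr normrM.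
rewrite (normrM s) (ger0_norm s0) ler_piMl ?mulr_ge0//.
exact: norm_gauss1_le1.
Qed.

Lemma inv_sqrt_lipschitz (w t t' : R) : 0 < w -> w <= t -> t <= t' ->
  `|(Num.sqrt t)^-1 - (Num.sqrt t')^-1| <= (t' - t) / (2 * (Num.sqrt w) ^+ 3).
Proof.
move=> w0 wt tt'.
have t0 : 0 < t by exact: lt_le_trans wt.
have t'0 : 0 < t' by exact: lt_le_trans tt'.
have sw : 0 < Num.sqrt w by rewrite sqrtr_gt0.
have swt : Num.sqrt w <= Num.sqrt t by rewrite ler_wsqrtr.
have stt : Num.sqrt t <= Num.sqrt t' by rewrite ler_wsqrtr.
have st : Num.sqrt t ^+ 2 = t by rewrite sqr_sqrtr ?ltW.
have st' : Num.sqrt t' ^+ 2 = t' by rewrite sqr_sqrtr ?ltW.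
move: (Num.sqrt w) (Num.sqrt t) (Num.sqrt t') st st' swt stt sw => a b c <- <- ab bc a0.
have b0 : 0 < b by exact: lt_le_trans ab.
have c0 : 0 < c by exact: lt_le_trans bc.
rewrite ger0_norm ?subr_ge0 ?lef_pV2 ?posrE//.
have -> : b^-1 - c^-1 = (c ^+ 2 - b ^+ 2) / (b * c * (b + c)).
  by field; rewrite !gt_eqF// addr_gt0.
have cb : 0 <= c ^+ 2 - b ^+ 2.
  by rewrite subr_sqr mulr_ge0 ?subr_ge0// addr_ge0 ?(ltW b0) ?(ltW c0).
rewrite ler_wpM2l//.
have bc0 : 0 < b * c * (b + c) by rewrite !mulr_gt0// addr_gt0.
rewrite lef_pV2 ?posrE ?mulr_gt0 ?exprn_gt0 ?addr_gt0//.
have ac := le_trans ab bc.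
have h1 : a * a <= b * c by rewrite ler_pM// ltW.
have h2 : a * a * (a + a) <= b * c * (b + c).
  by rewrite ler_pM ?mulr_ge0 ?addr_ge0 ?(ltW a0)// lerD.
by apply: le_trans h2; rewrite le_eqVlt; apply/orP; left; apply/eqP; ring.
Qed.

(** The sum is odd in [z], since the Gaussian primitive is.  Near the origin it is
    close to a linear function, with a slope that is a Lipschitz function of time:
    the first bound is precise for small [z] and for times close to the initial
    one, and the second, without any smallness, serves all other crossings. *)
Lemma odd_heat_linear (eps v : R) : 0 < eps -> exists2 K, 0 < K &
  forall t z, 2 * eps <= t -> t <= 2 * eps + 2 ->
  let k := 2 * slope (Num.sqrt (2 * eps + 2))^-1 v in
  `|gauss_prim ((z - v) / Num.sqrt t) + gauss_prim ((z + v) / Num.sqrt t) - k * z|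
    <= K * (`|z| * Num.min 1 `|z| + `|z| * (2 * eps + 2 - t)) /\
  `|gauss_prim ((z - v) / Num.sqrt t) + gauss_prim ((z + v) / Num.sqrt t) - k * z|
    <= K * `|z|.
Proof.
move=> e0; pose w := 2 * eps; have w0 : 0 < w by rewrite mulr_gt0.
have sw : 0 < Num.sqrt w by rewrite sqrtr_gt0.
pose s0 := (Num.sqrt (2 * eps + 2))^-1.
pose K1 := 2 / Num.sqrt w + 2 * `|slope s0 v|.
pose K2 := 2 / w.
pose K3 := 6 / (2 * Num.sqrt w ^+ 3).
have K10 : 0 < K1 by apply: ltr_pwDl; [exact: divr_gt0|exact: mulr_ge0].
have K20 : 0 < K2 by rewrite divr_gt0.
have K30 : 0 < K3 by rewrite divr_gt0// mulr_gt0// exprn_gt0.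
exists (K1 + K2 + K3); first by lra.
move=> t z wt t2 k.
have t0 : 0 < t by exact: lt_le_trans wt.
have st : 0 < Num.sqrt t by rewrite sqrtr_gt0.
have swt : Num.sqrt w <= Num.sqrt t by rewrite ler_wsqrtr.
pose s := (Num.sqrt t)^-1.
have s_ge0 : 0 < s by rewrite invr_gt0.
have sle : s <= (Num.sqrt w)^-1 by rewrite lef_pV2 ?posrE.
have s2 : s ^+ 2 = t^-1 by rewrite exprVn sqr_sqrtr ?ltW.
have -> : gauss_prim ((z - v) / Num.sqrt t) = - gauss_prim (s * v + - (s * z)).
  by rewrite -gauss_primN /s; congr gauss_prim; ring.
have -> : gauss_prim ((z + v) / Num.sqrt t) = gauss_prim (s * v + s * z).
  by rewrite /s; congr gauss_prim; ring.
set E := _ - k * z.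
have nz := normr_ge0 z.
have h2 : `|E| <= K1 * `|z|.
  have l1 := gauss_prim_lipschitz (s * v + s * z) (s * v + - (s * z)).
  rewrite (_ : s * v + s * z - (s * v + - (s * z)) = 2 * s * z) in l1; last by ring.
  have kz : `|k * z| = 2 * `|slope s0 v| * `|z|.
    by rewrite normrM /k normrM (ger0_norm (ler0n R 2)).
  rewrite (normrM _ z) (gtr0_norm (mulr_gt0 (ltr0n R 2) s_ge0)) in l1.
  rewrite /E [X in X - k * z]addrC; apply: (le_trans (ler_normB _ _)).
  have -> : K1 * `|z| = 2 / Num.sqrt w * `|z| + 2 * `|slope s0 v| * `|z|.
    by rewrite /K1 [LHS]mulrDl.
  rewrite kz; apply: lerD => //; apply: (le_trans l1).
  by rewrite ler_wpM2r// ler_wpM2l.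
have h1 : `|E| <= K2 * (`|z| * `|z|) + K3 * (`|z| * (2 * eps + 2 - t)).
  have T1 := gauss_prim_taylor1 (s * v) (s * z).
  have T2 := gauss_prim_taylor1 (s * v) (- (s * z)).
  have Sl := slope_lipschitz s s0 v.
  have SI := inv_sqrt_lipschitz w0 wt t2; rewrite -/s -/s0 in SI.
  have -> : E = (gauss_prim (s * v + s * z) - gauss_prim (s * v) - gauss_fun (s * v) * (s * z))
    - (gauss_prim (s * v - s * z) - gauss_prim (s * v) - gauss_fun (s * v) * (- (s * z)))
    + 2 * (slope s v - slope s0 v) * z.
    by rewrite /E /k /slope -/s0; ring.
  apply: (le_trans (ler_normD _ _)); apply: lerD.
    apply: (le_trans (ler_normB _ _)); apply: (le_trans (lerD T1 T2)).
    rewrite sqrrN exprMn s2 -[z ^+ 2]real_normK ?num_real// expr2.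
    have h : t^-1 <= w^-1 by rewrite lef_pV2 ?posrE.
    have := ler_wpM2r (mulr_ge0 nz nz) h; rewrite /K2; lra.
  rewrite !normrM (ger0_norm (ler0n R 2)) [`|z| * _]mulrC mulrA ler_wpM2r//.
  have h := le_trans Sl (ler_wpM2l (ler0n R 3) SI).
  apply: (le_trans (ler_wpM2l (ler0n R 2) h)).
  by rewrite le_eqVlt; apply/orP; left; apply/eqP; rewrite /K3; field; rewrite gt_eqF.
have T0 : 0 <= `|z| * (2 * eps + 2 - t) by rewrite mulr_ge0// subr_ge0.
split; last by apply: (le_trans h2); rewrite ler_wpM2r//; lra.
have [z1|z1] := leP 1 `|z|.
  apply: (le_trans h2); rewrite mulr1.
  have := mulr_ge0 (ltW K20) nz; have := mulr_ge0 (ltW K30) nz.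
  have := mulr_ge0 (ltW K10) T0; have := mulr_ge0 (ltW K20) T0; have := mulr_ge0 (ltW K30) T0.
  lra.
apply: (le_trans h1).
have zz := mulr_ge0 nz nz.
have := mulr_ge0 (ltW K10) zz; have := mulr_ge0 (ltW K30) zz.
have := mulr_ge0 (ltW K10) T0; have := mulr_ge0 (ltW K20) T0.
lra.
Qed.

End slope.

Section smoothed_limit.
Context {R : realType} (tY xY : R -> R).
Hypothesis M : majorant_estimates tY xY.

(** Overshoots at a fixed time are of order one, so seen on the scale
    [sqrt n] they are negligible: their square has mean at most [1 / n]. *)
Definition small_overshoot (n y : R) : R :=
  `|y / Num.sqrt n| * Num.min 1 `|y / Num.sqrt n|.

Lemma lin_growth_small_overshoot (n : R) : lin_growth (small_overshoot n).
Proof.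
split.
  apply: measurable_funM.
    by apply: measurableT_comp => //; exact: measurable_funM.
  apply: measurable_minr => //.
  by apply: measurableT_comp => //; exact: measurable_funM.
exists `|(Num.sqrt n)^-1| => y; rewrite /small_overshoot normrM normr_id.
have m1 : `|Num.min 1 `|y / Num.sqrt n| | <= 1.
  by rewrite ger0_norm ?le_min ?ler01 ?normr_ge0// ge_min lexx.
apply: (@le_trans _ _ (`|y / Num.sqrt n| * 1)); first by rewrite ler_wpM2l.
by rewrite mulr1 normrM mulrC ler_wpM2l// lerDr.
Qed.

Lemma cross_small_overshoot x e c k (n : R) : exit_functionals tY xY x e c -> 0 < n ->
  c k (small_overshoot n) <= n^-1.
Proof.
move=> H n0; pose f y : R := if y <= 0 then small_overshoot n y else 0.
have ls := lin_growth_small_overshoot n.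
have sn : 0 < Num.sqrt n by rewrite sqrtr_gt0.
have lf : lin_growth f.
  case: ls => ms [K hK]; split.
    by apply: measurable_fun_ifT => //; exact: measurable_fun_ler.
  exists K => y; rewrite /f; case: ifP => // _; rewrite normr0.
  exact: le_trans (normr_ge0 _) (hK y).
have s0 y : 0 <= small_overshoot n y.
  by rewrite mulr_ge0// le_min ler01 normr_ge0.
have f0 y : 0 <= f y by rewrite /f; case: ifP.
have cE : c k (small_overshoot n) <= c k f.
  by apply: (cross_le H) => // y y0; rewrite /f y0.
have e1 : 0 <= e k.+1 f by apply: (alive_ge0 H).
have l1 := @lin_growth_cst R 1.
have E : e k (fun=> n^-1) = n^-1 * e k (fun=> 1).
  have h (y : R) : n^-1 = n^-1 * 1 + 0 * 1 by rewrite mulr1 mul0r addr0.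
  by rewrite (alive_comb H k l1 l1 h) mul0r addr0.
have := alive_step H k lf (lin_growth_cst n^-1).
rewrite E => h; have {h}h : e k.+1 f + c k f <= n^-1 * e k (fun=> 1).
  apply: h => y y0; exists 0, 0, n^-1, 0, 0, 0, 0; split=> //; last by rewrite !mul0r !addr0 add0r.
  move=> u; rewrite !mul0r !addr0 !add0r /f; case: ifPn => yu; last first.
    by rewrite mulr_ge0 ?sqr_ge0// invr_ge0 ltW.
  rewrite /small_overshoot; apply: (@le_trans _ _ (`|(y + u) / Num.sqrt n| * `|(y + u) / Num.sqrt n|)).
    by rewrite ler_wpM2l// ge_min lexx orbT.
  rewrite -expr2 real_normK ?num_real// expr_div_n sqr_sqrtr ?(ltW n0)// mulrC.
  rewrite ler_wpM2l ?invr_ge0 ?(ltW n0)//.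
  rewrite -[leLHS]real_normK ?num_real// -[leRHS]real_normK ?num_real//.
  rewrite ler_pXn2r ?nnegrE// ler0_norm// ler0_norm; lra.
have := ler_wpM2l (_ : 0 <= n^-1) (survival_le1 H k).
by rewrite invr_ge0 (ltW n0) mulr1 => /(_ isT); lra.
Qed.

(** The odd test function evolves along the killed chain like a martingale, up to
    a rate small on the scale [1 / n]; summed over the lifetime of the chain, whose
    mean up to [n] is of order [V * sqrt n], the error is small against [V / sqrt n].
    The starting point and all the crossing points that matter lie where the
    function is almost linear, with slope [k].  They contribute
    [k / sqrt n * x] and [k / sqrt n] times the mean overshoot, and these add up
    to [k * V / sqrt n] by optional stopping.  The hypotheses on [V] say that it is
    the supremum of the means of the stopped chain. *)
Lemma smoothed_limit (x0 eps v d : R) : 0 < x0 -> 0 < eps -> 0 < d ->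
  exists2 r, 0 < r & exists n0 : nat, forall n : nat, (n0 <= n)%N -> (0 < n)%N /\
  forall x e c, exit_functionals tY xY x e c -> x0 <= x -> x <= r * Num.sqrt n%:R ->
  forall V, (forall k, e k id <= V) -> (forall b, (forall k, e k id <= b) -> V <= b) ->
  `|e n (heat2 n%:R 1 v 1 (- v) (2 * eps))
     - 2 * slope (Num.sqrt (2 * eps + 2))^-1 v * (V / Num.sqrt n%:R)|
    <= d * (V / Num.sqrt n%:R).
Proof.
move=> x00 e0 d0.
have [C C0 hC] := survival_le M x00.
have [K K0 hK] := odd_heat_linear v e0.
pose k := 2 * slope (Num.sqrt (2 * eps + 2))^-1 v.
pose Kk := K + `|k|; have Kk0 : 0 < Kk by rewrite ltr_pwDl.
pose d1 := d / 16; have d10 : 0 < d1 by rewrite divr_gt0.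
pose eps1 := d1 / Kk; have eps10 : 0 < eps1 by rewrite divr_gt0.
have [C1 C10 hC1] := overshoot_tail M eps10.
have eta0 : 0 < d1 / C by rewrite divr_gt0.
have [n1 hn1] := heat_telescope M e0 eta0.
(* after [m0] steps the remaining overshoot is a small part of [V] *)
pose m0 := (Num.truncn ((C1 * C / eps1) ^+ 2)).+1.
have m0_gt0 : 0 < m0%:R :> R by rewrite ltr0n.
have sm0 : 0 < Num.sqrt m0%:R :> R by rewrite sqrtr_gt0.
have m0P : C1 * (C / Num.sqrt m0%:R) <= eps1.
  rewrite mulrA ler_pdivrMr// [leRHS]mulrC -ler_pdivrMr//.
  have h0 : 0 <= C1 * C / eps1 by exact: divr_ge0 (mulr_ge0 C10 (ltW C0)) (ltW eps10).
  rewrite -(ger0_norm h0) -sqrtr_sqr ler_wsqrtr//; exact: ltW (truncnS_gt _).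
(* beyond [q] the [m0] early crossings contribute little, both through
   [small_overshoot] and through the change of the slope with time *)
pose q := (K * m0%:R / (x0 * d1)) ^+ 2 + 2 * K * m0%:R / d1.
exists (d1 / K); first by rewrite divr_gt0.
exists (n1 + m0 + (Num.truncn q).+1)%N => n hn.
have [npos tele] : (0 < n)%N /\ _ := hn1 n (leq_trans (leq_trans (leq_addr _ _) (leq_addr _ _)) hn).
have m0n : (m0 <= n)%N by apply: leq_trans hn; rewrite -addnA addnCA leq_addr.
split=> //; move=> x e c H xx xr V hV lub.
have nR : 0 < n%:R :> R by rewrite ltr0n.
have sn : 0 < Num.sqrt n%:R :> R by rewrite sqrtr_gt0.
have sn2 : Num.sqrt n%:R ^+ 2 = n%:R :> R by rewrite sqr_sqrtr// ltW.
have qn : q <= n%:R.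
  apply: (le_trans (ltW (truncnS_gt q))); rewrite ler_nat.
  by apply: leq_trans hn; rewrite leq_addl.
have q1 : K * m0%:R / (x0 * d1) <= Num.sqrt n%:R.
  have h0 : 0 <= K * m0%:R / (x0 * d1).
    exact: divr_ge0 (mulr_ge0 (ltW K0) (ltW m0_gt0)) (mulr_ge0 (ltW x00) (ltW d10)).
  rewrite -(ger0_norm h0) -sqrtr_sqr ler_wsqrtr//; apply: le_trans qn.
  rewrite /q lerDl; apply: divr_ge0 (ltW d10).
  exact: mulr_ge0 (mulr_ge0 (ler0n R 2) (ltW K0)) (ltW m0_gt0).
have q2 : 2 * K * m0%:R / d1 <= n%:R.
  by apply: le_trans qn; rewrite /q lerDr sqr_ge0.
have xV : x <= V by have := hV 0%N; rewrite (alive_init H)//; exact: lin_growth_id.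
have V0 : 0 < V by apply: lt_le_trans xV; exact: lt_le_trans xx.
have x_gt0 : 0 < x by exact: lt_le_trans xx.
have [hS hp] := hC x e c H xx V hV n npos.
pose F j := heat2 n%:R 1 v 1 (- v) (grid eps n j).
have lF j : lin_growth (F j) by apply: lin_growth_lin; exact: lin_growth_heat.
have FN j : heat2 n%:R (- 1) v (- 1) (- v) (grid eps n j) = (fun y => - F j y).
  by apply/funext => y; rewrite /F /heat2; ring.
have lo := @lin_growth_opp R.
have li := @lin_growth_id R.
have lso := lin_growth_small_overshoot n%:R.
have lab : lin_growth (fun y : R => `|y|).
  by split=> //; exists 1 => y; rewrite normr_id mul1r lerDr.
(* the martingale is conserved up to [d1 * V / sqrt n] *)
set Vn := V / Num.sqrt n%:R.
have Vn0 : 0 < Vn by rewrite divr_gt0.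
have rate : d1 / C / n%:R * \sum_(0 <= j < n) e j (fun=> 1) <= d1 * Vn.
  apply: (@le_trans _ _ (d1 / C / n%:R * (C * Num.sqrt n%:R * V))).
    by rewrite ler_wpM2l// (divr_ge0 (ltW eta0) (ltW nR)).
  rewrite le_eqVlt; apply/orP; left; apply/eqP; rewrite /Vn.
  by move: (Num.sqrt n%:R) sn sn2 => s s0 <-; field; rewrite !gt_eqF.
have S1 : e n (F 0%N) + \sum_(0 <= j < n) c j (F (n - j.+1)%N) - F n x <= d1 * Vn.
  have := tele x e c H 1 v 1 (- v); rewrite normr1 => /(_ (lexx _) (lexx _) 0%N n).
  rewrite leq0n leqnn subnn subn0 => /(_ isT).
  rewrite -/(F 0%N) -/(F n) (alive_init H)//.
  under eq_bigr do rewrite -/(F _).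
  by move=> h; rewrite lerBlDl; apply: (le_trans h); rewrite lerD2l.
have S2 : - (e n (F 0%N) + \sum_(0 <= j < n) c j (F (n - j.+1)%N) - F n x) <= d1 * Vn.
  have := tele x e c H (- 1) v (- 1) (- v); rewrite normrN normr1.
  move=> /(_ (lexx _) (lexx _) 0%N n); rewrite leq0n leqnn subnn subn0 => /(_ isT).
  rewrite !FN (aliveN H)// (aliveN H)// (alive_init H)//.
  under eq_bigr do rewrite FN (crossN H)//.
  rewrite sumrN -opprD lerNl opprD opprK lerBlDr => h.
  by rewrite opprB lerBlDr; apply: (le_trans h); rewrite addrC lerD2r.
(* the starting point is close to the boundary *)
have FE j y : F j y = gauss_prim ((y / Num.sqrt n%:R - v) / Num.sqrt (grid eps n j)) +
    gauss_prim ((y / Num.sqrt n%:R + v) / Num.sqrt (grid eps n j)).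
  by rewrite /F /heat2 /heat !mul1r opprK.
have gn : grid eps n n = 2 * eps + 2 by rewrite /grid mulrCA divff ?gt_eqF// mulr1.
have gle : grid eps n n <= 2 * eps + 2 by rewrite gn.
have FxE : `|F n x - k * (x / Num.sqrt n%:R)| <= d1 * Vn.
  have [h _] := hK (grid eps n n) (x / Num.sqrt n%:R) (grid_ge _ _ _) gle.
  have z0 : 0 < x / Num.sqrt n%:R by rewrite divr_gt0.
  have z1 : x / Num.sqrt n%:R <= d1 / K by rewrite ler_pdivrMr.
  have z2 : x / Num.sqrt n%:R <= Vn by rewrite ler_pM2r ?invr_gt0.
  rewrite FE; apply: (le_trans h); rewrite gn subrr mulr0 addr0 (gtr0_norm z0).
  move: (x / Num.sqrt n%:R) z0 z1 z2 => z z0 z1 z2.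
  apply: (@le_trans _ _ (K * (z * z))).
    by rewrite ler_wpM2l ?(ltW K0)// ler_wpM2l ?(ltW z0)// ge_min lexx orbT.
  apply: (@le_trans _ _ (K * (d1 / K * Vn))).
    by rewrite ler_wpM2l ?(ltW K0)// ler_pM// ?(ltW z0).
  by rewrite le_eqVlt; apply/orP; left; apply/eqP; field; rewrite gt_eqF.
(* the value of the kernel at the crossing times *)
have cN f g j : lin_growth f -> lin_growth g -> (forall y, y <= 0 -> `|f y| <= g y) ->
    `|c j f| <= c j g.
  move=> lf lg fg; rewrite ler_norml -(crossN H)//; apply/andP; split.
    apply: (cross_le H) => //; first exact: lin_growthN.
    by move=> y y0; have := fg y y0; rewrite ler_norml => /andP[].
  by apply: (cross_le H) => // y y0; exact: le_trans (ler_norm _) (fg y y0).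
have cabs j : c j (fun y : R => `|y|) <= overshoot c j.
  by apply: (cross_le H) => // y y0; rewrite ler0_norm.
pose D j y := 1 * F j y + - (k / Num.sqrt n%:R) * y.
have lD j : lin_growth (D j) by exact: lin_growth_lin.
have cD i j : c i (D j) = c i (F j) + k / Num.sqrt n%:R * overshoot c i.
  by rewrite /D (cross_lin H)// mul1r mulNr /overshoot (crossN H)// mulrN.
have DE j y : D j y = F j y - k * (y / Num.sqrt n%:R).
  by rewrite /D mul1r mulNr mulrAC mulrA.
have zabs (y : R) : `|y / Num.sqrt n%:R| = (Num.sqrt n%:R)^-1 * `|y|.
  by rewrite normrM normfV (gtr0_norm sn) mulrC.
have gj i : (i < n)%N -> grid eps n (n - i.+1) <= 2 * eps + 2 /\
    2 * eps + 2 - grid eps n (n - i.+1) = i.+1%:R * (2 / n%:R).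
  move=> hi; have h : 2 * eps + 2 - grid eps n (n - i.+1) = i.+1%:R * (2 / n%:R).
    rewrite -gn /grid natrB//; ring.
  by split=> //; rewrite -subr_ge0 h mulr_ge0// divr_ge0.
have late i : (i < n)%N -> `|c i (D (n - i.+1)%N)| <= K / Num.sqrt n%:R * overshoot c i.
  move=> hi; have [g1 g2] := gj i hi.
  apply: (@le_trans _ _ (c i (fun y : R => K / Num.sqrt n%:R * `|y| + 0 * `|y|))).
    apply: cN => //; first exact: lin_growth_lin.
    move=> y y0; rewrite mul0r addr0 DE FE -mulrA -zabs.
    by have [_] := hK _ (y / Num.sqrt n%:R) (grid_ge _ _ _) g1.
  rewrite (cross_lin H)// mul0r addr0 ler_wpM2l// divr_ge0 ?(ltW K0) ?(ltW sn)//.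
have early i : (i < m0)%N -> `|c i (D (n - i.+1)%N)| <=
    K * n%:R^-1 + K * (m0%:R * (2 / n%:R)) / Num.sqrt n%:R * overshoot c i.
  move=> hi; have [g1 g2] := gj i (leq_trans hi m0n).
  apply: (@le_trans _ _ (c i (fun y : R => K * small_overshoot n%:R y +
      K * (m0%:R * (2 / n%:R)) / Num.sqrt n%:R * `|y|))).
    apply: cN => //; first exact: lin_growth_lin.
    move=> y y0; rewrite DE FE -[X in _ <= _ + X]mulrA -zabs -[X in _ <= _ + X]mulrA -mulrDr.
    have [h _] := hK _ (y / Num.sqrt n%:R) (grid_ge _ _ _) g1.
    apply: (le_trans h); rewrite ler_wpM2l ?(ltW K0)// lerD2l g2 mulrC.
    by rewrite ler_wpM2r// ler_wpM2r ?divr_ge0// ler_nat.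
  rewrite (cross_lin H)//; apply: lerD.
    by rewrite ler_wpM2l ?(ltW K0)//; exact: cross_small_overshoot H nR.
  by rewrite ler_wpM2l// divr_ge0 ?(ltW sn)// !mulr_ge0 ?divr_ge0 ?(ltW K0).
have oV j : \sum_(0 <= i < j) overshoot c i <= V.
  by have := hV j; rewrite (alive_id H); apply: le_trans; rewrite lerDr ltW.
have tail j : (m0 <= j)%N -> \sum_(m0 <= i < j) overshoot c i <= 2 * eps1 * V.
  move=> mj; apply: (le_trans (hC1 x e c H m0 j mj)).
  have h1 := ler_wpM2l (ltW eps10) (hV m0).
  have [_ h2] := hC x e c H xx V hV m0 isT.
  have h3 := ler_wpM2l C10 h2.
  have h4 : C1 * (C * V / Num.sqrt m0%:R) <= eps1 * V.
    by rewrite [C * V / _]mulrAC mulrA ler_wpM2r// ltW.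
  have -> : 2 * eps1 * V = eps1 * V + eps1 * V by ring.
  exact: lerD h1 (le_trans h3 h4).
have Vm : V - e n id <= 2 * eps1 * V.
  rewrite lerBlDr; apply: lub => j; have [jn|nj] := leqP j n.
    have : e j id <= e n id.
      rewrite !(alive_id H) lerD2l (big_cat_nat (leq0n j) jn)//= lerDl.
      by apply: sumr_ge0 => i _; exact: (overshoot_ge0 H).
    move/le_trans; apply; rewrite lerDr.
    exact: mulr_ge0 (mulr_ge0 (ler0n R 2) (ltW eps10)) (ltW V0).
  rewrite !(alive_id H) (big_cat_nat (leq0n n) (ltnW nj))//=.
  have : \sum_(n <= i < j) overshoot c i <= \sum_(m0 <= i < j) overshoot c i.
    rewrite [leRHS](big_cat_nat m0n (ltnW nj))//= lerDr.
    by apply: sumr_ge0 => i _; exact: (overshoot_ge0 H).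
  move=> h; rewrite addrA [leRHS]addrC lerD2l.
  exact: le_trans h (tail j (leq_trans m0n (ltnW nj))).
have SD : `|\sum_(0 <= i < n) c i (D (n - i.+1)%N)| <=
    (K * m0%:R / n%:R + K * (m0%:R * (2 / n%:R)) / Num.sqrt n%:R * V)
    + K / Num.sqrt n%:R * (2 * eps1 * V).
  rewrite (big_cat_nat (leq0n m0) m0n)//=; apply: (le_trans (ler_normD _ _)); apply: lerD.
    apply: (le_trans (ler_norm_sum _ _ _)).
    apply: (@le_trans _ _ (\sum_(0 <= i < m0) (K * n%:R^-1 +
        K * (m0%:R * (2 / n%:R)) / Num.sqrt n%:R * overshoot c i))).
      by rewrite big_nat [leRHS]big_nat; apply: ler_sum => i /andP[_ im]; exact: early.
    rewrite big_split/=; apply: lerD.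
      by rewrite sumr_const_nat subn0 -[leLHS]mulr_natr mulrAC.
    by rewrite -mulr_sumr ler_wpM2l// divr_ge0 ?(ltW sn)// !mulr_ge0 ?divr_ge0 ?(ltW K0).
  apply: (le_trans (ler_norm_sum _ _ _)).
  apply: (@le_trans _ _ (\sum_(m0 <= i < n) (K / Num.sqrt n%:R * overshoot c i))).
    by rewrite big_nat [leRHS]big_nat; apply: ler_sum => i /andP[_ im]; exact: late.
  by rewrite -mulr_sumr ler_wpM2l ?tail// divr_ge0 ?(ltW K0) ?(ltW sn).
have SDE : \sum_(0 <= i < n) c i (D (n - i.+1)%N) =
    \sum_(0 <= i < n) c i (F (n - i.+1)%N) + k / Num.sqrt n%:R * (e n id - x).
  under eq_bigr do rewrite cD.
  by rewrite big_split/= -mulr_sumr (alive_id H) addrAC subrr add0r.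
have b1 : K * m0%:R / n%:R <= d1 * Vn.
  have h : K * m0%:R / Num.sqrt n%:R <= d1 * V.
    move: q1; rewrite ler_pdivrMr ?mulr_gt0// ler_pdivrMr// => /le_trans; apply.
    rewrite [leLHS]mulrC ler_wpM2r ?(ltW sn)// mulrC ler_wpM2l ?(ltW d10)//.
    exact: le_trans xx xV.
  have -> : K * m0%:R / n%:R = K * m0%:R / Num.sqrt n%:R * (Num.sqrt n%:R)^-1.
    by move: (Num.sqrt n%:R) sn sn2 => s s0 <-; field; rewrite !gt_eqF.
  by rewrite /Vn mulrA ler_wpM2r// invr_ge0 ltW.
have b2 : K * (m0%:R * (2 / n%:R)) / Num.sqrt n%:R * V <= d1 * Vn.
  have -> : K * (m0%:R * (2 / n%:R)) / Num.sqrt n%:R * V = (2 * K * m0%:R / n%:R) * Vn.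
    by rewrite /Vn; field; rewrite !gt_eqF.
  by rewrite ler_wpM2r ?(ltW Vn0)// ler_pdivrMr// [leRHS]mulrC -ler_pdivrMr.
have b3 : K / Num.sqrt n%:R * (2 * eps1 * V) <= 2 * d1 * Vn.
  have -> : K / Num.sqrt n%:R * (2 * eps1 * V) = 2 * (K / Kk) * d1 * Vn.
    by rewrite /Vn /eps1; field; rewrite !gt_eqF.
  rewrite ler_wpM2r ?(ltW Vn0)// ler_wpM2r ?(ltW d10)//.
  by rewrite ler_piMr// ler_pdivrMr// mul1r /Kk lerDl.
have b4 : `|k / Num.sqrt n%:R * (V - e n id)| <= 2 * d1 * Vn.
  rewrite normrM (normf_div k) (gtr0_norm sn) [`|V - _|]ger0_norm ?subr_ge0//.
  apply: (@le_trans _ _ (`|k| / Num.sqrt n%:R * (2 * eps1 * V))).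
    by rewrite ler_wpM2l// divr_ge0 ?(ltW sn).
  have -> : `|k| / Num.sqrt n%:R * (2 * eps1 * V) = 2 * (`|k| / Kk) * d1 * Vn.
    by rewrite /Vn /eps1; field; rewrite !gt_eqF.
  rewrite ler_wpM2r ?(ltW Vn0)// ler_wpM2r ?(ltW d10)//.
  by rewrite ler_piMr// ler_pdivrMr// mul1r /Kk lerDr ltW.
have F0E : heat2 n%:R 1 v 1 (- v) (2 * eps) = F 0%N.
  by rewrite /F /grid mul0r addr0.
rewrite F0E -/k.
move: S1 S2 FxE SD b4; rewrite SDE !ler_norml -/Vn.
have -> : k * (x / Num.sqrt n%:R) = k / Num.sqrt n%:R * x by rewrite mulrA mulrAC.
have -> : k * Vn = k / Num.sqrt n%:R * V by rewrite /Vn mulrA mulrAC.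
move: (\sum_(0 <= i < n) c i (F (n - i.+1)%N)) => S.
move=> S1 S2 /andP[x1 x2] /andP[y1 y2] /andP[z1 z2].
have dV : 0 < d1 * Vn by rewrite mulr_gt0.
have -> : d * Vn = 16 * (d1 * Vn) by rewrite /d1; field.
by clear -dV b1 b2 b3 S1 S2 x1 x2 y1 y2 z1 z2; apply/andP; split; lra.
Qed.

End smoothed_limit.

(** * The limit law *)

Definition above (R : realType) (a y : R) : R := if a < y then 1 else 0.

Section limit_beyond.
Context {R : realType} (tY xY : R -> R).
Hypothesis M : majorant_estimates tY xY.

Lemma lin_growth_above (a : R) : lin_growth (above a).
Proof.
split; first by apply: measurable_fun_ifT => //; exact: measurable_fun_ltr.
exists 1 => y; rewrite mul1r /above; case: ifP => _; rewrite ?normr1 ?normr0.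
  by rewrite lerDl.
by rewrite addr_ge0.
Qed.

(** For small [eta] the kernel starts at a time close to [2], where the slope is a
    multiple of the Gaussian density of variance [1]. *)
Lemma slope_limit (v v' eta : R) : 0 < eta -> eta <= 1 -> `|v' - v| <= eta ->
  `|2 * slope (Num.sqrt (2 * eta ^+ 4 + 2))^-1 v' - Num.sqrt 2 * expR (- (v ^+ 2 / 2))|
    <= 8 * eta.
Proof.
move=> h0 h1 vv; pose s : R := Num.sqrt 2.
have s0 : 0 < s by rewrite sqrtr_gt0.
have s2 : s ^+ 2 = 2 by rewrite sqr_sqrtr.
have -> : Num.sqrt 2 * expR (- (v ^+ 2 / 2)) = 2 * slope s^-1 v.
  rewrite /slope /gauss_fun exprMn exprVn s2 -/s [2^-1 * _]mulrC mulrA; congr (_ * _).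
  by rewrite -s2 expr2 mulfK// gt_eqF.
have e4 : 0 < eta ^+ 4 by rewrite exprn_gt0.
have e41 : eta ^+ 4 <= eta by rewrite -[leRHS]expr1 ler_wiXn2l// ltW.
have two : (2 : R) <= 2 * eta ^+ 4 + 2 by lra.
have := inv_sqrt_lipschitz (ltr0n R 2) (lexx 2) two; rewrite -/s => hs.
have {}hs : `|(Num.sqrt (2 * eta ^+ 4 + 2))^-1 - s^-1| <= eta.
  rewrite distrC; apply: (le_trans hs); rewrite addrK.
  rewrite ler_pdivrMr ?mulr_gt0 ?exprn_gt0//.
  have s1 : 1 <= s by rewrite -[leLHS]sqrtr1 ler_wsqrtr// ler1n.
  have : 1 <= s ^+ 3 by rewrite exprn_ege1.
  by nra.
set s' := (Num.sqrt (2 * eta ^+ 4 + 2))^-1 in hs *.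
have l1 := slope_lipschitz s' s^-1 v'.
have l2 := slope_continuous_shift v' v (_ : 0 <= s^-1).
have {}l2 : `|slope s^-1 v' - slope s^-1 v| <= eta.
  apply: (le_trans (l2 _)); first by rewrite invr_ge0 ltW.
  by rewrite exprVn s2; have := normr_ge0 (v' - v); lra.
rewrite -mulrBr normrM ger0_norm// -[slope s' v'](subrK (slope s^-1 v')) -addrA.
have := ler_normD (slope s' v' - slope s^-1 v') (slope s^-1 v' - slope s^-1 v).
lra.
Qed.

(** Moving the step of the odd test function from [v] to [v - eta] puts it above
    the indicator of [v < z].  When [v < eta] the step has to stay at [0], and the
    window [z <= eta] pays for the mass between [v] and [eta]. *)
Lemma smoothed_above_ge (v eta w rho z : R) : 0 < eta -> 0 < w -> 0 < rho -> 0 < z ->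
  Num.sqrt pi / 2 - gauss_prim (eta / w) <= rho ->
  Num.sqrt pi * (if v < z then 1 else 0) <=
  Num.sqrt pi * (if z <= eta then 1 else 0)
    + (gauss_prim ((z - Num.max (v - eta) 0) / w)
       + gauss_prim ((z + Num.max (v - eta) 0) / w) + 2 * rho).
Proof.
move=> eta0 w0 rho0 z0 hrho; set v1 := Num.max (v - eta) 0.
have v10 : 0 <= v1 by rewrite /v1 le_max lexx orbT.
have P0 : 0 <= Num.sqrt pi :> R by exact: sqrtr_ge0.
have Gmono (a b : R) : a <= b -> gauss_prim (a / w) <= gauss_prim (b / w).
  by move=> ab; apply: gauss_prim_nd; rewrite ler_pM2r ?invr_gt0.
have h_ge0 : 0 <= gauss_prim ((z - v1) / w) + gauss_prim ((z + v1) / w).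
  have -> : gauss_prim ((z - v1) / w) = - gauss_prim ((v1 - z) / w).
    by rewrite -gauss_primN -mulNr opprB.
  by rewrite addrC subr_ge0; apply: Gmono; lra.
have [vz|vz] := ltP v z; last first.
  by rewrite mulr0; case: ifP => _; rewrite ?mulr0 ?mulr1; lra.
have [ze|ze] := leP z eta; first by rewrite mulr1; lra.
have h1 : eta <= z - v1 by rewrite /v1; have [h|h] := leP (v - eta) 0; lra.
have h2 : eta <= z + v1 by lra.
by have := Gmono _ _ h1; have := Gmono _ _ h2; rewrite mulr1 mulr0; lra.
Qed.

Lemma smoothed_above_le (v eta w rho z : R) : 0 < w -> 0 < rho ->
  Num.sqrt pi / 2 - gauss_prim (eta / w) <= rho ->
  gauss_prim ((z - (v + eta)) / w) + gauss_prim ((z + (v + eta)) / w) - 2 * rho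
    <= Num.sqrt pi * (if v < z then 1 else 0).
Proof.
move=> w0 rho0 hrho; set v2 := v + eta.
have g1 := gauss_prim_le ((z - v2) / w); have g2 := gauss_prim_le ((z + v2) / w).
have [vz|vz] := ltP v z; first by rewrite mulr1; lra.
have : gauss_prim ((z - v2) / w) <= - gauss_prim (eta / w).
  rewrite -gauss_primN -mulNr gauss_prim_nd// ler_pM2r ?invr_gt0// /v2.
  by lra.
by rewrite mulr0; lra.
Qed.

(** The law of [X(n) / sqrt n] on [tau > n], read off from the smoothed test
    functions: at the final time the heat kernel has width of order [eta ^+ 2],
    negligible against the error [eta] made on the level [v]. *)
Lemma limit_beyond (x0 v d : R) : 0 < x0 -> 0 <= v -> 0 < d ->
  exists2 r, 0 < r & exists n0 : nat, forall n : nat, (n0 <= n)%N -> (0 < n)%N /\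
  forall x e c, exit_functionals tY xY x e c -> x0 <= x -> x <= r * Num.sqrt n%:R ->
  forall V, (forall k, e k id <= V) -> (forall b, (forall k, e k id <= b) -> V <= b) ->
  `|e n (above (v * Num.sqrt n%:R))
     - Num.sqrt (2 / pi) * expR (- (v ^+ 2 / 2)) * (V / Num.sqrt n%:R)|
    <= d * (V / Num.sqrt n%:R).
Proof.
move=> x00 v0 d0; pose P : R := Num.sqrt pi.
have P0 : 0 < P by rewrite sqrtr_gt0 pi_gt0.
pose d1 := d * P / 8; have d10 : 0 < d1 by rewrite divr_gt0// mulr_gt0.
have [C C0 hC] := survival_le M x00.
have [Cb Cb0 hCb] := small_ball M x00.
have r0 : 0 < d1 / (2 * C) by rewrite divr_gt0// mulr_gt0.
have [B [B0 hB]] : exists B : R, 0 <= B /\ forall y, B <= y -> P / 2 - gauss_prim y <= d1 / (2 * C).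
  have /cvgrPdist_le/(_ _ r0)[B [_ hB]] := @cvg_gauss_prim R.
  exists (Num.max (B + 1) 0); split; first by rewrite le_max lexx orbT.
  move=> y By; apply: (le_trans (ler_norm _)); apply: hB.
  by apply: lt_le_trans By; rewrite lt_max ltrDl ltr01.
(* the four bounds make [eta] at most [1], the error on the slope small, the small
   ball negligible, and [eta] a large multiple of the final width of the kernel *)
pose eta := Num.min (Num.min 1 (d1 / 8)) (Num.min (d1 / (P * Cb)) (1 / (2 * (B + 1)))).
have B10 : 0 < 2 * (B + 1) by rewrite mulr_gt0// ltr_wpDl.
have eta0 : 0 < eta by rewrite /eta !lt_min ltr01 !divr_gt0// mulr_gt0.
have eta1 : eta <= 1 by rewrite /eta !ge_min lexx.
have eta2 : 8 * eta <= d1.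
  by rewrite mulrC -ler_pdivlMr// /eta !ge_min lexx orbT.
have eta3 : P * Cb * eta <= d1.
  by rewrite mulrC -ler_pdivlMr ?mulr_gt0// /eta !ge_min lexx !orbT.
have eta4 : eta * (2 * (B + 1)) <= 1 by rewrite -ler_pdivlMr// /eta !ge_min lexx !orbT.
pose eps := eta ^+ 4; have eps0 : 0 < eps by rewrite exprn_gt0.
pose v1 := Num.max (v - eta) 0; pose v2 := v + eta.
have v1v : `|v1 - v| <= eta.
  by rewrite /v1; have [h|h] := leP (v - eta) 0; rewrite ler_norml; apply/andP; split; lra.
have v2v : `|v2 - v| <= eta by rewrite /v2 addrAC subrr add0r gtr0_norm.
have [ra ra0 [na hna]] := smoothed_limit M v1 x00 eps0 d10.
have [rb rb0 [nb hnb]] := smoothed_limit M v2 x00 eps0 d10.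
have [nc hnc] := hCb eta eta0.
exists (Num.min ra rb); first by rewrite lt_min ra0.
exists (na + nb + nc)%N => n hn.
have [npos A1] : (0 < n)%N /\ _ := hna n (leq_trans (leq_trans (leq_addr _ _) (leq_addr _ _)) hn).
have [_ A2] : (0 < n)%N /\ _ := hnb n (leq_trans (leq_trans (leq_addl _ _) (leq_addr _ _)) hn).
have A3 := hnc n (leq_trans (leq_addl _ _) hn).
split=> // x e c H xx xr V hV lub.
have nR : 0 < n%:R :> R by rewrite ltr0n.
have sn : 0 < Num.sqrt n%:R :> R by rewrite sqrtr_gt0.
have {}A1 := A1 x e c H xx _ V hV lub.
have {}A2 := A2 x e c H xx _ V hV lub.
have {}A3 := A3 x e c H xx V hV.
have [_ pn] := hC x e c H xx V hV n npos.
have xa : x <= ra * Num.sqrt n%:R.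
  by apply: (le_trans xr); rewrite ler_wpM2r ?(ltW sn)// ge_min lexx.
have xb : x <= rb * Num.sqrt n%:R.
  by apply: (le_trans xr); rewrite ler_wpM2r ?(ltW sn)// ge_min lexx orbT.
move: (A1 xa) (A2 xb) => {}A1 {}A2.
have V0 : 0 < V.
  have := hV 0%N; rewrite (alive_init H); last exact: lin_growth_id.
  by apply: lt_le_trans; exact: lt_le_trans xx.
set Vn := V / Num.sqrt n%:R in A1 A2 *.
have Vn0 : 0 < Vn by rewrite divr_gt0.
rewrite -[C * V / _]mulrA -/Vn in pn.
rewrite -[Cb * eta * V / _]mulrA -/Vn in A3.
have L1 := slope_limit eta0 eta1 v1v.
have L2 := slope_limit eta0 eta1 v2v.
rewrite -/eps in L1 L2.
set w : R := Num.sqrt (2 * eps).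
have wE : w = Num.sqrt 2 * eta ^+ 2.
  by rewrite /w sqrtrM// /eps (_ : eta ^+ 4 = (eta ^+ 2) ^+ 2) ?sqrtr_sqr ?ger0_norm ?sqr_ge0// -exprM.
have s1 : 1 <= Num.sqrt 2 :> R by rewrite -[leLHS]sqrtr1 ler_wsqrtr// ler1n.
have s2 : Num.sqrt 2 <= 2 :> R.
  by rewrite -[leRHS](ger0_norm (ler0n R 2)) -sqrtr_sqr ler_wsqrtr// expr2; clear -M; lra.
have w0 : 0 < w by rewrite wE mulr_gt0 ?exprn_gt0// (lt_le_trans ltr01).
have Bw : B <= eta / w.
  rewrite ler_pdivlMr// wE.
  have h : B * Num.sqrt 2 * eta <= 1.
    have := ler_wpM2l B0 s2; have := mulr_ge0 B0 (ltW eta0) => h1 h2.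
    have := ler_wpM2r (ltW eta0) h2; clear -M eta4 h1 eta0; lra.
  have := ler_wpM2r (ltW eta0) h; rewrite mul1r expr2; clear -M; lra.
have hrho := hB _ Bw.
set rho := d1 / (2 * C) in hrho.
have lab := @lin_growth_above.
have lh a : lin_growth (heat2 n%:R 1 a 1 (- a) (2 * eps)).
  by apply: lin_growth_lin; exact: lin_growth_heat.
have hE a y : heat2 n%:R 1 a 1 (- a) (2 * eps) y =
    gauss_prim ((y / Num.sqrt n%:R - a) / w) + gauss_prim ((y / Num.sqrt n%:R + a) / w).
  by rewrite /heat2 /heat !mul1r opprK.
have l1 := @lin_growth_cst R 1.
have le_n (y : R) : (y <= eta * Num.sqrt n%:R) = (y / Num.sqrt n%:R <= eta).
  by rewrite ler_pdivrMr.
have lt_n (y : R) : (v * Num.sqrt n%:R < y) = (v < y / Num.sqrt n%:R).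
  by rewrite ltr_pdivlMr.
have lI : lin_growth (fun y : R => if y <= eta * Num.sqrt n%:R then 1 else 0 : R).
  have := lin_growth_lin 1 (-1) l1 (lab (eta * Num.sqrt n%:R)).
  congr lin_growth; apply/funext => y; rewrite /above leNgt; case: ifP => _ /=; ring.
have rho0 : 0 < rho by [].
have up : P * e n (above (v * Num.sqrt n%:R)) <=
    P * e n (fun y => if y <= eta * Num.sqrt n%:R then 1 else 0)
    + (e n (heat2 n%:R 1 v1 1 (- v1) (2 * eps)) + 2 * rho * e n (fun=> 1)).
  have -> : P * e n (above (v * Num.sqrt n%:R)) =
     e n (fun y => P * above (v * Num.sqrt n%:R) y + 0 * above (v * Num.sqrt n%:R) y).
    by rewrite (alive_lin H) ?mul0r ?addr0.
  have l3 := lin_growth_lin 1 (2 * rho) (lh v1) l1.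
  have -> : e n (heat2 n%:R 1 v1 1 (- v1) (2 * eps)) + 2 * rho * e n (fun=> 1) =
     e n (fun y => 1 * heat2 n%:R 1 v1 1 (- v1) (2 * eps) y + 2 * rho * 1).
    by rewrite (alive_lin H)// mul1r.
  rewrite -[X in _ + X]mul1r -(alive_lin H)//.
  apply: (alive_le H) => //; [exact: lin_growth_lin|exact: lin_growth_lin|].
  move=> y y0; rewrite mul0r addr0 mul1r mul1r mulr1 hE /above le_n lt_n.
  by apply: smoothed_above_ge => //; rewrite divr_gt0.
have low : e n (heat2 n%:R 1 v2 1 (- v2) (2 * eps)) - 2 * rho * e n (fun=> 1) <=
    P * e n (above (v * Num.sqrt n%:R)).
  have -> : P * e n (above (v * Num.sqrt n%:R)) =
     e n (fun y => P * above (v * Num.sqrt n%:R) y + 0 * above (v * Num.sqrt n%:R) y).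
    by rewrite (alive_lin H) ?mul0r ?addr0.
  have -> : e n (heat2 n%:R 1 v2 1 (- v2) (2 * eps)) - 2 * rho * e n (fun=> 1) =
     e n (fun y => 1 * heat2 n%:R 1 v2 1 (- v2) (2 * eps) y + - (2 * rho) * 1).
    by rewrite [RHS](alive_lin H)// mul1r mulNr.
  apply: (alive_le H) => //; [exact: lin_growth_lin|exact: lin_growth_lin|].
  move=> y y0; rewrite mul0r addr0 mul1r mulr1 hE /above lt_n.
  exact: smoothed_above_le.
have rpn : 2 * rho * e n (fun=> 1) <= d1 * Vn.
  apply: (@le_trans _ _ (2 * rho * (C * Vn))).
    by rewrite ler_wpM2l// mulr_ge0// ltW.
  by rewrite le_eqVlt; apply/orP; left; apply/eqP; rewrite /rho; field; rewrite gt_eqF.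
have sbn : P * e n (fun y => if y <= eta * Num.sqrt n%:R then 1 else 0) <= d1 * Vn.
  apply: (@le_trans _ _ (P * (Cb * eta * Vn))); first by rewrite ler_wpM2l// ltW.
  have -> : P * (Cb * eta * Vn) = P * Cb * eta * Vn by ring.
  by rewrite ler_pM2r.
have e8 := ler_wpM2r (ltW Vn0) eta2.
have lim (a : R) : `|a - Num.sqrt 2 * expR (- (v ^+ 2 / 2))| <= 8 * eta ->
    `|a * Vn - Num.sqrt 2 * expR (- (v ^+ 2 / 2)) * Vn| <= d1 * Vn.
  move=> h; rewrite -mulrBl normrM (gtr0_norm Vn0) ler_wpM2r ?(ltW Vn0)//.
  exact: le_trans h eta2.
move: (lim _ L1) (lim _ L2) A1 A2; rewrite !ler_norml.
move=> /andP[p1 p2] /andP[p3 p4] /andP[p5 p6] /andP[p7 p8].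
have PE : P * (Num.sqrt (2 / pi) * expR (- (v ^+ 2 / 2)) * Vn) =
    Num.sqrt 2 * expR (- (v ^+ 2 / 2)) * Vn.
  have p0 : pi != 0 :> R by rewrite gt_eqF// pi_gt0.
  have -> : Num.sqrt 2 = P * Num.sqrt (2 / pi).
    by rewrite /P -sqrtrM ?pi_ge0// mulrCA divff// mulr1.
  by ring.
have dE : P * (d * Vn) = 8 * (d1 * Vn) by rewrite /d1; field.
have dV : 0 < d1 * Vn by rewrite mulr_gt0.
apply/andP; split; rewrite -(ler_pM2l P0) ?mulrN mulrBr PE dE;
  clear -M sbn rpn low up dV p1 p2 p3 p4 p5 p6 p7 p8; lra.
Qed.

End limit_beyond.

Section chain_to_functionals.
Context (R : realType) (d : measure_display) (Omega : measurableType d)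
  (Pr : R -> probability Omega R) (X : nat -> {mfun Omega >-> R}).

Lemma survivalE x n :
  fine (Pr x [set w | (n%:R%:E < tau X w)%E]) = alive_mean Pr X x n (fun=> 1).
Proof.
rewrite gt_tau /alive_mean Rintegral_cst ?mul1r//; exact: measurable_alive.
Qed.

Lemma survival_beyondE x n (v : R) : (0 < n)%N ->
  fine (Pr x ([set w | v < X n w / Num.sqrt n%:R] `&` [set w | (n%:R%:E < tau X w)%E])) =
  alive_mean Pr X x n (above (v * Num.sqrt n%:R)).
Proof.
move=> n0; have sn : 0 < Num.sqrt n%:R :> R by rewrite sqrtr_gt0 ltr0n.
have mA := measurable_alive X n.
pose B := X n @^-1` `]v * Num.sqrt n%:R, +oo[.
have mB : measurable B by rewrite -[B]setTI; exact: measurable_funP.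
rewrite gt_tau /alive_mean /Rintegral.
have -> : (\int[Pr x]_(w in alive X n) (above (v * Num.sqrt n%:R) (X n w))%:E =
    \int[Pr x]_(w in alive X n) (\1_B w)%:E)%E.
  apply: eq_integral => w _; rewrite /above indicE; case: ifPn => h.
    by rewrite mem_set// /B /= in_itv/= h.
  by rewrite memNset// /B /= in_itv/= andbT; apply/negP.
rewrite integral_indic//; congr (fine (Pr x (_ `&` _))).
by apply/seteqP; split=> w; rewrite /B /= in_itv/= andbT ltr_pdivlMr.
Qed.

End chain_to_functionals.

Lemma majorant_estimates_of (R : realType) (d2 : measure_display)
    (Omega2 : measurableType d2) (P2 : probability Omega2 R) (Y : {RV P2 >-> R}) :
  (forall w : Omega2, 0 < Y w) -> (\int[P2]_w (Y w ^+ 2)%:E < +oo)%E ->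
  majorant_estimates (tail_majorant Y) (excess_majorant Y).
Proof.
move=> Y0 Y2; split.
- exact: tail_majorant_small.
- by move=> s; apply: Rintegral_ge0 => w _; rewrite /excess le_max lexx orbT.
- by move=> a b; exact: excess_majorant_ni.
- exact: lyapunov_function.
Qed.

Lemma lub_of_cvg (R : realType) (u : nat -> R) (l : R) :
  {homo u : m n / (m <= n)%N >-> m <= n} -> u n @[n --> \oo] --> l ->
  (forall k, u k <= l) /\ (forall b, (forall k, u k <= b) -> l <= b).
Proof.
move=> ndu ul; have cu : cvgn u by apply/cvg_ex; exists l.
rewrite -(cvg_lim _ ul)//; split; first exact: nondecreasing_cvgn_le.
by move=> b ub; apply: limr_le => //; exact: nearW.
Qed.

Theorem theorem8p7 (R : realType)
  (* the chain *)
  (d : measure_display) (Omega : measurableType d)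
  (Pr : R -> probability Omega R) (X : nat -> {mfun Omega >-> R})
  (hX : time_homogeneous_markov_chain Pr X)
  (* the jumps *)
  (d1 : R -> measure_display) (Omega1 : forall x : R, measurableType (d1 x))
  (P1 : forall x : R, probability (Omega1 x) R)
  (xi : forall x : R, {RV (P1 x) >-> R})
  (hxi : forall (x : R) (B : set R), measurable B ->
     P1 x [set w | B (xi x w)] = Pr x [set w | B (X 1%N w - x)])
  (hxi1 : forall x : R, ('E_(P1 x)[xi x] = 0)%E)
  (hxi2 : forall x : R, ('E_(P1 x)[(fun w => (xi x w ^+ 2)%R)] = 1)%E)
  (* the stochastic majorant *)
  (d2 : measure_display) (Omega2 : measurableType d2)
  (P2 : probability Omega2 R) (Y : {RV P2 >-> R})
  (hY0 : forall w : Omega2, 0 < Y w)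
  (hY2 : ('E_P2[(fun w => (Y w ^+ 2)%R)] < +oo)%E)
  (hY : forall x y : R, 0 <= y ->
     (P1 x [set w | (y < `|xi x w|)%R] <= P2 [set w | (y < Y w)%R])%E)
  (delta : nat -> R) (hdelta : nonincreasing_seq delta)
  (hdelta0 : delta n @[n --> \oo] --> (0 : R))
  (x0 : R) (hx0 : 0 < x0) :
  (* (i) *)
  uniform_equiv_in
    (fun n => `[x0, delta n * Num.sqrt n%:R]%classic)
    (fun n x => fine (Pr x [set w | (n%:R%:E < tau X w)%E]))
    (fun n x => Num.sqrt (2 / pi) * (fine (V Pr X x) / Num.sqrt n%:R))
  /\
  (* (ii) *)
  (forall v : R, 0 <= v ->
     uniform_cvg_in
       (fun n => `[x0, delta n * Num.sqrt n%:R]%classic)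
       (fun n x => cond_prob (Pr x)
          [set w | v < X n w / Num.sqrt n%:R]
          [set w | (n%:R%:E < tau X w)%E])
       (expR (- (v ^+ 2 / 2)))).
Proof.
have [hX0 [K hXK]] := hX.
have Y2 : (\int[P2]_w (Y w ^+ 2)%:E < +oo)%E by have := hY2; rewrite unlock.
have M := majorant_estimates_of hY0 Y2.
have H x (x_gt0 : 0 < x) :=
  chain_exit_functionals hX0 hXK hxi hxi1 hxi2 hY0 hY2 hY x_gt0.
pose e := alive_mean Pr X; pose c := cross_mean Pr X.
have lubV x : 0 < x -> (forall k, e x k id <= fine (V Pr X x)) /\
    (forall b, (forall k, e x k id <= b) -> fine (V Pr X x) <= b).
  move=> x_gt0; have Hx := H x x_gt0.
  (* bounded total overshoot makes [V] finite and the limit of the stopped means *)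
  have [C C0 hC] := overshoot_tail M (ltr01 : 0 < 1 :> R).
  have li := @lin_growth_id R.
  have bnd n : \sum_(0 <= k < n) c x k (fun y => - y) <= x + C.
    have := hC x _ _ Hx 0%N n (leq0n n).
    by rewrite mul1r (survival0 Hx) mulr1 (alive_init Hx).
  have cvV := cvg_V (fun n => integrable_chain_lin_growth hX0 hXK hxi hxi1 hxi2 hY0 hY2 hY x n.+1 (measurable_crossing X n) li) bnd.
  have eE : (fun n => e x n id) = (fun n => x + \sum_(0 <= k < n) overshoot (c x) k).
    by apply/funext => n; exact: alive_id Hx n.
  apply: (@lub_of_cvg _ (fun n => e x n id)); last by rewrite eE; exact: cvV.
  apply/nondecreasing_seqP => n; rewrite /e !(alive_id Hx) big_nat_recr//= lerD2l.
  by rewrite lerDl; exact: (overshoot_ge0 Hx).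
(* both claims follow from the mass beyond [v * sqrt n], the survival
   probability being the case [v = 0] *)
pose c0 : R := Num.sqrt (2 / pi).
have c00 : 0 < c0 by rewrite sqrtr_gt0 divr_gt0// pi_gt0.
have beyond v q : 0 <= v -> 0 < q -> \forall n \near \oo, (0 < n)%N /\
    forall x, `[x0, delta n * Num.sqrt n%:R]%classic x ->
    0 < fine (V Pr X x) / Num.sqrt n%:R /\
    `|e x n (above (v * Num.sqrt n%:R)) - c0 * expR (- (v ^+ 2 / 2)) *
       (fine (V Pr X x) / Num.sqrt n%:R)| <= q * (fine (V Pr X x) / Num.sqrt n%:R).
  move=> v0 q0; have [r r0 [n0 hn0]] := limit_beyond M hx0 v0 q0.
  have /cvgrPdist_le/(_ r r0) hr := hdelta0.
  near=> n.
  have n0n : (n0 <= n)%N by near: n; exact: nbhs_infty_ge.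
  have [npos hn] := hn0 n n0n.
  split=> // x; rewrite /= in_itv/= => /andP[xx xd].
  have x_gt0 : 0 < x by exact: lt_le_trans xx.
  have [V1 V2] := lubV x x_gt0.
  have sn : 0 < Num.sqrt n%:R :> R by rewrite sqrtr_gt0 ltr0n.
  split.
    rewrite divr_gt0//; have := V1 0%N; rewrite /e (alive_init (H x x_gt0)).
      exact: lt_le_trans.
    exact: lin_growth_id.
  apply: (hn x (e x) (c x)) => //; first exact: H.
  apply: (le_trans xd); rewrite ler_wpM2r ?(ltW sn)//.
  have : `|0 - delta n| <= r by near: n.
  by rewrite sub0r normrN; apply: le_trans; exact: ler_norm.
have eq0 x n : 0 < x -> e x n (above (0 * Num.sqrt n%:R)) = e x n (fun=> 1).
  move=> x_gt0; have l1 := @lin_growth_cst R 1; have la := @lin_growth_above R 0.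
  rewrite mul0r; apply/eqP; rewrite eq_le; apply/andP.
  by split; apply: (alive_le (H x x_gt0)) => // y y0; rewrite /above y0.
have xpos n x : `[x0, delta n * Num.sqrt n%:R]%classic x -> 0 < x.
  by rewrite /= in_itv/= => /andP[xx _]; exact: lt_le_trans xx.
split.
  move=> eps eps0.
  have q0 : 0 < c0 * eps / 2 by rewrite divr_gt0// mulr_gt0.
  apply: filterS (beyond 0 _ (lexx 0) q0) => n [npos hn] x Ix.
  have [Vn0 h] := hn x Ix.
  rewrite survivalE -/(e x n (fun=> 1)) -(eq0 _ _ (xpos _ _ Ix)).
  move: h; rewrite expr0n/= !mul0r oppr0 expR0 mulr1 -/c0.
  move: (fine (V Pr X x) / Num.sqrt n%:R) Vn0 => Vn Vn0.
  move: (e x n _) => p h.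
  have cV : 0 < c0 * Vn by rewrite mulr_gt0.
  have -> : p / (c0 * Vn) - 1 = (p - c0 * Vn) / (c0 * Vn) by field; rewrite !gt_eqF.
  rewrite normrM normfV (gtr0_norm cV) ltr_pdivrMr//; apply: (le_lt_trans h).
  have : 0 < eps * (c0 * Vn) by rewrite mulr_gt0.
  by lra.
move=> v v0 eps eps0.
(* the first bound keeps the survival probability away from [0], the second one
   controls the two errors in the quotient *)
pose q := Num.min (c0 / 2) (c0 * eps / 8).
have q0 : 0 < q by rewrite lt_min !divr_gt0// mulr_gt0.
have q1 : q <= c0 / 2 by rewrite /q ge_min lexx.
have q2 : q <= c0 * eps / 8 by rewrite /q ge_min lexx orbT.
apply: filterS2 (beyond 0 _ (lexx 0) q0) (beyond v _ v0 q0).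
move=> n [npos hn] [_ hnv] x Ix.
have [Vn0 h] := hn x Ix; have [_ hv] := hnv x Ix.
rewrite /cond_prob survival_beyondE// survivalE.
rewrite -/(e x n (fun=> 1)) -/(e x n (above _)) -(eq0 _ n (xpos _ _ Ix)).
move: h hv; rewrite expr0n/= !mul0r oppr0 expR0 mulr1.
have E0 : 0 <= expR (- (v ^+ 2 / 2)) by exact: expR_ge0.
have E1 : expR (- (v ^+ 2 / 2)) <= 1.
  by rewrite -expR0 ler_expR oppr_le0 divr_ge0// sqr_ge0.
move: (expR (- (v ^+ 2 / 2))) E0 E1 => E E0 E1.
move: (fine (V Pr X x) / Num.sqrt n%:R) Vn0 => Vn Vn0.
move: (e x n (above 0)) (e x n (above (v * _))) => p N hp hN.
have qV : q * Vn <= c0 / 2 * Vn by rewrite ler_wpM2r// ltW.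
have p_ge : c0 / 2 * Vn <= p by move: hp; rewrite ler_norml => /andP[]; lra.
have p0 : 0 < p by apply: lt_le_trans p_ge; rewrite mulr_gt0// divr_gt0.
have -> : N / p - E = (N - E * p) / p by field; rewrite gt_eqF.
rewrite normrM normfV (gtr0_norm p0) ltr_pdivrMr//.
have -> : N - E * p = (N - c0 * E * Vn) - E * (p - c0 * Vn) by ring.
apply: (le_lt_trans (ler_normB _ _)).
have hE : `|E * (p - c0 * Vn)| <= q * Vn.
  rewrite normrM ger0_norm//; apply: le_trans hp.
  by rewrite ler_piMl.
have qe : q * Vn <= c0 * eps / 8 * Vn by rewrite ler_wpM2r// ltW.
have pe := ler_wpM2l (ltW eps0) p_ge.
have : 0 < c0 * eps * Vn by rewrite !mulr_gt0.
lra.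
Unshelve. all: by end_near. Qed.
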